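(* Let $A$ be a right regular Noetherian $\mathbb{Z}$-graded ring. Then $$K_0^{\mathrm{gr}}(A)\big/\big\langle\, [P(1)]-[P]\,\big\rangle\;\cong\;K_0(A),$$ where $\langle [P(1)]-[P]\rangle$ is the subgroup generated by all elements $[P(1)]-[P]$ with $P$ a graded finitely generated projective $A$-module.
   Context: Rings have an identity; modules are right modules. For a $\mathbb{Z}$-graded ring $A$ and a graded right $A$-module $M=\bigoplus_k M_k$, the shift $M(1)$ is the graded module with $M(1)_k=M_{1+k}$. $K_0^{\mathrm{gr}}(A)$ is the group completion of the monoid (under $\oplus$) of graded (degree-preserving) isomorphism classes $[P]$ of graded finitely generated projective right $A$-modules; $K_0(A)$ is the usual Grothendieck group of finitely generated projective right $A$-modules. ''Right regular Noetherian'' for a graded ring $A$ means: $A$ is graded right Noetherian (ascending chain condition on graded right ideals) and graded right regular, i.e. the graded right global dimension of $A$ (the supremum, over all graded right $A$-modules, of the minimal length of a resolution by graded projective modules) is finite. *)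

(* Defs.v *)
From HB Require Import structures.
From mathcomp Require Import all_boot all_order all_algebra.
From mathcomp Require Import boolp.

Set Implicit Arguments.
Unset Strict Implicit.
Unset Printing Implicit Defensive.

Import GRing.Theory.
Local Open Scope ring_scope.

(* The type of all modules, hence that of their isomorphism classes, is too    *)
(* large to carry a zmodType (universe inconsistency); hence the bare records *)
(* below for commutative monoids and abelian groups.                          *)

Record abMonoid := AbMonoid {
  am_car :> Type;
  am_zero : am_car;
  am_add : am_car -> am_car -> am_car;
  am_addA : associative am_add;
  am_addC : commutative am_add;
  am_add0 : left_id am_zero am_add }.

Record abGroup := AbGroup {
  ag_monoid :> abMonoid;
  ag_opp : ag_monoid -> ag_monoid;
  ag_addN : left_inverse (am_zero ag_monoid) ag_opp (@am_add ag_monoid) }.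

Definition ag_sub (G : abGroup) (x y : G) : G := am_add x (ag_opp y).

Definition ag_isomorphic (G H : abGroup) : Prop :=
  exists f : G -> H,
    bijective f /\ forall x y, f (am_add x y) = am_add (f x) (f y).

Section Quotient.
Variables (T : Type) (R : T -> T -> Prop).

Definition equivalence : Prop :=
  [/\ forall x, R x x, forall x y, R x y -> R y x
    & forall x y z, R x y -> R y z -> R x z].

Definition quot : Type := {C : T -> Prop | exists x, C = R x}.

Definition cls (x : T) : quot := exist _ (R x) (ex_intro _ x erefl).

Definition rep (C : quot) : T := projT1 (cid (proj2_sig C)).

Lemma repK (C : quot) : cls (rep C) = C.
Proof.
rewrite /rep; case: C => C HC /=; case: cid => x /= Cx; apply: eq_exist => /=.
by rewrite Cx.
Qed.

Hypothesis Req : equivalence.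

Lemma clsP x y : cls x = cls y <-> R x y.
Proof.
case: Req => Rxx Rs Rt; split=> [/(congr1 (@proj1_sig _ _)) /= ->|Rxy] //.
apply: eq_exist => /=; apply: funext => z; apply: propext; split.
  exact/Rt/Rs.
exact: Rt.
Qed.

Lemma rep_cls x : R (rep (cls x)) x.
Proof. by apply/clsP; rewrite repK. Qed.

End Quotient.

Section QuotientMonoid.
Variables (T : Type) (R : T -> T -> Prop) (zero : T) (add : T -> T -> T).
Hypothesis Req : equivalence R.
Hypothesis addR : forall x x' y y', R x x' -> R y y' -> R (add x y) (add x' y').
Hypothesis addA : forall x y z, R (add x (add y z)) (add (add x y) z).
Hypothesis addC : forall x y, R (add x y) (add y x).
Hypothesis add0 : forall x, R (add zero x) x.

Definition quot_add (C D : quot R) : quot R := cls R (add (rep C) (rep D)).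

Lemma quot_addE x y : quot_add (cls R x) (cls R y) = cls R (add x y).
Proof. by apply/(clsP Req)/addR; apply: rep_cls. Qed.

Lemma quot_addA : associative quot_add.
Proof.
move=> C D E; rewrite -(repK C) -(repK D) -(repK E) !quot_addE.
exact/(clsP Req)/addA.
Qed.

Lemma quot_addC : commutative quot_add.
Proof.
by move=> C D; rewrite -(repK C) -(repK D) !quot_addE; apply/(clsP Req)/addC.
Qed.

Lemma quot_add0 : left_id (cls R zero) quot_add.
Proof. by move=> C; rewrite -(repK C) quot_addE; apply/(clsP Req)/add0. Qed.

Definition quot_monoid : abMonoid := AbMonoid quot_addA quot_addC quot_add0.

End QuotientMonoid.

(* The pair (a, b) stands for the formal difference a - b. *)
HB.instance Definition _ (M : abMonoid) := Monoid.isComLaw.Build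
  M (am_zero M) (@am_add M) (@am_addA M) (@am_addC M) (@am_add0 M).

Section GroupCompletion.
Variable M : abMonoid.
Local Notation "a +! b" := (@am_add M a b) (at level 50, left associativity).

Definition gc_eq (p q : M * M) : Prop :=
  exists k : M, (p.1 +! q.2) +! k = (q.1 +! p.2) +! k.
Definition gc_add (p q : M * M) : M * M := (p.1 +! q.1, p.2 +! q.2).
Definition gc_zero : M * M := (am_zero M, am_zero M).

Let addACA : interchange (@am_add M) (@am_add M).
Proof.
move=> a b c d; rewrite -!am_addA; congr (_ +! _).
by rewrite !am_addA (am_addC b).
Qed.

Lemma gc_equiv : equivalence gc_eq.
Proof.
split=> [p|p q [k E]|p q r [k Ek] [l El]]; first by exists (am_zero M).
  by exists k.
exists ((q.1 +! q.2) +! (k +! l)).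
rewrite [LHS](AC (2*(2*2)) ((1*4*5)*(3*2*6))) /= Ek El.
by rewrite [LHS](AC (3*3) ((4*2)*((1*5)*(3*6)))).
Qed.

Lemma gc_addR p p' q q' :
  gc_eq p p' -> gc_eq q q' -> gc_eq (gc_add p q) (gc_add p' q').
Proof.
move=> [k Ek] [l El]; exists (k +! l) => /=.
by rewrite (addACA p.1) (addACA p'.1) addACA Ek El addACA.
Qed.

Lemma gc_addA p q r : gc_eq (gc_add p (gc_add q r)) (gc_add (gc_add p q) r).
Proof. by exists (am_zero M); rewrite /gc_add /= !am_addA. Qed.

Lemma gc_addC p q : gc_eq (gc_add p q) (gc_add q p).
Proof.
by exists (am_zero M); rewrite /gc_add /= (am_addC p.1) (am_addC p.2).
Qed.

Lemma gc_add0 p : gc_eq (gc_add gc_zero p) p.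
Proof. by exists (am_zero M); rewrite /gc_add /= !am_add0. Qed.

Definition gc_monoid : abMonoid :=
  quot_monoid gc_equiv gc_addR gc_addA gc_addC gc_add0.

Definition gc_opp (x : gc_monoid) : gc_monoid :=
  cls gc_eq ((rep x).2, (rep x).1).

Lemma gc_addN : left_inverse (am_zero gc_monoid) gc_opp (@am_add gc_monoid).
Proof.
move=> x; rewrite -{2}(repK x) /= (quot_addE gc_equiv gc_addR).
apply/(clsP gc_equiv); exists (am_zero M) => /=.
by rewrite (am_addC (rep x).2) am_addC [in RHS](am_addC _ (_ +! _))
  ?(am_addC _ (am_zero M)) ?am_add0.
Qed.

Definition group_completion : abGroup := AbGroup gc_addN.

Definition gc_class (a : M) : group_completion :=
  cls gc_eq (a, am_zero M).

End GroupCompletion.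

Definition is_subgroup (G : abGroup) (H : G -> Prop) : Prop :=
  H (am_zero G) /\ forall x y, H x -> H y -> H (ag_sub x y).

Definition subgroup_gen (G : abGroup) (S : G -> Prop) : G -> Prop :=
  fun x => forall H : G -> Prop,
    is_subgroup H -> (forall y, S y -> H y) -> H x.

Lemma subgroup_genP (G : abGroup) (S : G -> Prop) :
  is_subgroup (subgroup_gen S).
Proof.
split=> [H [H0 _] _ //|x y Sx Sy H Hs HS].
by apply: (proj2 Hs); [apply: Sx|apply: Sy].
Qed.

Section QuotientGroup.
Variables (G : abGroup) (H : G -> Prop).
Hypothesis Hs : is_subgroup H.
Local Notation "a +! b" := (@am_add G a b) (at level 50, left associativity).
Local Notation opp := (@ag_opp G).

Definition cong (x y : G) : Prop := H (ag_sub x y).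

Let addrN x : x +! opp x = am_zero G. Proof. by rewrite am_addC ag_addN. Qed.
Let addKl x : cancel (am_add x) (am_add (opp x)).
Proof. by move=> y; rewrite am_addA ag_addN am_add0. Qed.
Let addI x y z : x +! y = x +! z -> y = z.
Proof. exact: (can_inj (addKl x)). Qed.
Let oppK x : opp (opp x) = x.
Proof. by apply: (@addI (opp x)); rewrite addrN ag_addN. Qed.
Let addACA : interchange (@am_add G) (@am_add G).
Proof.
move=> a b c d; rewrite -!am_addA; congr (_ +! _).
by rewrite !am_addA (am_addC b).
Qed.
Let oppD x y : opp (x +! y) = opp x +! opp y.
Proof. by apply: (@addI (x +! y)); rewrite addrN addACA !addrN am_add0. Qed.
Let HN x : H x -> H (opp x).
Proof.
by case: Hs => H0 HB Hx; rewrite -[opp x]am_add0; apply: HB.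
Qed.
Let HD x y : H x -> H y -> H (x +! y).
Proof.
by case: (Hs) => _ HB Hx /HN Hy; rewrite -[y]oppK; apply: HB.
Qed.

Lemma cong_equiv : equivalence cong.
Proof.
split=> [x|x y /HN|x y z Hxy /(HD Hxy)]; rewrite /cong /ag_sub.
- by rewrite addrN; case: Hs.
- by rewrite oppD oppK am_addC.
- by rewrite -am_addA (am_addA (opp y)) ag_addN am_add0.
Qed.

Lemma cong_addR x x' y y' :
  cong x x' -> cong y y' -> cong (x +! y) (x' +! y').
Proof. by move=> Hx /(HD Hx); rewrite /cong /ag_sub oppD addACA. Qed.

Let eq_cong x y : x = y -> cong x y.
Proof. by move=> ->; case: cong_equiv. Qed.

Definition quotg_monoid : abMonoid :=
  quot_monoid cong_equiv cong_addR
    (fun x y z => eq_cong (am_addA x y z)) (fun x y => eq_cong (am_addC x y))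
    (fun x => eq_cong (am_add0 x)).

Definition quotg_opp (x : quotg_monoid) : quotg_monoid :=
  cls cong (opp (rep x)).

Lemma quotg_addN :
  left_inverse (am_zero quotg_monoid) quotg_opp (@am_add quotg_monoid).
Proof.
move=> x; rewrite -{2}(repK x) /= (quot_addE cong_equiv cong_addR).
by apply/(clsP cong_equiv)/eq_cong; rewrite ag_addN.
Qed.

Definition quotient_group : abGroup := AbGroup quotg_addN.

End QuotientGroup.

(* Right modules over A are left modules over the converse ring: for          *)
(* a : A^c, the element a *: m is the usual m a.                              *)
Notation rmodType A :=
  (lmodType (GRing.GRing_converse__canonical__GRing_PzRing A)).

Section Modules.
Variable A : pzRingType.

Definition isomorphic (M N : rmodType A) : Prop :=
  exists (f : {linear M -> N}) (g : {linear N -> M}), cancel f g /\ cancel g f.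

Definition finitely_generated (M : rmodType A) : Prop :=
  exists (n : nat) (e : 'I_n -> M), forall x : M,
  exists a : 'I_n -> A^c, x = \sum_i a i *: e i.

Definition projective (P : rmodType A) : Prop :=
  forall (N L : rmodType A) (p : {linear N -> L}) (f : {linear P -> L}),
    (forall y, exists x, p x = y) ->
    exists g : {linear P -> N}, forall x, p (g x) = f x.

Record fgProj := FgProj {
  fgp_mod :> rmodType A;
  fgp_fg : finitely_generated fgp_mod;
  fgp_proj : projective fgp_mod }.

End Modules.

(* V is the internal direct sum of its subgroups G k. *)
Record direct_grading (V : zmodType) (G : int -> V -> Prop) : Prop := {
  grading0 : forall k, G k 0;
  gradingB : forall k x y, G k x -> G k y -> G k (x - y);
  grading_span : forall x, exists s : seq V,
    (forall y, y \in s -> exists k, G k y) /\ x = \sum_(y <- s) y;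
  grading_free : forall (s : seq int) (f : int -> V), uniq s ->
    (forall k, G k (f k)) -> \sum_(k <- s) f k = 0 ->
    forall k, k \in s -> f k = 0 }.

Record grRing := GrRing {
  gr_ring :> pzRingType;
  gr_comp : int -> gr_ring -> Prop;
  gr_compP : direct_grading gr_comp;
  gr_comp1 : gr_comp 0 1;
  gr_compM : forall i j a b,
    gr_comp i a -> gr_comp j b -> gr_comp (i + j) (a * b) }.

Record grMod (A : grRing) := GrMod {
  gm_mod :> rmodType A;
  gm_comp : int -> gm_mod -> Prop;
  gm_compP : direct_grading gm_comp;
  gm_compZ : forall i j m (a : A),
    gm_comp i m -> gr_comp j a -> gm_comp (i + j) ((a : A^c) *: m) }.

Section GradedModules.
Variable A : grRing.
Implicit Types M N L P : grMod A.

Definition degree0 M N (f : M -> N) : Prop :=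
  forall k m, gm_comp k m -> gm_comp k (f m).

Definition gr_isomorphic M N : Prop :=
  exists (f : {linear M -> N}) (g : {linear N -> M}),
    [/\ degree0 f, degree0 g, cancel f g & cancel g f].

(* Projective object of the category of graded modules. *)
Definition gr_projective P : Prop :=
  forall N L (p : {linear N -> L}) (f : {linear P -> L}),
    degree0 p -> degree0 f -> (forall y, exists x, p x = y) ->
    exists g : {linear P -> N}, degree0 g /\ forall x, p (g x) = f x.

Record grFgProj := GrFgProj {
  gfp_mod :> grMod A;
  gfp_fg : finitely_generated gfp_mod;
  gfp_proj : gr_projective gfp_mod }.

(* Exact  ... -> P_1 -> P_0 -> M -> 0  with P_i = 0 for i > n. *)
Definition gr_proj_resolution M (n : nat) : Prop :=
  exists (P : nat -> grMod A) (eps : {linear P 0%N -> M})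
         (d : forall i, {linear P i.+1 -> P i}),
    [/\ forall i, gr_projective (P i),
        degree0 eps /\ (forall i, degree0 (d i)),
        (forall y, exists x, eps x = y) /\
          (forall x, eps x = 0 <-> exists y, d 0%N y = x),
        forall i x, d i x = 0 <-> exists y, d i.+1 y = x
      & forall i, (n < i)%N -> forall x : P i, x = 0].

Definition gr_projdim M (n : nat) : Prop :=
  gr_proj_resolution M n /\
  forall m, gr_proj_resolution M m -> (n <= m)%N.

(* The supremum of the projective dimensions is the natural number d; in      *)
(* particular every graded module has finite projective dimension.            *)
Definition gr_gldim (d : nat) : Prop :=
  (forall M, exists2 n, gr_projdim M n & (n <= d)%N) /\
  forall e, (forall M, exists2 n, gr_projdim M n & (n <= e)%N) -> (d <= e)%N.

Definition gr_right_regular : Prop := exists d, gr_gldim d.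

Definition gr_right_ideal (I : A -> Prop) : Prop :=
  [/\ I 0, forall x y, I x -> I y -> I (x + y),
      forall x a, I x -> I (x * a)
    & forall x, I x -> exists s : seq A,
        (forall y, y \in s -> I y /\ exists k, gr_comp k y) /\
        x = \sum_(y <- s) y].

Definition gr_right_noetherian : Prop :=
  forall I : nat -> A -> Prop,
    (forall n, gr_right_ideal (I n)) ->
    (forall n x, I n x -> I n.+1 x) ->
    exists n0, forall n, (n0 <= n)%N -> forall x, I n x <-> I n0 x.

End GradedModules.

Definition mklin (R : pzRingType) (M N : lmodType R) (f : M -> N)
  (fL : linear f) : {linear M -> N} :=
  HB.pack f (GRing.isLinear.Build R M N *:%R f fL).

Section DirectSum.
Variable A : pzRingType.
Implicit Types M N : rmodType A.

Definition zero_mod : rmodType A := 'rV[A^c]_0.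
Definition dsum M N : rmodType A := (M * N)%type.

Lemma zero_modE (x : zero_mod) : x = 0.
Proof. by apply/rowP => -[]. Qed.

Lemma zero_mod_fg : finitely_generated zero_mod.
Proof.
exists 0%N, (fun=> 0) => x; exists (fun=> 0).
by rewrite big_ord0; apply: zero_modE.
Qed.

Lemma dsum_fg M N :
  finitely_generated M -> finitely_generated N -> finitely_generated (dsum M N).
Proof.
move=> [m [e eP]] [n [e' e'P]]; exists (m + n)%N.
exists (fun i => match split i with inl j => (e j, 0) | inr j => (0, e' j) end).
move=> [x y]; have [a ->] := eP x; have [b ->] := e'P y.
exists (fun i => match split i with inl j => a j | inr j => b j end).
rewrite big_split_ord /=.
have sl (i : 'I_m) : split (lshift n i) = inl i := unsplitK (inl i).
have sr (i : 'I_n) : split (rshift m i) = inr i := unsplitK (inr i).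
under [X in _ = X + _]eq_bigr => i _ do rewrite sl.
under [X in _ = _ + X]eq_bigr => i _ do rewrite sr.
have E (I : finType) (F : I -> dsum M N) :
    \sum_i F i = (\sum_i (F i).1, \sum_i (F i).2).
  by elim/big_rec3: _ => // i u v w _ ->; case: (F i).
rewrite !E /=; congr (_, _).
  by rewrite [X in _ + X]big1 ?addr0 // => i _; exact: scaler0.
by rewrite [X in X + _]big1 ?add0r // => i _; exact: scaler0.
Qed.

Lemma inl_linear M N : linear (fun x : M => (x, 0) : dsum M N).
Proof. by move=> a u v; congr (_, _) => /=; rewrite ?scaler0 ?addr0. Qed.

Lemma inr_linear M N : linear (fun x : N => (0, x) : dsum M N).
Proof. by move=> a u v; congr (_, _) => /=; rewrite ?scaler0 ?addr0. Qed.

Lemma copair_linear M N (L : rmodType A)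
    (f : {linear M -> L}) (g : {linear N -> L}) :
  linear (fun x : dsum M N => f x.1 + g x.2).
Proof. by move=> a u v /=; rewrite !linearP scalerDr addrACA. Qed.

Lemma pair_linear M N (L : rmodType A)
    (f : {linear L -> M}) (g : {linear L -> N}) :
  linear (fun x => (f x, g x) : dsum M N).
Proof. by move=> a u v /=; rewrite !linearP. Qed.

Lemma map_linear M N (M' N' : rmodType A)
    (f : {linear M -> M'}) (g : {linear N -> N'}) :
  linear (fun x : dsum M N => (f x.1, g x.2) : dsum M' N').
Proof. by move=> a u v /=; rewrite !linearP. Qed.

Lemma swap_linear M N : linear (fun x : dsum M N => (x.2, x.1) : dsum N M).
Proof. by []. Qed.

Lemma assocl_linear M N (L : rmodType A) :
  linear (fun x : dsum M (dsum N L) =>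
    ((x.1, x.2.1), x.2.2) : dsum (dsum M N) L).
Proof. by []. Qed.

Lemma assocr_linear M N (L : rmodType A) :
  linear (fun x : dsum (dsum M N) L =>
    (x.1.1, (x.1.2, x.2)) : dsum M (dsum N L)).
Proof. by []. Qed.

Lemma snd_linear M N : linear (fun x : dsum M N => x.2).
Proof. by []. Qed.

Lemma zero_mod_projective : projective zero_mod.
Proof.
move=> N L p f _; exists (mklin (linearP (\0 : {linear zero_mod -> N}))) => x.
by rewrite (zero_modE x) !raddf0.
Qed.

Lemma dsum_projective M N :
  projective M -> projective N -> projective (dsum M N).
Proof.
move=> PM PN K L p f pS.
have [g gE] := PM K L p (f \o mklin (@inl_linear M N)) pS.
have [h hE] := PN K L p (f \o mklin (@inr_linear M N)) pS.
exists (mklin (copair_linear g h)) => -[x y] /=.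
rewrite linearD gE hE /= -linearD; congr (f _).
by congr (_, _); rewrite ?addr0 ?add0r.
Qed.

Definition fgp_zero : fgProj A := FgProj zero_mod_fg zero_mod_projective.
Definition fgp_dsum (P Q : fgProj A) : fgProj A :=
  FgProj (dsum_fg (fgp_fg P) (fgp_fg Q))
         (dsum_projective (@fgp_proj _ P) (@fgp_proj _ Q)).

Definition fgp_iso (P Q : fgProj A) : Prop := isomorphic P Q.

Lemma fgp_iso_equiv : equivalence fgp_iso.
Proof.
split=> [P|P Q [f [g [fK gK]]]|P Q L [f [g [fK gK]]] [f' [g' [fK' gK']]]].
- by exists idfun, idfun.
- by exists g, f.
- exists (f' \o f), (g \o g'); split=> x /=; first by rewrite fK' fK.
  by rewrite gK gK'.
Qed.

Lemma fgp_dsum_iso P P' Q Q' :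
  fgp_iso P P' -> fgp_iso Q Q' -> fgp_iso (fgp_dsum P Q) (fgp_dsum P' Q').
Proof.
move=> [f [g [fK gK]]] [f' [g' [fK' gK']]].
exists (mklin (map_linear f f')), (mklin (map_linear g g')).
by split=> -[x y] /=; rewrite ?fK ?fK' ?gK ?gK'.
Qed.

Lemma fgp_dsumA P Q L :
  fgp_iso (fgp_dsum P (fgp_dsum Q L)) (fgp_dsum (fgp_dsum P Q) L).
Proof.
exists (mklin (@assocl_linear P Q L)), (mklin (@assocr_linear P Q L)).
by split=> [[x [y z]]|[[x y] z]].
Qed.

Lemma fgp_dsumC P Q : fgp_iso (fgp_dsum P Q) (fgp_dsum Q P).
Proof.
exists (mklin (@swap_linear P Q)), (mklin (@swap_linear Q P)).
by split=> -[x y].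
Qed.

Lemma fgp_dsum0 P : fgp_iso (fgp_dsum fgp_zero P) P.
Proof.
exists (mklin (@snd_linear zero_mod P)), (mklin (@inr_linear zero_mod P)).
by split=> [[x y]|y] //=; rewrite (zero_modE x).
Qed.

Definition K0_monoid : abMonoid :=
  quot_monoid fgp_iso_equiv fgp_dsum_iso fgp_dsumA fgp_dsumC fgp_dsum0.

Definition K0 : abGroup := group_completion K0_monoid.

End DirectSum.

Section GradedDirectSum.
Variable A : grRing.
Implicit Types M N L : grMod A.

Fact gr_zero_grading : direct_grading (fun (_ : int) (_ : zero_mod A) => True).
Proof.
split=> // [x|s f _ _ _ k _]; last exact: zero_modE.
by exists [::]; split=> //; rewrite big_nil; apply: zero_modE.
Qed.

Definition gr_zero : grMod A :=
  @GrMod A (zero_mod A) (fun _ _ => True) gr_zero_grading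
    (fun _ _ _ _ _ _ => I).

Fact gr_dsum_grading M N : direct_grading
  (fun k (x : dsum M N) => gm_comp k x.1 /\ gm_comp k x.2).
Proof.
have GM := gm_compP M; have GN := gm_compP N.
split=> [k|k x y [x1 x2] [y1 y2]|[x y]|s f us fG f0 k ks].
- by split; apply: grading0.
- by split; apply: gradingB.
- have [s [sG ->]] := grading_span GM x; have [t [tG ->]] := grading_span GN y.
  exists ([seq (u, 0) | u <- s] ++ [seq (0, u) | u <- t]); split.
    move=> u; rewrite mem_cat => /orP[]/mapP[v vi ->].
      by have [k vk] := sG _ vi; exists k; split=> //; apply: grading0.
    by have [k vk] := tG _ vi; exists k; split=> //; apply: grading0.
  rewrite big_cat !big_map /=.
  rewrite -(raddf_sum (mklin (@inl_linear A M N))).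
  rewrite -(raddf_sum (mklin (@inr_linear A M N))).
  by congr (_, _); rewrite ?addr0 ?add0r.
- have f1 : \sum_(k <- s) (f k).1 = 0.
    by rewrite -[RHS](congr1 fst f0) (raddf_sum fst).
  have f2 : \sum_(k <- s) (f k).2 = 0.
    by rewrite -[RHS](congr1 snd f0) (raddf_sum snd).
  rewrite [f k]surjective_pairing.
  rewrite (grading_free GM us (fun k => proj1 (fG k)) f1 ks).
  by rewrite (grading_free GN us (fun k => proj2 (fG k)) f2 ks).
Qed.

Fact gr_dsum_scale M N i j (m : dsum M N) (a : A) :
  gm_comp i m.1 /\ gm_comp i m.2 -> gr_comp j a ->
  gm_comp (i + j) ((a : A^c) *: m).1 /\ gm_comp (i + j) ((a : A^c) *: m).2.
Proof. by move=> [m1 m2] aj; split; apply: gm_compZ. Qed.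

Definition gr_dsum M N : grMod A :=
  @GrMod A (dsum M N) (fun k x => gm_comp k x.1 /\ gm_comp k x.2)
    (gr_dsum_grading M N) (@gr_dsum_scale M N).

Fact gr_shift_grading M (n : int) :
  direct_grading (fun k (x : M) => gm_comp (n + k) x).
Proof.
have G := gm_compP M; split=> [k|k x y|x|s f us fG f0 k ks].
- exact: grading0.
- exact: gradingB.
- have [s [sG ->]] := grading_span G x; exists s; split=> // y /sG[k yk].
  by exists (k - n); rewrite addrC subrK.
- have -> : f k = f (n + k - n) by rewrite addrAC subrr add0r.
  apply: (grading_free G (s := [seq n + i | i <- s]) (f := fun i => f (i - n))).
  + by rewrite map_inj_uniq //; apply: addrI.
  + by move=> i; have := fG (i - n); rewrite addrC subrK.
  + by rewrite big_map -[RHS]f0; apply: eq_bigr => i _; rewrite addrAC subrr add0r.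
  + exact: map_f.
Qed.

Fact gr_shift_scale M (n : int) i j (m : M) (a : A) :
  gm_comp (n + i) m -> gr_comp j a -> gm_comp (n + (i + j)) ((a : A^c) *: m).
Proof. by move=> mi aj; rewrite addrA; apply: gm_compZ. Qed.

(* M(n)_k = M_{n+k} *)
Definition gr_shift M (n : int) : grMod A :=
  @GrMod A M (fun k x => gm_comp (n + k) x)
    (gr_shift_grading M n) (@gr_shift_scale M n).

Lemma gr_zero_projective : gr_projective gr_zero.
Proof.
move=> N L p f _ _ _.
exists (mklin (linearP (\0 : {linear zero_mod A -> N}))); split=> [k m _|x].
  exact: (grading0 (gm_compP N) k).
by rewrite (zero_modE x) !raddf0.
Qed.

Lemma gr_dsum_projective M N :
  gr_projective M -> gr_projective N -> gr_projective (gr_dsum M N).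
Proof.
move=> PM PN K L p f p0 f0 pS.
have [|g [g0 gE]] := PM K L p (f \o mklin (@inl_linear A M N)) p0 _ pS.
  by move=> k m mk; apply: f0; split=> //; exact: (grading0 (gm_compP _)).
have [|h [h0 hE]] := PN K L p (f \o mklin (@inr_linear A M N)) p0 _ pS.
  by move=> k m mk; apply: f0; split=> //; exact: (grading0 (gm_compP _)).
exists (mklin (copair_linear g h)); split.
  move=> k [x y] [xk yk] /=; rewrite -[h y]opprK.
  apply: (gradingB (gm_compP K)); first exact: g0.
  rewrite -sub0r; apply: (gradingB (gm_compP K)); last exact: h0.
  exact: (grading0 (gm_compP _)).
move=> [x y] /=; rewrite linearD gE hE /= -linearD; congr (f _).
by congr (_, _); rewrite ?addr0 ?add0r.
Qed.

Lemma gr_shift_projective M n : gr_projective M -> gr_projective (gr_shift M n).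
Proof.
move=> PM N L p f p0 f0 pS.
have [k m|k m mk||g [g0 gE]] := PM (gr_shift N (- n)) (gr_shift L (- n)) p f.
- exact: p0.
- by apply: f0; rewrite /= addNKr.
- exact: pS.
exists g; split=> // k m mk.
by have := g0 _ _ mk; rewrite /= addKr.
Qed.

Definition gfp_zero : grFgProj A :=
  @GrFgProj A gr_zero (zero_mod_fg A) gr_zero_projective.
Definition gfp_dsum (P Q : grFgProj A) : grFgProj A :=
  @GrFgProj A (gr_dsum P Q) (dsum_fg (gfp_fg P) (gfp_fg Q))
    (gr_dsum_projective (@gfp_proj _ P) (@gfp_proj _ Q)).
Definition gfp_shift (P : grFgProj A) (n : int) : grFgProj A :=
  @GrFgProj A (gr_shift P n) (gfp_fg P)
    (@gr_shift_projective P n (@gfp_proj _ P)).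

Definition gfp_iso (P Q : grFgProj A) : Prop := gr_isomorphic P Q.

Lemma gfp_iso_equiv : equivalence gfp_iso.
Proof.
split=> [P|P Q [f [g [f0 g0 fK gK]]]|].
- by exists idfun, idfun; split.
- by exists g, f; split.
move=> P Q L [f [g [f0 g0 fK gK]]] [f' [g' [f0' g0' fK' gK']]].
exists (f' \o f), (g \o g'); split=> [k m mk|k m mk|x|x] /=.
- by apply: f0'; apply: f0.
- by apply: g0; apply: g0'.
- by rewrite fK' fK.
- by rewrite gK gK'.
Qed.

Lemma gfp_dsum_iso P P' Q Q' :
  gfp_iso P P' -> gfp_iso Q Q' -> gfp_iso (gfp_dsum P Q) (gfp_dsum P' Q').
Proof.
move=> [f [g [f0 g0 fK gK]]] [f' [g' [f0' g0' fK' gK']]].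
exists (mklin (map_linear f f')), (mklin (map_linear g g')).
split=> [k [x y] [xk yk]|k [x y] [xk yk]|[x y]|[x y]] /=.
- by split; [apply: f0|apply: f0'].
- by split; [apply: g0|apply: g0'].
- by rewrite fK fK'.
- by rewrite gK gK'.
Qed.

Lemma gfp_dsumA P Q (L : grFgProj A) :
  gfp_iso (gfp_dsum P (gfp_dsum Q L)) (gfp_dsum (gfp_dsum P Q) L).
Proof.
exists (mklin (@assocl_linear A P Q L)), (mklin (@assocr_linear A P Q L)).
split=> [k [x [y z]] [? []]|k [[x y] z] [[]]|[x [y z]]|[[x y] z]] //=.
Qed.

Lemma gfp_dsumC P Q : gfp_iso (gfp_dsum P Q) (gfp_dsum Q P).
Proof.
exists (mklin (@swap_linear A P Q)), (mklin (@swap_linear A Q P)).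
by split=> [k [x y] []|k [x y] []|[x y]|[x y]].
Qed.

Lemma gfp_dsum0 P : gfp_iso (gfp_dsum gfp_zero P) P.
Proof.
exists (mklin (@snd_linear A (zero_mod A) P)).
exists (mklin (@inr_linear A (zero_mod A) P)).
by split=> [k [x y] []|k y|[x y]|y] //=; rewrite (zero_modE x).
Qed.

Definition K0gr_monoid : abMonoid :=
  quot_monoid gfp_iso_equiv gfp_dsum_iso gfp_dsumA gfp_dsumC gfp_dsum0.

Definition K0gr : abGroup := group_completion K0gr_monoid.

Definition K0gr_class (P : grFgProj A) : K0gr := @gc_class K0gr_monoid (cls gfp_iso P).

Definition shift_diff (x : K0gr) : Prop :=
  exists P : grFgProj A, x = ag_sub (K0gr_class (gfp_shift P 1)) (K0gr_class P).

End GradedDirectSum.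

(* Main.v *)
Require Import Defs.
From HB Require Import structures.
From mathcomp Require Import all_boot all_order all_algebra.
From mathcomp Require Import boolp zify.

(** Forgetting the grading sends [P(1)] and [P] to the same class, hence induces
    a map phi from the quotient of the graded Grothendieck group to K0(A). It is
    an isomorphism because an ungraded finitely generated projective P has an
    associated graded module, whose Euler characteristic in the quotient is the
    inverse image of [P].

    Euler characteristics. As A is graded right Noetherian and of finite graded
    global dimension, every finitely generated graded module M has a finite
    resolution by finitely generated graded projectives ([euler_ex]). The
    alternating sum chi(M) of its classes does not depend on the resolution
    ([euler_uniq], by Schanuel's lemma) and is additive on exact sequences
    ([euler_ses], by the horseshoe lemma).

    The inverse map. Let t^k have degree k, so that P[t, 1/t] is a graded
    A-module with an automorphism t of degree one. A good filtration of P amounts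
    to a graded A[t]-submodule R of P[t, 1/t] which is finitely generated and
    whose translates t^-n R exhaust P[t, 1/t]; its associated graded module is
    R/tR. If R <= R' <= t^-1 R, then R'/tR' is an extension of R'/R by R/tR',
    while R/tR is an extension of R/tR' by tR'/tR, a shift of R'/R. So R/tR and
    R'/tR' have the same Euler characteristic modulo shifts
    ([lattice_interlace]), and any two good filtrations are linked by such steps
    ([good_chi_uniq]). Thus psi [P] = chi(R/tR) is well defined, and it is
    additive. If P is graded, it is its own associated graded module for the
    filtration by degree, so psi (phi [P]) = [P] ([pclass_graded]). Only
    submodules of P[t, 1/t] occur in these arguments: chi(Y/X) is read as
    chi(V) - chi(V meet X), where V is any finitely generated graded submodule
    with V + X = Y ([chi_quo]).

    Surjectivity of phi. Let pi map a finitely generated graded module F onto P,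
    let V be the image of F in P[t, 1/t], and G_n = V + tV + ... + t^n V. For n
    large the sequence 0 -> G_n -> G_(n+1) -> P -> 0, given by multiplication by
    1 - t and by t = 1, is exact ([rees_ses]): the generators of the kernel of pi
    involve a bounded range of degrees. Hence [P] = phi(chi G_(n+1)) - phi(chi
    G_n). The Euler characteristics of ungraded modules used here are those of
    graded modules over A with all of A in degree zero. *)

Set Implicit Arguments.
Unset Strict Implicit.
Unset Printing Implicit Defensive.

Import Order.TTheory GRing.Theory Num.Theory.
Local Open Scope ring_scope.

(** * Homogeneous components *)

Lemma big_support (V : zmodType) (s s' : seq int) (f : int -> V) :
    uniq s -> uniq s' ->
    (forall k, k \notin s -> f k = 0) -> (forall k, k \notin s' -> f k = 0) ->
  \sum_(k <- s) f k = \sum_(k <- s') f k.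
Proof.
move=> us us' fs fs'.
have E r : \sum_(k <- r) f k = \sum_(k <- [seq k <- r | f k != 0]) f k.
  by rewrite big_filter [LHS](bigID (fun k => f k != 0)) /= [X in _ + X]big1
    ?addr0 // => k /negPn/eqP.
rewrite E [RHS]E; apply/perm_big/uniq_perm; rewrite ?filter_uniq // => k.
rewrite !mem_filter; case: eqVneq => //= fk.
have mem r : (forall k, k \notin r -> f k = 0) -> k \in r.
  by move=> fr; apply/negPn/negP => /fr fk0; rewrite fk0 eqxx in fk.
by rewrite !mem.
Qed.

Section Gradings.
Variables (V : zmodType) (G : int -> V -> Prop).
Hypothesis hG : direct_grading G.

Lemma gradingN k x : G k x -> G k (- x).
Proof. by move=> Gx; rewrite -sub0r; apply: gradingB => //; apply: grading0. Qed.

Lemma gradingD k x y : G k x -> G k y -> G k (x + y).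
Proof. by move=> Gx Gy; rewrite -[y]opprK; apply: gradingB => //; apply: gradingN. Qed.

Definition decomposes x (s : seq int) (f : int -> V) : Prop :=
  [/\ uniq s, forall k, G k (f k), forall k, k \notin s -> f k = 0
    & x = \sum_(k <- s) f k].

Lemma decomposes_hom k x :
  G k x -> decomposes x [:: k] (fun i => if i == k then x else 0).
Proof.
move=> Gx; split=> // [i|i|]; last by rewrite big_seq1 eqxx.
  by case: eqP => [->//|_]; apply: grading0.
by rewrite inE => /negPf ->.
Qed.

Lemma decomposesB x y s t f g : decomposes x s f -> decomposes y t g ->
  decomposes (x - y) (undup (s ++ t)) (fun k => f k - g k).
Proof.
move=> [us Gf fs ->] [ut Gg gt ->]; split=> [|k|k|]; first exact: undup_uniq.
- exact: gradingB.
- by rewrite mem_undup mem_cat negb_or => /andP[/fs-> /gt->]; rewrite subr0.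
- rewrite sumrB; congr (_ - _); apply: big_support; rewrite ?undup_uniq //.
    by move=> k; rewrite mem_undup mem_cat negb_or => /andP[/fs].
  by move=> k; rewrite mem_undup mem_cat negb_or => /andP[_ /gt].
Qed.

Lemma decomposes0 : decomposes 0 [::] (fun=> 0).
Proof. by split=> // [k|]; [apply: grading0|rewrite big_nil]. Qed.

Lemma grading_ind (Q : V -> Prop) :
    Q 0 -> (forall k x, G k x -> Q x) -> (forall x y, Q x -> Q y -> Q (x + y)) ->
  forall x, Q x.
Proof.
move=> Q0 QG QD x; have [s [sG ->]] := grading_span hG x.
elim: s sG => [|y s IHs] sG; first by rewrite big_nil.
rewrite big_cons; apply: QD; last by apply: IHs => z zs; apply: sG; rewrite inE zs orbT.
by have [|k /QG] := sG y; first exact: mem_head.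
Qed.

Lemma decomposes_ex x : exists sf : seq int * (int -> V), decomposes x sf.1 sf.2.
Proof.
elim/grading_ind: x => [|k x Gx|x y [[s f] dx] [[t g] dy]].
- by exists ([::], fun=> 0); apply: decomposes0.
- by exists ([:: k], fun i => if i == k then x else 0); apply: decomposes_hom.
rewrite -[y]opprK -[- y]sub0r.
by eexists (_, _); apply: (decomposesB dx (decomposesB decomposes0 dy)).
Qed.

Lemma decomposes_uniq x s t f g :
  decomposes x s f -> decomposes x t g -> f =1 g.
Proof.
move=> dx dy k; have [us Gfg fgs] := decomposesB dx dy.
rewrite subrr => /esym fg0; apply/eqP; rewrite -subr_eq0; apply/eqP.
have [ks|/fgs//] := boolP (k \in undup (s ++ t)).
exact: (grading_free hG us Gfg fg0 ks).
Qed.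

Definition hsupp x : seq int := (projT1 (cid (decomposes_ex x))).1.
Definition hcomp k x : V := (projT1 (cid (decomposes_ex x))).2 k.

Lemma hcompP x : decomposes x (hsupp x) (hcomp^~ x).
Proof. exact: (projT2 (cid (decomposes_ex x))). Qed.

Lemma hcompE x s f : decomposes x s f -> forall k, hcomp k x = f k.
Proof. exact: decomposes_uniq (hcompP x). Qed.

Lemma hcomp_hom k x : G k (hcomp k x).
Proof. by case: (hcompP x). Qed.

Lemma hcomp_sum x : x = \sum_(k <- hsupp x) hcomp k x.
Proof. by case: (hcompP x). Qed.

Lemma hcompB k x y : hcomp k (x - y) = hcomp k x - hcomp k y.
Proof. exact: (hcompE (decomposesB (hcompP x) (hcompP y))). Qed.

Lemma hcomp0 k : hcomp k 0 = 0.
Proof. by rewrite -[0 in LHS](subrr 0) hcompB subrr. Qed.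

Lemma hcompN k x : hcomp k (- x) = - hcomp k x.
Proof. by rewrite -[in LHS]sub0r hcompB hcomp0 sub0r. Qed.

Lemma hcompD k x y : hcomp k (x + y) = hcomp k x + hcomp k y.
Proof. by rewrite -[in LHS](opprK y) hcompB hcompN opprK. Qed.

Lemma hcomp_other j k x : G j x -> hcomp k x = if k == j then x else 0.
Proof. by move=> /decomposes_hom/hcompE. Qed.

Lemma hcomp_id k x : G k x -> hcomp k x = x.
Proof. by move=> /(hcomp_other k); rewrite eqxx. Qed.

Lemma hcomp_eq0 x : (forall k, hcomp k x = 0) -> x = 0.
Proof. by move=> x0; rewrite (hcomp_sum x) big1. Qed.

Section Glue.
Variables (W : zmodType) (h : int -> V -> W).
Hypothesis hB : forall k x y, h k (x - y) = h k x - h k y.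

(** Universal property of the direct sum of the components. *)
Definition glue x : W := \sum_(k <- hsupp x) h k (hcomp k x).

Let h0 k : h k 0 = 0. Proof. by rewrite -(subrr 0) hB subrr. Qed.

Lemma glueE x s f : decomposes x s f -> glue x = \sum_(k <- s) h k (f k).
Proof.
move=> dx; have [us _ fs _] := dx; have [ux _ fx _] := hcompP x.
rewrite /glue; under eq_bigr do rewrite (hcompE dx).
apply: big_support => // k kn; last by rewrite fs.
by rewrite -(hcompE dx) fx.
Qed.

Lemma glue_hom k x : G k x -> glue x = h k x.
Proof. by move=> /decomposes_hom/glueE->; rewrite big_seq1 eqxx. Qed.

Lemma glueB x y : glue (x - y) = glue x - glue y.
Proof.
have [ux Gx fx _] := hcompP x; have [uy Gy fy _] := hcompP y.
rewrite (glueE (decomposesB (hcompP x) (hcompP y))).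
under eq_bigr do rewrite hB.
rewrite sumrB; congr (_ - _); apply: big_support => //; rewrite ?undup_uniq // => k.
- by rewrite mem_undup mem_cat negb_or => /andP[/fx-> _].
- by move=> /fx->.
- by rewrite mem_undup mem_cat negb_or => /andP[_ /fy->].
- by move=> /fy->.
Qed.

Lemma glue0 : glue 0 = 0.
Proof. by rewrite -(subrr 0) glueB subrr. Qed.

Lemma glueD x y : glue (x + y) = glue x + glue y.
Proof. by rewrite -[y in LHS]opprK -[- y]sub0r !glueB glue0 sub0r opprK. Qed.

End Glue.
End Gradings.

(** * Submodules *)

Section Submodules.
Variables (R : pzRingType) (M : lmodType R).

(** Membership is a proposition: the kernels, images and intersections used   *)
(** below are not decidable.                                                 *)
Record submodule := Submodule {
  smem :> M -> Prop;
  smem0 : smem 0;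
  smemD : forall x y, smem x -> smem y -> smem (x + y);
  smemZ : forall a x, smem x -> smem (a *: x) }.

Variable S : submodule.

Lemma smemN x : S x -> S (- x).
Proof. by move=> Sx; rewrite -scaleN1r; apply: smemZ. Qed.

Lemma smemB x y : S x -> S y -> S (x - y).
Proof. by move=> Sx Sy; apply: smemD => //; apply: smemN. Qed.

Lemma smem_sum (I : eqType) (s : seq I) (f : I -> M) :
  (forall i, i \in s -> S (f i)) -> S (\sum_(i <- s) f i).
Proof.
move=> Sf; rewrite big_seq.
elim/big_ind: _; [exact: smem0|exact: smemD|exact: Sf].
Qed.

Definition smemb : pred M := fun x => `[< S x >].

Fact smemb_closed : submod_closed smemb.
Proof.
split=> [|a x y /asboolP Sx /asboolP Sy]; apply/asboolP; first exact: smem0.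
by apply: smemD => //; apply: smemZ.
Qed.

HB.instance Definition _ := GRing.isSubmodClosed.Build R M smemb smemb_closed.

Definition smod_car : Type := {x : M | smemb x}.
HB.instance Definition _ := [isSub of smod_car for @sval M smemb].
HB.instance Definition _ := [Choice of smod_car by <:].
HB.instance Definition _ := [SubChoice_isSubLmodule of smod_car by <:].

Definition smod : lmodType R := smod_car.
Let smod_sval : {linear smod -> M} := (val : smod_car -> M).
(* Locked, so that simplification does not expose the underlying projection. *)
Definition smod_val : {linear smod -> M} := locked smod_sval.
Let smod_valE x : smod_val x = val (x : smod_car).
Proof. by rewrite /smod_val -lock. Qed.

Lemma smod_valP (x : smod) : S (smod_val x).
Proof. by rewrite smod_valE; apply/asboolP; apply: (valP (x : smod_car)). Qed.

Lemma smod_val_inj : injective smod_val.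
Proof. by move=> x y; rewrite !smod_valE => /val_inj. Qed.

Definition smod_mk x (Sx : S x) : smod := (exist _ x (asboolT Sx) : smod_car).

Lemma smod_mkK x (Sx : S x) : smod_val (smod_mk Sx) = x.
Proof. by rewrite smod_valE. Qed.

Section Corestriction.
Variables (N : lmodType R) (f : {linear N -> M}) (Sf : forall x, S (f x)).

Fact corestr_linear : linear (fun x => smod_mk (Sf x)).
Proof. by move=> a x y; apply: smod_val_inj; rewrite [RHS]linearP !smod_mkK linearP. Qed.

Definition corestr : {linear N -> smod} := mklin corestr_linear.

Lemma corestrE x : smod_val (corestr x) = f x. Proof. exact: smod_mkK. Qed.

End Corestriction.
End Submodules.

Arguments smod_val {R M S}.

(** * Graded submodules and exact sequences *)

(** Checked on homogeneous elements, which generate. The relabelling s is the *)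
(** identity for maps of degree zero, and a translation for multiplication by *)
(** a homogeneous scalar or by t.                                            *)
Lemma hcomp_morph (V W : zmodType) (G : int -> V -> Prop) (H : int -> W -> Prop)
    (hG : direct_grading G) (hH : direct_grading H) (f : V -> W) (s : int -> int) :
    (forall x y, f (x + y) = f x + f y) -> injective s ->
    (forall k x, G k x -> H (s k) (f x)) ->
  forall k x, hcomp hH (s k) (f x) = f (hcomp hG k x).
Proof.
move=> fD s_inj fGH k; have f0 : f 0 = 0.
  by apply: (addrI (f 0)); rewrite -fD !addr0.
elim/(grading_ind hG) => [|j x Gx|x y IHx IHy]; first by rewrite hcomp0 f0 !hcomp0.
  rewrite (hcomp_other hH (s k) (fGH _ _ Gx)) (hcomp_other hG k Gx) (inj_eq s_inj).
  by case: eqP.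
by rewrite fD !hcompD fD IHx IHy.
Qed.

Section GradedSubmodules.
Variable A : grRing.
Implicit Types M N L K P : grMod A.

Local Notation pr M k x := (hcomp (gm_compP M) k x).

Lemma gm_comp0 M k : @gm_comp A M k 0.
Proof. exact: (grading0 (gm_compP M)). Qed.

Lemma gm_compB M k x y : @gm_comp A M k x -> gm_comp k y -> gm_comp k (x - y).
Proof. exact: (gradingB (gm_compP M)). Qed.

Lemma gm_compD M k x y : @gm_comp A M k x -> gm_comp k y -> gm_comp k (x + y).
Proof. exact: (gradingD (gm_compP M)). Qed.

Lemma gm_compN M k x : @gm_comp A M k x -> gm_comp k (- x).
Proof. exact: (gradingN (gm_compP M)). Qed.

Lemma degree0_hcomp M N (f : {linear M -> N}) :
  degree0 f -> forall k x, pr N k (f x) = f (pr M k x).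
Proof. by move=> f0; apply: (@hcomp_morph _ _ _ _ _ _ f id) => // x y; rewrite linearD. Qed.

Lemma hcompZ M j (a : A) : gr_comp j a -> forall k (x : M),
  pr M (k + j) ((a : A^c) *: x) = (a : A^c) *: pr M k x.
Proof.
move=> aj; apply: (@hcomp_morph _ _ _ _ _ _ _ (+%R^~ j)) => [x y||k x xk].
- exact: scalerDr.
- exact: addIr.
- exact: gm_compZ.
Qed.

Lemma grA_ind (Q : A -> Prop) : Q 0 -> (forall k a, gr_comp k a -> Q a) ->
  (forall a b, Q a -> Q b -> Q (a + b)) -> forall a, Q a.
Proof. exact: (grading_ind (gr_compP A)). Qed.

(** An injective map of degree zero commutes with taking components, so it    *)
(** also reflects degrees.                                                   *)
Lemma inj_degree0 M N (f : {linear M -> N}) : degree0 f -> injective f ->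
  forall k x, gm_comp k (f x) -> gm_comp k x.
Proof.
move=> f0 f_inj k x fxk; have <- : pr M k x = x; last exact: hcomp_hom.
by apply: f_inj; rewrite -degree0_hcomp // hcomp_id.
Qed.

Lemma factor_inj (R : pzRingType) (X Y Z : lmodType R)
    (f : {linear X -> Z}) (i : {linear Y -> Z}) :
  injective i -> (forall x, exists y, i y = f x) ->
  exists g : {linear X -> Y}, forall x, i (g x) = f x.
Proof.
move=> i_inj fi; pose g x := projT1 (cid (fi x)).
have gE x : i (g x) = f x := projT2 (cid (fi x)).
have gL : linear g by move=> a x y; apply: i_inj; rewrite gE !linearP !gE.
by exists (mklin gL).
Qed.

Lemma gr_factor_inj M N L (f : {linear M -> L}) (i : {linear N -> L}) :
  degree0 f -> degree0 i -> injective i -> (forall x, exists y, i y = f x) ->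
  exists g : {linear M -> N}, degree0 g /\ forall x, i (g x) = f x.
Proof.
move=> f0 i0 i_inj /(factor_inj i_inj)[g gE]; exists g; split=> // k x xk.
by apply: (inj_degree0 i0 i_inj); rewrite gE; apply: f0.
Qed.

Lemma gr_iso_bij M N (f : {linear M -> N}) :
  degree0 f -> injective f -> (forall y, exists x, f x = y) -> gr_isomorphic M N.
Proof.
move=> f0 f_inj fS.
have [|g [g0 gE]] := gr_factor_inj (f := idfun : {linear N -> N}) _ f0 f_inj fS.
  by move=> k x.
by exists f, g; split=> // x; apply: f_inj; rewrite gE.
Qed.

Lemma gr_iso_refl M : gr_isomorphic M M.
Proof. by exists idfun, idfun; split. Qed.

Lemma gr_iso_sym M N : gr_isomorphic M N -> gr_isomorphic N M.
Proof. by move=> [f [g [? ? ? ?]]]; exists g, f; split. Qed.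

Lemma gr_iso_trans M N L :
  gr_isomorphic M N -> gr_isomorphic N L -> gr_isomorphic M L.
Proof.
move=> [f [g [f0 g0 fK gK]]] [f' [g' [f0' g0' fK' gK']]].
exists (f' \o f), (g \o g'); split=> [k x xk|k x xk|x|x] /=.
- exact/f0'/f0.
- exact/g0/g0'.
- by rewrite fK' fK.
- by rewrite gK gK'.
Qed.

Lemma gr_iso_projective M N :
  gr_isomorphic M N -> gr_projective M -> gr_projective N.
Proof.
move=> [u [v [u0 v0 uK vK]]] PM X Y p f p0 f0 pS.
have [|g [g0 gE]] := PM X Y p (f \o u) p0 _ pS.
  by move=> k x xk /=; apply/f0/u0.
exists (g \o v); split=> [k x xk|x] /=; first exact/g0/v0.
by rewrite gE /= vK.
Qed.

(** Closure under components amounts to being spanned by homogeneous elements. *)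
Record grSub M := GrSub {
  gs_sub :> submodule M;
  gs_hcomp : forall k x, gs_sub x -> gs_sub (pr M k x) }.

Lemma submodule_ext (R : pzRingType) (X : lmodType R) (S T : submodule X) :
  (forall x, S x <-> T x) -> S = T.
Proof.
case: S T => [S S0 SD SZ] [T T0 TD TZ] /= ST.
have {}ST : S = T by apply: funext => x; apply: propext; apply: ST.
by case: _ / ST in T0 TD TZ *; congr Submodule; apply: Prop_irrelevance.
Qed.

Lemma grSub_ext M (S T : grSub M) : (forall x, S x <-> T x) -> S = T.
Proof.
case: S T => [S SH] [T TH] /= /submodule_ext ST.
by case: _ / ST in TH *; congr GrSub; apply: Prop_irrelevance.
Qed.

Section Object.
Variables (M : grMod A) (S : grSub M).

Fact grsub_grading :
  direct_grading (fun k (x : smod S) => @gm_comp A M k (smod_val x)).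
Proof.
split=> [k|k x y xk yk|x|s f us fG f0 k ks].
- by rewrite linear0; apply: gm_comp0.
- by rewrite linearB; apply: gm_compB.
- have SH k := gs_hcomp k (smod_valP x).
  exists [seq smod_mk (SH k) | k <- hsupp (gm_compP M) (smod_val x)]; split.
    by move=> y /mapP[k _ ->]; exists k; rewrite smod_mkK; apply: hcomp_hom.
  rewrite big_map; apply: smod_val_inj; rewrite linear_sum.
  under eq_bigr do rewrite smod_mkK.
  by rewrite [LHS](hcomp_sum (gm_compP M)).
- apply: smod_val_inj; rewrite linear0.
  apply: (grading_free (gm_compP M) us fG) ks.
  by rewrite -(linear_sum (smod_val (S := S))) f0 linear0.
Qed.

Fact grsub_scale i j (m : smod S) (a : A) : @gm_comp A M i (smod_val m) ->
  gr_comp j a -> @gm_comp A M (i + j) (smod_val ((a : A^c) *: m)).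
Proof. by move=> mi aj; rewrite linearZ; apply: gm_compZ. Qed.

Definition grsub_mod : grMod A := GrMod grsub_grading grsub_scale.

Definition gs_val : {linear grsub_mod -> M} := smod_val (S := S).

Lemma gs_val0 : degree0 (M := grsub_mod) gs_val. Proof. by []. Qed.
Lemma gs_val_inj : injective gs_val. Proof. exact: smod_val_inj. Qed.
Lemma gs_valP x : S (gs_val x). Proof. exact: smod_valP. Qed.
Lemma gs_val_surj x : S x -> exists y, gs_val y = x.
Proof. by move=> Sx; exists (smod_mk Sx); apply: smod_mkK. Qed.

End Object.
Arguments gs_val {M S}.

Lemma gs_corestr M N (S : grSub N) (f : {linear M -> N}) : degree0 f ->
  (forall x, S (f x)) ->
  exists g : {linear M -> grsub_mod S},
    degree0 g /\ forall x, gs_val (g x) = f x.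
Proof.
move=> f0 Sf; apply: gr_factor_inj => //; first exact: gs_val_inj.
by move=> x; apply/gs_val_surj/Sf.
Qed.

Section Constructions.
Variables M N : grMod A.

Section Kernel.
Variables (f : {linear M -> N}) (f0 : degree0 f).
Definition ker_sub : submodule M.
Proof.
exists (fun x => f x = 0) => [|x y fx fy|a x fx]; first exact: linear0.
  by rewrite linearD fx fy addr0.
by rewrite linearZ_LR fx scaler0.
Defined.
Fact ker_hcomp k x : ker_sub x -> ker_sub (pr M k x).
Proof. by move=> /= fx; rewrite -degree0_hcomp // fx hcomp0. Qed.
Definition gr_ker : grSub M := GrSub ker_hcomp.
End Kernel.

Section Image.
Variables (f : {linear M -> N}) (f0 : degree0 f) (S : grSub M).
Definition img_sub : submodule N.
Proof.
exists (fun y => exists2 x, S x & f x = y) => [|_ _ [x Sx <-] [y Sy <-]|a _ [x Sx <-]].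
- by exists 0; [exact: smem0|rewrite linear0].
- by exists (x + y); [apply: smemD|rewrite linearD].
- by exists (a *: x); [apply: smemZ|rewrite linearZ_LR].
Defined.
Fact img_hcomp k x : img_sub x -> img_sub (pr N k x).
Proof.
move=> [y Sy <-]; exists (pr M k y); first exact: gs_hcomp.
by rewrite -degree0_hcomp.
Qed.
Definition gr_img : grSub N := GrSub img_hcomp.
End Image.

Section Meet.
Variables S T : grSub M.
Definition meet_sub : submodule M.
Proof.
exists (fun x => S x /\ T x) => [|x y [Sx Tx] [Sy Ty]|a x [Sx Tx]].
- by split; apply: smem0.
- by split; apply: smemD.
- by split; apply: smemZ.
Defined.
Fact meet_hcomp k x : meet_sub x -> meet_sub (pr M k x).
Proof. by move=> [Sx Tx]; split; apply: gs_hcomp. Qed.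
Definition gs_meet : grSub M := GrSub meet_hcomp.

Definition join_sub : submodule M.
Proof.
exists (fun x => exists y z, [/\ S y, T z & x = y + z]).
- by exists 0, 0; split; rewrite ?addr0 //; apply: smem0.
- move=> _ _ [x [y [Sx Ty ->]]] [x' [y' [Sx' Ty' ->]]].
  by exists (x + x'), (y + y'); split; rewrite 1?addrACA //; apply: smemD.
- move=> a _ [x [y [Sx Ty ->]]]; exists (a *: x), (a *: y).
  by split; rewrite ?scalerDr //; apply: smemZ.
Defined.
Fact join_hcomp k x : join_sub x -> join_sub (pr M k x).
Proof.
move=> [y [z [Sy Tz ->]]]; exists (pr M k y), (pr M k z).
by split; rewrite ?hcompD //; apply: gs_hcomp.
Qed.
Definition gs_join : grSub M := GrSub join_hcomp.

Lemma gs_joinl x : S x -> gs_join x.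
Proof. by move=> Sx; exists x, 0; split; rewrite ?addr0 //; apply: smem0. Qed.
Lemma gs_joinr x : T x -> gs_join x.
Proof. by move=> Tx; exists 0, x; split; rewrite ?add0r //; apply: smem0. Qed.
End Meet.

Definition top_sub : submodule M.
Proof. by exists (fun=> True). Defined.
Definition gs_top : grSub M := GrSub (gs_sub := top_sub) (fun _ _ _ => I).

End Constructions.

Lemma copair_degree0 M N L (f : {linear M -> L}) (g : {linear N -> L}) :
  degree0 f -> degree0 g ->
  degree0 (M := gr_dsum M N) (mklin (copair_linear f g)).
Proof. by move=> f0 g0 k x [xk yk]; apply: gm_compD; [apply: f0|apply: g0]. Qed.

Lemma map_degree0 M N M' N' (f : {linear M -> M'}) (g : {linear N -> N'}) :
  degree0 f -> degree0 g ->
  degree0 (M := gr_dsum M N) (N := gr_dsum M' N') (mklin (map_linear f g)).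
Proof. by move=> f0 g0 k x [xk yk]; split; [apply: f0|apply: g0]. Qed.

(** Exactness of 0 -> K -> P -> M -> 0. *)
Definition ses K P M : Prop :=
  exists (i : {linear K -> P}) (p : {linear P -> M}),
    [/\ degree0 i, degree0 p, injective i, (forall y, exists x, p x = y)
      & forall x, p x = 0 <-> exists y, i y = x].

Lemma ses_ker P M (p : {linear P -> M}) (p0 : degree0 p) :
  (forall y, exists x, p x = y) -> ses (grsub_mod (gr_ker p0)) P M.
Proof.
move=> pS; exists (gs_val (S := gr_ker p0)), p; split=> //.
- exact: gs_val_inj.
- move=> x; split=> [px|[y <-]]; first by apply: gs_val_surj.
  exact: (gs_valP y).
Qed.

Lemma ses_iso K P M K' P' M' : gr_isomorphic K K' -> gr_isomorphic P P' ->
  gr_isomorphic M M' -> ses K P M -> ses K' P' M'.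
Proof.
move=> [u [u' [u0 u0' uK uK']]] [v [v' [v0 v0' vK vK']]].
move=> [w [w' [w0 w0' wK wK']]] [i [p [i0 p0 i_inj pS ip]]].
exists (v \o (i \o u')), (w \o (p \o v')); split=> [k x xk|k x xk|||].
- exact/v0/i0/u0'.
- exact/w0/p0/v0'.
- move=> x y /(can_inj vK)/i_inj; exact: can_inj uK' _ _.
- move=> y; have [x px] := pS (w' y).
  by exists (v x) => /=; rewrite vK px wK'.
- move=> x /=; split=> [wx|[y <-]].
    have /ip[y iy] : p (v' x) = 0 by apply: (can_inj wK); rewrite wx linear0.
    by exists (u y); rewrite uK iy vK'.
  by rewrite vK (_ : p _ = 0) ?linear0 //; apply/ip; exists (u' y).
Qed.

Lemma ses_dsum K P M K' P' M' :
  ses K P M -> ses K' P' M' -> ses (gr_dsum K K') (gr_dsum P P') (gr_dsum M M').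
Proof.
move=> [i [p [i0 p0 i_inj pS ip]]] [i' [p' [i0' p0' i_inj' pS' ip']]].
exists (mklin (map_linear i i')), (mklin (map_linear p p')); split.
- exact: map_degree0.
- exact: map_degree0.
- by move=> [x x'] [y y'] [/i_inj-> /i_inj'->].
- move=> [y y']; have [x <-] := pS y; have [x' <-] := pS' y'.
  by exists (x, x').
- move=> [x x']; split=> [[/ip[y <-] /ip'[y' <-]]|[[y y'] [<- <-]]].
    by exists (y, y').
  congr (_, _); [apply/ip; by exists y|apply/ip'; by exists y'].
Qed.

Lemma ses_idl P : ses (gr_zero A) P P.
Proof.
exists (mklin (linearP (\0 : {linear zero_mod A -> P}))), idfun; split=> //.
- by move=> k x _; apply: gm_comp0.
- by move=> x y _; rewrite (zero_modE x) (zero_modE y).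
- by move=> x; exists x.
- by move=> x; split=> [/= ->|[y <-]] //; exists 0.
Qed.

Lemma ses_idr P : ses P P (gr_zero A).
Proof.
exists idfun, (mklin (linearP (\0 : {linear P -> zero_mod A}))); split=> //.
- by move=> y; exists 0; rewrite (zero_modE y).
- by move=> x; split=> // _; exists x.
Qed.

Lemma gr_iso_dsumC M N : gr_isomorphic (gr_dsum M N) (gr_dsum N M).
Proof.
exists (mklin (@swap_linear A M N)), (mklin (@swap_linear A N M)).
by split=> [k [x y] []|k [x y] []|[x y]|[x y]].
Qed.

Lemma gr_iso_dsum0 M : gr_isomorphic (gr_dsum M (gr_zero A)) M.
Proof.
apply: (gr_iso_trans (gr_iso_dsumC _ _)).
exists (mklin (@snd_linear A (zero_mod A) M)).
exists (mklin (@inr_linear A (zero_mod A) M)).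
by split=> [k [x y] []|k y|[x y]|y] //=; rewrite (zero_modE x).
Qed.

Lemma gr_iso_dsum M M' N N' : gr_isomorphic M M' -> gr_isomorphic N N' ->
  gr_isomorphic (gr_dsum M N) (gr_dsum M' N').
Proof.
move=> [f [g [f0 g0 fK gK]]] [f' [g' [f0' g0' fK' gK']]].
exists (mklin (map_linear f f')), (mklin (map_linear g g')).
split; [exact: map_degree0|exact: map_degree0|move=> [x y]|move=> [x y]] => /=.
  by rewrite fK fK'.
by rewrite gK gK'.
Qed.

Lemma ses_split K P M :
  ses K P M -> gr_projective M -> gr_isomorphic (gr_dsum K M) P.
Proof.
move=> [i [p [i0 p0 i_inj pS ip]]] PM.
have [//|s [s0 sE]] := PM _ _ p (idfun : {linear M -> M}) p0 _ pS.
apply: (@gr_iso_bij (gr_dsum K M) P (mklin (copair_linear i s))); first exact: copair_degree0.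
  have pi x : p (i x) = 0 by apply/ip; exists x.
  move=> [x y] [x' y'] /= E; have := congr1 p E.
  rewrite !linearD !pi !add0r !sE /= => yy; rewrite -yy in E *.
  by move/addIr/i_inj: E => ->.
move=> z; have /ip[x xE] : p (z - s (p z)) = 0 by rewrite linearB sE subrr.
by exists (x, p z); rewrite /= xE subrK.
Qed.

Lemma summand_projective M N : gr_projective (gr_dsum M N) -> gr_projective M.
Proof.
move=> PMN X Y p f p0 f0 pS.
have [|g [g0 gE]] := PMN X Y p (mklin (copair_linear f \0)) p0 _ pS.
  by apply: copair_degree0 => // k x _; apply: gm_comp0.
exists (g \o mklin (@inl_linear A M N)); split=> [k x xk|x] /=.
  by apply: g0; split=> //; apply: gm_comp0.
by rewrite gE /= addr0.
Qed.

(** Schanuel's lemma: both sides are isomorphic to the pullback of P and P' over M. *)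
Lemma schanuel K P K' P' M : gr_projective P -> gr_projective P' ->
  ses K P M -> ses K' P' M -> gr_isomorphic (gr_dsum K P') (gr_dsum K' P).
Proof.
(* The pullback E of p and q is K1 + P2, through (k, y) |-> (i k + v y, y).  *)
have half K1 P1 P2 (i : {linear K1 -> P1}) (p : {linear P1 -> M})
    (q : {linear P2 -> M}) (v : {linear P2 -> P1}) (E : grSub (gr_dsum P1 P2)) :
    degree0 i -> injective i -> (forall x, p x = 0 <-> exists y, i y = x) ->
    degree0 v -> (forall x, p (v x) = q x) -> (forall x, E x <-> p x.1 = q x.2) ->
    gr_isomorphic (gr_dsum K1 P2) (grsub_mod E).
  move=> i0 i_inj ip v0 vE EE.
  have pi x : p (i x) = 0 by apply/ip; exists x.
  pose f : {linear gr_dsum K1 P2 -> gr_dsum P1 P2} :=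
    mklin (pair_linear (mklin (copair_linear i v)) (mklin (@snd_linear A K1 P2))).
  have fE x : f x = (i x.1 + v x.2, x.2) by [].
  have [||g [g0 gE]] := gs_corestr (S := E) (f := f).
  - by move=> k x [xk yk]; split=> //; apply: gm_compD; [apply: i0|apply: v0].
  - by move=> x; apply/EE; rewrite fE /= linearD pi add0r vE.
  apply: (gr_iso_bij g0).
    move=> [x y] [x' y'] /(congr1 (@gs_val _ E)); rewrite !gE !fE /= => -[+ yy].
    by rewrite yy => /addIr/i_inj->.
  move=> z; have := gs_valP z; move zE : (gs_val z) => [x y] /EE/= xy.
  have /ip[k kE] : p (x - v y) = 0 by rewrite linearB vE xy subrr.
  exists (k, y); apply: (@gs_val_inj _ E); rewrite gE fE zE /=.
  by rewrite kE subrK.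
move=> PP PP' [i [p [i0 p0 i_inj pS ip]]] [i' [p' [i0' p0' i_inj' pS' ip']]].
have [u [u0 uE]] := PP _ _ p' p p0' p0 pS'.
have [v [v0 vE]] := PP' _ _ p p' p0 p0' pS.
pose q : {linear gr_dsum P P' -> M} := mklin (copair_linear p (\- p')).
have q0 : degree0 (M := gr_dsum P P') q.
  by apply: copair_degree0 => // k x xk; apply/gm_compN/p0'.
pose q' : {linear gr_dsum P' P -> M} := mklin (copair_linear p' (\- p)).
have q0' : degree0 (M := gr_dsum P' P) q'.
  by apply: copair_degree0 => // k x xk; apply/gm_compN/p0.
apply: (gr_iso_trans (half _ _ _ i p p' v (gr_ker q0) i0 i_inj ip v0 vE _)).
  move=> x /=; split=> [/eqP|->]; last by rewrite subrr.
  by rewrite subr_eq0 => /eqP.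
apply: gr_iso_sym.
apply: (gr_iso_trans (half _ _ _ i' p' p u (gr_ker q0') i0' i_inj' ip' u0 uE _)).
  move=> x /=; split=> [/eqP|->]; last by rewrite subrr.
  by rewrite subr_eq0 => /eqP.
pose s : {linear grsub_mod (gr_ker q0') -> gr_dsum P P'} :=
  mklin (@swap_linear A P' P) \o gs_val (S := gr_ker q0').
have [||g [g0 gE]] := gs_corestr (S := gr_ker q0) (f := s).
- by move=> k x [xk yk].
- by move=> x; have /= := gs_valP x; rewrite -opprB => /eqP; rewrite oppr_eq0 => /eqP.
apply: (gr_iso_bij g0).
  move=> x y /(congr1 (@gs_val _ _)); rewrite !gE /= => -[E1 E2].
  by apply: (@gs_val_inj _ (gr_ker q0')); rewrite [LHS]surjective_pairing E1 E2 -surjective_pairing.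
move=> y; have := gs_valP y; move yE: (gs_val y) => [a b] /= ab.
have : gr_ker q0' (b, a) by rewrite /= -opprB ab oppr0.
by move=> /gs_val_surj[x xE]; exists x; apply: (@gs_val_inj _ (gr_ker q0)); rewrite gE /= xE.
Qed.

(** One step of the horseshoe lemma: P'' -> M'' lifts to M by projectivity, and *)
(** K is the kernel of the resulting map from P' + P'' to M.                 *)
Lemma horseshoe K' P' M' K'' P'' M'' M : gr_projective P'' ->
  ses M' M M'' -> ses K' P' M' -> ses K'' P'' M'' ->
  exists K, ses K (gr_dsum P' P'') M /\ ses K' K K''.
Proof.
move=> PP [i [p [i0 p0 i_inj pS ip]]] [i1 [p1 [i10 p10 i1_inj p1S ip1]]].
move=> [i2 [p2 [i20 p20 i2_inj p2S ip2]]].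
have [h [h0 hE]] := PP _ _ p p2 p0 p20 pS.
have pi x : p (i x) = 0 by apply/ip; exists x.
pose q : {linear gr_dsum P' P'' -> M} := mklin (copair_linear (i \o p1) h).
have q0 : degree0 (M := gr_dsum P' P'') q.
  by apply: copair_degree0 => // k x xk; apply/i0/p10.
have qE x : q x = i (p1 x.1) + h x.2 by [].
exists (grsub_mod (gr_ker q0)); split.
  apply: ses_ker => z; have [y yE] := p2S (p z).
  have /ip[x xE] : p (z - h y) = 0 by rewrite linearB hE yE subrr.
  by have [w wE] := p1S x; exists (w, y); rewrite qE /= wE xE subrK.
pose j : {linear K' -> gr_dsum P' P''} := mklin (@inl_linear A P' P'') \o i1.
have [||j' [j0 jE]] := gs_corestr (S := gr_ker q0) (f := j).
- by move=> k x xk; split; [apply: i10|apply: gm_comp0].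
- move=> x /=; rewrite linear0 addr0 (_ : p1 _ = 0) ?linear0 //.
  by apply/ip1; exists x.
pose r : {linear grsub_mod (gr_ker q0) -> P''} :=
  mklin (@snd_linear A P' P'') \o gs_val (S := gr_ker q0).
have [||r' [r0 rE]] := gr_factor_inj (M := grsub_mod (gr_ker q0)) (f := r) _ i20 i2_inj.
- by move=> k x [].
- move=> x; have := gs_valP x; rewrite /= -/(gs_val x) => qx; apply/ip2.
  by rewrite -hE; move/(congr1 p): qx; rewrite linearD pi add0r linear0.
exists j', r'; split=> //.
- move=> x y /(congr1 (@gs_val _ _)); rewrite !jE /= => -[/i1_inj].
  exact.
- move=> y; have /ip[x xE] : p (h (i2 y)) = 0.
    by rewrite hE; apply/ip2; exists y.
  have [w wE] := p1S x.
  have : gr_ker q0 (- w, i2 y) by rewrite /= linearN wE linearN xE addNr.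
  by move=> /gs_val_surj[z zE]; exists z; apply: i2_inj; rewrite rE /= zE.
- move=> x; have := gs_valP x; move xE: (gs_val x) => [a b] /= qx; split=> [rx|[y yE]].
    have b0 : b = 0 by move/(congr1 i2): rx; rewrite rE /= xE linear0.
    move: qx; rewrite b0 linear0 addr0 -(linear0 i) => /i_inj/ip1[y yE].
    by exists y; apply: (@gs_val_inj _ (gr_ker q0)); rewrite jE xE b0 /= yE.
  apply: i2_inj; rewrite rE linear0 /= xE /=.
  by move: xE; rewrite -yE jE => -[_ <-].
Qed.

End GradedSubmodules.

Arguments gs_val {A M S}.
Arguments gs_val_inj {A M S}.

(** * Euler characteristics *)

Declare Scope abgroup_scope.
Delimit Scope abgroup_scope with ab.
Notation "x +! y" := (am_add x y) (at level 50, left associativity) : abgroup_scope.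
Local Open Scope abgroup_scope.

Section AbelianGroups.
Variable G : abGroup.
Implicit Types x y z : G.

Lemma ag_addr0 x : x +! am_zero G = x.
Proof. by rewrite am_addC am_add0. Qed.

Lemma ag_addI x y z : x +! y = x +! z -> y = z.
Proof. by move=> /(congr1 (am_add (ag_opp x))); rewrite !am_addA !ag_addN !am_add0. Qed.

Lemma ag_addIr x y z : y +! x = z +! x -> y = z.
Proof. by rewrite ![_ +! x]am_addC => /ag_addI. Qed.

Lemma ag_addACA x y z t : (x +! y) +! (z +! t) = (x +! z) +! (y +! t).
Proof. by rewrite -!am_addA (am_addA y) (am_addC y z) !am_addA. Qed.

Lemma ag_subK x y : ag_sub x y +! y = x.
Proof. by rewrite /ag_sub -am_addA ag_addN ag_addr0. Qed.

End AbelianGroups.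

Section EulerCharacteristic.
Variables (A : grRing) (H : abGroup) (lam : grFgProj A -> H).
Hypothesis lam_iso : forall P Q, gfp_iso P Q -> lam P = lam Q.
Hypothesis lam_dsum : forall P Q, lam (gfp_dsum P Q) = lam P +! lam Q.
Implicit Types (M N K : grMod A) (P Q : grFgProj A).

(** Some resolution of M by finitely generated projectives, of length n, has  *)
(** alternating sum x. It is recorded through its successive syzygies, so that *)
(** uniqueness and additivity reduce to one step by induction on n.          *)
Fixpoint euler (n : nat) M (x : H) : Prop :=
  match n with
  | 0 => exists2 P : grFgProj A, gr_isomorphic P M & x = lam P
  | m.+1 => exists (P : grFgProj A) K y,
      [/\ ses K P M, euler m K y & x +! y = lam P]
  end.

Lemma lam0 : lam (gfp_zero A) = am_zero H.
Proof.
have := lam_iso (gfp_dsum0 (gfp_zero A)); rewrite lam_dsum -[RHS]ag_addr0.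
exact: ag_addI.
Qed.

Lemma euler_iso n M N x : gr_isomorphic M N -> euler n M x -> euler n N x.
Proof.
case: n => [|n] MN [P] => [PM -> | [K [y [S Ky xy]]]].
  by exists P => //; apply: gr_iso_trans MN.
exists P, K, y; split=> //.
exact: (ses_iso (gr_iso_refl _) (gr_iso_refl _) MN).
Qed.

Lemma euler_dsumP n M P x : euler n M x -> euler n (gr_dsum M P) (x +! lam P).
Proof.
case: n => [[Q QM ->]|n [Q [K [y [S Ky xy]]]]].
  exists (gfp_dsum Q P); last by rewrite lam_dsum.
  exact: gr_iso_dsum QM (gr_iso_refl _).
exists (gfp_dsum Q P), K, y; split=> //.
  apply: (ses_iso (gr_iso_dsum0 K) (gr_iso_refl _) (gr_iso_refl _)).
  exact: ses_dsum S (ses_idl _).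
by rewrite lam_dsum -xy -!am_addA (am_addC (lam P)).
Qed.

Lemma euler_succ n M x : euler n M x -> euler n.+1 M x.
Proof.
elim: n => [|n IHn] in M x *.
  move=> [P PM ->]; exists P, (gr_zero A), (am_zero H); split=> /=.
  - exact: (ses_iso (gr_iso_refl _) (gr_iso_refl _) PM (ses_idl P)).
  - by exists (gfp_zero A); [apply: gr_iso_refl|rewrite lam0].
  - by rewrite ag_addr0.
by move=> [P [K [y [S Ky xy]]]]; exists P, K, y; split=> //; apply: IHn.
Qed.

Lemma euler_leq m n M x : (m <= n)%N -> euler m M x -> euler n M x.
Proof.
by move=> /subnKC <-; elim: (n - m)%N => [|k IHk]; rewrite ?addn0 // addnS => /IHk/euler_succ.
Qed.

(** By Schanuel's lemma the first syzygies K and K' become isomorphic after   *)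
(** adding P' and P, and the induction hypothesis applies to the two sums.   *)
Lemma euler_uniq_same n M x x' : euler n M x -> euler n M x' -> x = x'.
Proof.
elim: n => [|n IHn] in M x x' *.
  move=> [P PM ->] [P' PM' ->]; apply: lam_iso.
  exact: gr_iso_trans PM (gr_iso_sym PM').
move=> [P [K [y [S Ky xy]]]] [P' [K' [y' [S' Ky' xy']]]].
have I := schanuel (@gfp_proj _ P) (@gfp_proj _ P') S S'.
have E := IHn _ _ _ (euler_iso I (euler_dsumP P' Ky)) (euler_dsumP P Ky').
apply: (@ag_addIr _ (y +! lam P')).
by rewrite {2}E am_addA xy am_addA xy' am_addC.
Qed.

Lemma euler_uniq m n M x x' : euler m M x -> euler n M x' -> x = x'.
Proof.
move=> /(euler_leq (leq_maxl m n)) Mx /(euler_leq (leq_maxr m n)).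
exact: euler_uniq_same Mx.
Qed.

(** The horseshoe lemma resolves the middle term by the sum of the two        *)
(** resolutions.                                                             *)
Lemma euler_ses_same n M' M M'' x' x'' : ses M' M M'' ->
  euler n M' x' -> euler n M'' x'' -> euler n M (x' +! x'').
Proof.
elim: n => [|n IHn] in M' M M'' x' x'' *.
  move=> S [P' P'M ->] [P'' P''M ->]; exists (gfp_dsum P' P'') => //.
  have PM := gr_iso_projective P''M (@gfp_proj _ P'').
  exact: gr_iso_trans (gr_iso_dsum P'M P''M) (ses_split S PM).
move=> S [P' [K' [y' [S' Ky' xy']]]] [P'' [K'' [y'' [S'' Ky'' xy'']]]].
have [K [SM SK]] := horseshoe (@gfp_proj _ P'') S S' S''.
exists (gfp_dsum P' P''), K, (y' +! y''); split=> //; first exact: IHn SK _ _.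
by rewrite ag_addACA xy' xy'' lam_dsum.
Qed.

Lemma euler_ses l m n M' M M'' x x' x'' : ses M' M M'' ->
  euler l M' x' -> euler m M'' x'' -> euler n M x -> x = x' +! x''.
Proof.
move=> S /(euler_leq (leq_maxl l m)) Mx' /(euler_leq (leq_maxr l m)) Mx'' Mx.
exact: euler_uniq Mx (euler_ses_same S Mx' Mx'').
Qed.

End EulerCharacteristic.

(** * Finite generation *)

Section Span.
Variable R : pzRingType.
Implicit Types M N : lmodType R.

Fixpoint lspan M (s : seq M) (x : M) : Prop :=
  match s with
  | [::] => x = 0
  | m :: s' => exists a y, lspan s' y /\ x = a *: m + y
  end.

Definition lspan_sub M (s : seq M) : submodule M.
Proof.
exists (lspan s).
- by elim: s => //= m s IHs; exists 0, 0; split; rewrite ?scale0r ?addr0.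
- elim: s => [_ _ -> ->|m s IHs _ _ [a [x [sx ->]]] [b [y [sy ->]]]] /=.
    by rewrite addr0.
  exists (a + b), (x + y); split; first exact: IHs.
  by rewrite addrACA scalerDl.
- elim: s => [a _ ->|m s IHs a _ [b [y [sy ->]]]] /=; first by rewrite scaler0.
  exists (a * b), (a *: y); split; first exact: IHs.
  by rewrite scalerDr scalerA.
Defined.

Lemma lspan_mem M (s : seq M) m : m \in s -> lspan s m.
Proof.
elim: s => //= u s IHs; rewrite inE => /predU1P[->|/IHs sm].
  exists 1, 0; rewrite scale1r addr0; split=> //.
  exact: (smem0 (lspan_sub s)).
by exists 0, m; rewrite scale0r add0r.
Qed.

Lemma lspan_min M (s : seq M) (S : submodule M) x :
  (forall m, m \in s -> S m) -> lspan s x -> S x.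
Proof.
elim: s x => [x _ ->|m s IHs x Ss /= [a [y [sy ->]]]]; first exact: smem0.
apply: smemD; first by apply/smemZ/Ss/mem_head.
by apply: IHs => // u us; apply: Ss; rewrite inE us orbT.
Qed.

Lemma lspan_trans M (s t : seq M) x :
  (forall m, m \in s -> lspan t m) -> lspan s x -> lspan t x.
Proof. exact: (@lspan_min _ s (lspan_sub t)). Qed.

Lemma lspan_map M N (f : {linear M -> N}) s x : lspan s x -> lspan (map f s) (f x).
Proof.
elim: s x => [x ->|m s IHs x /= [a [y [sy ->]]]] /=; first exact: linear0.
by exists a, (f y); split; [apply: IHs|rewrite linearP].
Qed.

Lemma lspan_mapP M N (f : {linear M -> N}) s z :
  lspan (map f s) z -> exists2 x, lspan s x & f x = z.
Proof.
elim: s z => [z ->|m s IHs z /= [a [_ [/IHs[x sx <-] ->]]]].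
  by exists 0; rewrite //= linear0.
by exists (a *: m + x); [exists a, x|rewrite linearP].
Qed.

Lemma fg_span M : (exists s : seq M, forall x, lspan s x) <->
  exists n (e : 'I_n -> M), forall x, exists a : 'I_n -> R, x = \sum_i a i *: e i.
Proof.
split=> [[s sP]|[n [e eP]]].
  exists (size s), (fun i => s`_i) => x; move: x (sP x) => {sP}.
  elim: s => [x ->|m s IHs x].
    by exists (fun=> 0); rewrite big_ord0.
  move=> [a [y [/IHs[b ->] ->]]].
  exists (fun i => if unlift ord0 i is Some j then b j else a).
  rewrite big_ord_recl unlift_none /=; congr (_ + _).
  by apply: eq_bigr => i _; rewrite liftK.
exists [seq e i | i <- enum 'I_n] => x; have [a ->] := eP x.
rewrite -big_enum.
apply: (smem_sum (S := lspan_sub _)) => i _; apply: smemZ.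
by apply/lspan_mem/map_f; rewrite mem_enum.
Qed.

End Span.

Section GradedSpan.
Variable A : grRing.
Implicit Types M N L K P : grMod A.
Local Notation pr M k x := (hcomp (gm_compP M) k x).

Lemma fgP (M : rmodType A) :
  finitely_generated M <-> exists s : seq M, forall x, lspan s x.
Proof. by rewrite fg_span. Qed.

Lemma fg_surj (M N : rmodType A) (f : {linear M -> N}) :
  (forall y, exists x, f x = y) -> finitely_generated M -> finitely_generated N.
Proof.
move=> fS /fgP[s sP]; apply/fgP; exists (map f s) => y.
by have [x <-] := fS y; apply: lspan_map.
Qed.

Lemma fg_smod (M : rmodType A) (S : submodule M) : finitely_generated (smod S) <->
  exists s : seq M, (forall m, m \in s -> S m) /\ forall x, S x -> lspan s x.
Proof.
split=> [/fgP[s sP]|[s [sS sP]]].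
  exists (map (smod_val (S := S)) s); split=> [_ /mapP[m _ ->]|x Sx].
    exact: smod_valP.
  by rewrite -(smod_mkK Sx); apply: lspan_map.
apply/fgP; pose h m : smod S := if pselect (S m) is left Sm then smod_mk Sm else 0.
have hE : map (smod_val (S := S)) (map h s) = s.
  rewrite -map_comp; apply: map_id_in => m /sS Sm /=; rewrite /h.
  by case: pselect => // Sm'; rewrite smod_mkK.
exists (map h s) => x.
have := sP _ (smod_valP x); rewrite -{1}hE => /lspan_mapP[y sy].
by move=> /smod_val_inj <-.
Qed.

Definition homogeneous M (s : seq M) : Prop :=
  forall m, m \in s -> exists k, gm_comp k m.

(** Enough for one generator m of degree d: the component of degree k of a *: m *)
(** is a_(k - d) *: m.                                                       *)
Lemma lspan_hcomp M (s : seq M) : homogeneous s ->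
  forall k x, lspan s x -> lspan s (pr M k x).
Proof.
elim: s => [|m s IHs] hs k x /=; first by move=> ->; rewrite hcomp0.
move=> [a [y [sy ->]]]; rewrite hcompD.
have hs' : homogeneous s by move=> u us; apply: hs; rewrite inE us orbT.
suff [b ->] : exists b, pr M k (a *: m) = b *: m.
  by exists b, (pr M k y); split=> //; apply: IHs.
have [d md] := hs m (mem_head _ _).
elim/grA_ind: a => [|j a aj|a b [a' Ea] [b' Eb]].
- by exists 0; rewrite !scale0r hcomp0.
- have -> : k = k - j + j by rewrite subrK.
  rewrite hcompZ // (hcomp_other _ _ md).
  by case: ifP => _; [exists a|exists 0; rewrite scaler0 scale0r].
- by exists (a' + b'); rewrite !scalerDl hcompD Ea Eb.
Qed.

Definition gr_span M (s : seq M) (hs : homogeneous s) : grSub M :=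
  GrSub (gs_sub := lspan_sub s) (lspan_hcomp hs).

Lemma homogeneous_span M (S : grSub M) (s : seq M) :
  (forall m, m \in s -> S m) -> exists t : seq M,
  [/\ homogeneous t, forall m, m \in t -> S m & forall x, lspan s x -> lspan t x].
Proof.
move=> sS; exists (flatten [seq [seq pr M k m | k <- hsupp (gm_compP M) m] | m <- s]).
split=> [u /flatten_mapP[m _ /mapP[k _ ->]]|u /flatten_mapP[m ms /mapP[k _ ->]]|x].
- by exists k; apply: hcomp_hom.
- by apply/gs_hcomp/sS.
apply: lspan_trans => m ms; rewrite (hcomp_sum (gm_compP M) m).
apply: (smem_sum (S := lspan_sub _)) => k ks; apply: lspan_mem.
by apply/flatten_mapP; exists m => //; apply: map_f.
Qed.

(** * Graded free modules *)

(** A as a right module over itself. *)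
Definition reg_mod : rmodType A := A^c^o.

Fact gr_reg_scale i j (m : reg_mod) (a : A) :
  gr_comp i (m : A) -> gr_comp j a -> gr_comp (i + j) ((a : A^c) *: m : A).
Proof. exact: gr_compM. Qed.

Definition gr_reg : grMod A :=
  @GrMod A reg_mod (@gr_comp A) (gr_compP A) gr_reg_scale.

Fact orbit_linear (M : rmodType A) (m : M) : linear (fun a : reg_mod => (a : A^c) *: m).
Proof. by move=> c a b; rewrite scalerDl scalerA. Qed.

Definition orbit_map (M : rmodType A) (m : M) : {linear reg_mod -> M} :=
  mklin (orbit_linear m).

Lemma reg_scale1 (a : A) : (a : A^c) *: ((1 : A) : reg_mod) = a.
Proof. exact: (@mul1r A a). Qed.

Lemma reg_fg : finitely_generated reg_mod.
Proof.
by exists 1%N, (fun=> (1 : A)) => x; exists (fun=> x); rewrite big_ord1 reg_scale1.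
Qed.

Lemma orbit_map1 (L : rmodType A) (f : {linear reg_mod -> L}) x :
  f x = orbit_map (f (1 : A)) x.
Proof. by rewrite -[x in LHS]reg_scale1 linearZ_LR. Qed.

Lemma reg_projective : projective reg_mod.
Proof.
move=> N L p f pS; have [y yE] := pS (f (1 : A)).
exists (orbit_map y) => x; rewrite [RHS]orbit_map1 -yE; exact: linearZ_LR.
Qed.

Lemma gr_reg_projective : gr_projective gr_reg.
Proof.
move=> N L p f p0 f0 pS; have [y yE] := pS (f (1 : A)).
exists (orbit_map (pr N 0 y)); split=> [k a ak|x].
  by rewrite -[k]add0r; apply: gm_compZ ak; apply: hcomp_hom.
rewrite [RHS]orbit_map1 /= linearZ_LR -degree0_hcomp // yE hcomp_id //.
exact/f0/gr_comp1.
Qed.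

Definition gfp_reg : grFgProj A := GrFgProj (gfp_mod := gr_reg) reg_fg gr_reg_projective.

(** F is a sum of shifts of A, hence it is still projective when its grading  *)
(** is forgotten; that this holds for all graded projectives is deduced below. *)
Lemma free_cover M (s : seq M) : homogeneous s ->
  exists (F : grFgProj A) (f : {linear F -> M}),
    [/\ projective F, degree0 f & forall x, lspan s x <-> exists y, f y = x].
Proof.
elim: s => [_|m s IHs hs].
  exists (gfp_zero A), (\0 : {linear zero_mod A -> M}); split.
  - exact: zero_mod_projective.
  - by move=> k x _; apply: gm_comp0.
  - by move=> x; split=> [->|[y <-]] //; exists 0.
have [|F [f [PF f0 fP]]] := IHs.
  by move=> u us; apply: hs; rewrite inE us orbT.
have [d md] := hs m (mem_head _ _).
exists (gfp_dsum (gfp_shift gfp_reg (- d)) F).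
exists (mklin (copair_linear (orbit_map m) f)); split.
- exact: dsum_projective reg_projective PF.
- apply: (@copair_degree0 A (gr_shift gr_reg (- d))) => // k a ak /=.
  by rewrite -[k](addNKr d); apply: gm_compZ.
- move=> x; split=> [[a [y [/fP[z <-] ->]]]|[[a y] <-]]; first by exists (a, z).
  by exists a, (f y); split=> //; apply/fP; exists y.
Qed.

Lemma fg_cover M : finitely_generated M ->
  exists (F : grFgProj A) (f : {linear F -> M}),
    [/\ projective F, degree0 f & forall y, exists x, f x = y].
Proof.
move=> /fgP[s sP]; have [//|t [ht _ st]] := @homogeneous_span M (gs_top M) s.
have [F [f [PF f0 fP]]] := free_cover ht.
by exists F, f; split=> // y; apply/fP/st.
Qed.

(** A graded projective module is a direct summand of a graded free one. *)
Lemma gfp_projective (P : grFgProj A) : projective P.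
Proof.
have [F [f [PF f0 fS]]] := fg_cover (gfp_fg P).
have [//|s [_ sE]] := @gfp_proj _ P _ _ f (idfun : {linear P -> P}) f0 _ fS.
move=> N L p g pS; have [h hE] := PF N L p (g \o f) pS.
by exists (h \o s) => x /=; rewrite hE /= sE.
Qed.

(** * Noetherian graded rings *)

Section Noetherian.
Hypothesis Anoeth : gr_right_noetherian A.

Lemma lspan_ideal (s : seq gr_reg) : homogeneous s -> gr_right_ideal (lspan s).
Proof.
move=> hs; split=> [|x y|x a|x sx].
- exact: (smem0 (lspan_sub s)).
- exact: (smemD (s := lspan_sub s)).
- exact: (smemZ (s := lspan_sub s) a).
exists [seq pr gr_reg k x | k <- hsupp (gm_compP gr_reg) x]; split.
  move=> _ /mapP[k _ ->]; split; first exact: lspan_hcomp.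
  by exists k; apply: (hcomp_hom (gm_compP gr_reg)).
by rewrite big_map; apply: (hcomp_sum (gm_compP gr_reg)).
Qed.

(** Otherwise homogeneous elements of I outside the span of the previous ones *)
(** could be adjoined forever, against the ascending chain condition.        *)
Lemma ideal_fg (I : A -> Prop) : gr_right_ideal I ->
  exists s : seq gr_reg, (forall m, m \in s -> I m) /\ forall x, I x -> lspan s x.
Proof.
move=> [I0 ID IZ IH].
pose new (s : seq gr_reg) x := [/\ I x, exists k, gr_comp k x & ~ lspan s x].
pose step s := if pselect (exists x, new s x) is left E then projT1 (cid E) :: s else s.
pose S n := iter n step [::].
have SI n : (forall m, m \in S n -> I m) /\ homogeneous (S n).
  elim: n => [|n [IHn1 IHn2]] //=; rewrite /step; case: pselect => // E.
  case: (cid E) => x [Ix xk _] /=; split=> m; rewrite inE => /predU1P[->|] //.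
    exact: IHn1.
  exact: IHn2.
have [|n x|n Sn] := @Anoeth (fun n => lspan (S n)).
- by move=> n; apply/lspan_ideal/(proj2 (SI n)).
- rewrite /S iterS -/(S n) /step; case: pselect => // E.
  by apply: lspan_trans => m ms; apply: lspan_mem; rewrite inE ms orbT.
exists (S n); split; first exact: (proj1 (SI n)).
have H y : I y -> (exists k, gr_comp k y) -> lspan (S n) y.
  move=> Iy hy; apply: contrapT => nSy.
  have E : exists x, new (S n) x by exists y.
  have := Sn n.+1 (leqnSn n); rewrite /S iterS -/(S n) /step; case: pselect => // E'.
  case: (cid E') => x [_ _ nx] /= /(_ x)[H _]; apply/nx/H.
  exact: (@lspan_mem _ gr_reg (x :: S n) x (mem_head _ _)).
move=> x /IH[t [tI ->]]; apply: (smem_sum (S := lspan_sub (S n))) => y yt.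
by have [Iy ky] := tI y yt; apply: H.
Qed.

(** Induction on the number of generators. The scalars a with a m in S modulo *)
(** the span of the other generators form a graded right ideal I. Elements of S *)
(** that lift finitely many generators of I, together with generators of the *)
(** intersection of S with that span, generate S.                            *)
Lemma noetherian_span M (s : seq M) (S : grSub M) : homogeneous s ->
  (forall x, S x -> lspan s x) -> finitely_generated (grsub_mod S).
Proof.
move=> hs Ss; apply/fg_smod; elim: s => [|m s IHs] in S hs Ss *.
  by exists [::]; split.
have hs' : homogeneous s by move=> u us; apply: hs; rewrite inE us orbT.
have [d md] := hs m (mem_head _ _).
pose I (a : A) := exists2 y, S y & lspan s (y - (a : A^c) *: m).
have II : gr_right_ideal I.
  split=> [|a b [y Sy ya] [z Sz zb]|a c [y Sy ya]|a [y Sy ya]].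
  - by exists 0; [apply: smem0|rewrite scale0r subr0; apply: (smem0 (lspan_sub s))].
  - exists (y + z); first exact: smemD.
    rewrite scalerDl opprD addrACA; exact: (smemD (s := lspan_sub s)).
  - exists ((c : A^c) *: y); first exact: smemZ.
    have -> : ((a * c : A) : A^c) *: m = (c : A^c) *: ((a : A^c) *: m) by rewrite scalerA.
    rewrite -scalerBr; exact: (smemZ (s := lspan_sub s)).
  exists [seq pr gr_reg k a | k <- hsupp (gm_compP gr_reg) a]; split; last first.
    by rewrite big_map; apply: (hcomp_sum (gm_compP gr_reg)).
  move=> _ /mapP[k _ ->]; split; last by exists k; apply: (hcomp_hom (gm_compP gr_reg)).
  exists (pr M (d + k) y); first exact: gs_hcomp.
  (* The degrees of I are those of A(-d), the source of a |-> a *: m. *)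
  have f0 : degree0 (M := gr_shift gr_reg (- d)) (N := M) (orbit_map m).
    move=> j c cj /=; rewrite -[j](addNKr d); exact: gm_compZ.
  have -> : pr gr_reg k a = pr (gr_shift gr_reg (- d)) (d + k) a.
    rewrite (@hcompE _ _ (gm_compP (gr_shift gr_reg (- d))) a
      [seq d + j | j <- hsupp (gm_compP gr_reg) a]
      (fun j => pr gr_reg (- d + j) a)); first by rewrite addKr.
    have [us Gs fs E] := hcompP (gm_compP gr_reg) a; split.
    - by rewrite map_inj_uniq //; apply: addrI.
    - by move=> j; apply: (hcomp_hom (gm_compP gr_reg)).
    - move=> j nj; apply: fs; apply: contraNN nj => js.
      by apply/mapP; exists (- d + j); rewrite ?addNKr.
    - by rewrite big_map {1}E; apply: eq_bigr => j _; rewrite addKr.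
  have := degree0_hcomp f0 (d + k) a; rewrite /= => <-.
  by rewrite -hcompB; apply: lspan_hcomp.
have [t [tI tP]] := ideal_fg II.
have [s' [s'S s'P]] := IHs (gs_meet S (gr_span hs')) hs' (fun x => @proj2 _ _).
have lift (u : seq gr_reg) : (forall m, m \in u -> I m) ->
    exists v : seq M, (forall y, y \in v -> S y) /\
    forall a, lspan u a -> exists2 y, lspan v y & lspan s (y - (a : A^c) *: m).
  elim: u => [_|c u IHu uI].
    exists [::]; split=> // a ->; exists 0 => //.
    by rewrite scale0r subr0; apply: (smem0 (lspan_sub s)).
  have [|v [vS vP]] := IHu; first by move=> b bu; apply: uI; rewrite inE bu orbT.
  have [y Sy yc] := uI c (mem_head _ _).
  exists (y :: v); split=> [z|_ [b [a [/vP[z vz za] ->]]]].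
    by rewrite inE => /predU1P[->|/vS].
  exists ((b : A^c) *: y + z); first by exists b, z.
  rewrite scalerDl opprD addrACA; apply: (smemD (s := lspan_sub s)) => //.
  have -> : (b *: c : A^c) *: m = (b : A^c) *: ((c : A^c) *: m) by rewrite scalerA.
  rewrite -scalerBr; exact: (smemZ (s := lspan_sub s)).
have [v [vS vP]] := lift t tI.
exists (v ++ s'); split=> [y|x Sx].
  by rewrite mem_cat => /orP[/vS|/s'S[]].
have [a [z [sz xE]]] := Ss x Sx.
have [|y vy ya] := vP a.
  by apply: tP; exists x; rewrite // xE addrC addKr.
have Sy : S y by apply: lspan_min vy.
have : lspan s' (x - y).
  apply: s'P; split; first exact: smemB.
  have -> : x - y = z - (y - a *: m) by rewrite xE opprB addrA [z + _]addrC.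
  exact: (smemB (S := lspan_sub s)).
move=> sxy; rewrite -[x](subrK y).
apply: (smemD (s := lspan_sub (v ++ s'))).
  by apply: lspan_trans sxy => u us; apply: lspan_mem; rewrite mem_cat us orbT.
by apply: lspan_trans vy => u us; apply: lspan_mem; rewrite mem_cat us.
Qed.

Lemma noetherian_sub M (S : grSub M) :
  finitely_generated M -> finitely_generated (grsub_mod S).
Proof.
move=> /fgP[s sP]; have [//|t [ht _ st]] := @homogeneous_span M (gs_top M) s.
by apply: (noetherian_span ht) => x _; apply: st.
Qed.

End Noetherian.
End GradedSpan.

(** * Finite resolutions over regular Noetherian graded rings *)

Section FiniteResolutions.
Variable A : grRing.
Implicit Types (M N K X : grMod A) (P : grMod A).

Fixpoint pdim_le n M : Prop :=
  match n with
  | 0 => gr_projective M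
  | m.+1 => exists P K, [/\ gr_projective P, ses K P M & pdim_le m K]
  end.

(** The form of [pdim_le] that applies to any given cover of M, in particular *)
(** to a finitely generated one, whereas [gr_proj_resolution] has modules of *)
(** arbitrary size.                                                          *)
Fixpoint syzygy_projective n M : Prop :=
  match n with
  | 0 => gr_projective M
  | m.+1 => forall P K, gr_projective P -> ses K P M -> syzygy_projective m K
  end.

Lemma resolution_pdim n M : gr_proj_resolution M n -> pdim_le n M.
Proof.
elim: n M => [|n IHn] M [P [eps [d [PP [e0 d0] [eS ed] dd Pn]]]].
  apply: (gr_iso_projective (M := P 0%N)) => //; apply: (gr_iso_bij e0) => // x y exy.
  have /ed[z zE] : eps (x - y) = 0 by rewrite linearB exy subrr.
  by apply/eqP; rewrite -subr_eq0 -zE (Pn 1%N isT z) linear0.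
have [x|e' [e0' eE]] := gs_corestr (S := gr_ker e0) (d0 0%N).
  by apply/ed; exists x.
exists (P 0%N), (grsub_mod (gr_ker e0)); split=> //; first exact: ses_ker.
apply: IHn; exists (fun i => P i.+1), e', (fun i => d i.+1); split=> //.
- split=> [y|x].
    have /ed[x xE] := gs_valP y; exists x.
    by apply: (gs_val_inj (S := gr_ker e0)); rewrite eE.
  rewrite -dd -eE; split=> [->|]; first exact: linear0.
  by rewrite -(linear0 (gs_val (S := gr_ker e0))) => /gs_val_inj.
- by move=> i ni; apply: Pn.
Qed.

Lemma pdim_le_iso n M N : gr_isomorphic M N -> pdim_le n M -> pdim_le n N.
Proof.
case: n => [|n] MN; first exact: gr_iso_projective.
move=> [P [K [PP S Kn]]]; exists P, K; split=> //.
exact: (ses_iso (gr_iso_refl _) (gr_iso_refl _) MN).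
Qed.

Lemma pdim_le_dsum n M X :
  gr_projective X -> pdim_le n M -> pdim_le n (gr_dsum M X).
Proof.
case: n => [|n] PX; first by move=> PM; apply: gr_dsum_projective.
move=> [P [K [PP S Kn]]]; exists (gr_dsum P X), K; split=> //.
  exact: gr_dsum_projective.
apply: (ses_iso (gr_iso_dsum0 K) (gr_iso_refl _) (gr_iso_refl _)).
exact: ses_dsum S (ses_idl _).
Qed.

Lemma syzygy_projective_summand n M X :
  gr_projective X -> syzygy_projective n (gr_dsum M X) -> syzygy_projective n M.
Proof.
case: n => [|n] PX /=; first exact: summand_projective.
move=> H P K PP S; apply: (H (gr_dsum P X)); first exact: gr_dsum_projective.
apply: (ses_iso (gr_iso_dsum0 K) (gr_iso_refl _) (gr_iso_refl _)).
exact: ses_dsum S (ses_idl _).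
Qed.

(** By Schanuel's lemma the kernels of two covers agree up to projective      *)
(** summands.                                                                *)
Lemma pdim_syzygy n M : pdim_le n M -> syzygy_projective n M.
Proof.
elim: n M => [//|n IHn] M [P [K [PP S Kn]]] P' K' PP' S'.
apply: (syzygy_projective_summand PP); apply: IHn.
apply: pdim_le_iso (pdim_le_dsum PP' Kn).
exact: schanuel S S'.
Qed.

Hypothesis Anoeth : gr_right_noetherian A.

Lemma ses_fg_kernel K P M : ses K P M -> finitely_generated P -> finitely_generated K.
Proof.
move=> [i [p [i0 p0 i_inj pS ip]]] Pfg.
have [|j [j0 jE]] := gs_corestr (S := gr_img i0 (gs_top K)) i0.
  by move=> x; exists x.
have [||f [g [_ _ fK gK]]] := gr_iso_bij j0.
- by move=> x y /(congr1 (@gs_val _ _ _)); rewrite !jE => /i_inj.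
- move=> y; have [x _ xE] := gs_valP y; exists x.
  by apply: (gs_val_inj (S := gr_img i0 (gs_top K))); rewrite jE.
apply: (fg_surj (f := g)); first by move=> x; exists (f x).
exact: (noetherian_sub Anoeth).
Qed.

Section Existence.
Variables (H : abGroup) (lam : grFgProj A -> H).

Lemma euler_syzygy n M : finitely_generated M -> syzygy_projective n M ->
  exists x, euler lam n M x.
Proof.
elim: n M => [|n IHn] M Mfg.
  by move=> PM; exists (lam (GrFgProj Mfg PM)), (GrFgProj Mfg PM) => //; apply: gr_iso_refl.
move=> Ms; have [F [f [PF f0 fS]]] := fg_cover Mfg.
have S := ses_ker f0 fS.
have [||y Ky] := IHn (grsub_mod (gr_ker f0)).
- exact: ses_fg_kernel S (gfp_fg F).
- exact: Ms (@gfp_proj _ F) S.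
by exists (ag_sub (lam F) y), F, (grsub_mod (gr_ker f0)), y; rewrite ag_subK.
Qed.

Lemma euler_ex M : gr_right_regular A -> finitely_generated M ->
  exists n x, euler lam n M x.
Proof.
move=> [d [Ad _]] Mfg; have [n [Mn _] _] := Ad M.
have [x Mx] := euler_syzygy Mfg (pdim_syzygy (resolution_pdim Mn)).
by exists n, x.
Qed.

End Existence.
End FiniteResolutions.

(** * Euler characteristics of subquotients *)

Section Chi.
Variable A : grRing.
Hypotheses (Anoeth : gr_right_noetherian A) (Areg : gr_right_regular A).
Variables (H : abGroup) (lam : grFgProj A -> H).
Hypothesis lam_iso : forall P Q, gfp_iso P Q -> lam P = lam Q.
Hypothesis lam_dsum : forall P Q, lam (gfp_dsum P Q) = lam P +! lam Q.
Hypothesis lam_shift : forall P n, lam (gfp_shift P n) = lam P.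
Implicit Types (M N K : grMod A).

Definition chi M : H :=
  if pselect (exists x n, euler lam n M x) is left E then projT1 (cid E)
  else am_zero H.

Lemma chiP M : finitely_generated M -> exists n, euler lam n M (chi M).
Proof.
move=> Mfg; rewrite /chi; case: pselect => [E|[]]; first exact: projT2 (cid E).
by have [n [x Mx]] := euler_ex Anoeth lam Areg Mfg; exists x, n.
Qed.

Lemma chi_eq n M x : finitely_generated M -> euler lam n M x -> chi M = x.
Proof. by move=> /chiP[m Mm]; apply: euler_uniq Mm. Qed.

Lemma fg_iso M N : gr_isomorphic M N -> finitely_generated M -> finitely_generated N.
Proof. by move=> [f [g [_ _ _ gK]]]; apply: (fg_surj (f := f)) => y; exists (g y). Qed.

Lemma chi_iso M N : finitely_generated M -> gr_isomorphic M N -> chi M = chi N.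
Proof.
move=> Mfg MN; have [n Nn] := chiP (fg_iso MN Mfg).
exact: chi_eq Mfg (euler_iso (gr_iso_sym MN) Nn).
Qed.

Lemma chi_ses M' M M'' : finitely_generated M' -> finitely_generated M ->
  finitely_generated M'' -> ses M' M M'' -> chi M = chi M' +! chi M''.
Proof.
move=> /chiP[? H'] /chiP[? HM] /chiP[? H''] S.
exact: (euler_ses lam_iso lam_dsum S H' H'' HM).
Qed.

Lemma chi_dsum M N : finitely_generated M -> finitely_generated N ->
  chi (gr_dsum M N) = chi M +! chi N.
Proof.
move=> Mfg Nfg; apply: chi_ses => //; first exact: dsum_fg.
apply: (ses_iso (gr_iso_dsum0 M) (gr_iso_refl _)).
  apply: (gr_iso_trans (gr_iso_dsumC _ _) (gr_iso_dsum0 N)).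
exact: ses_dsum (ses_idr M) (ses_idl N).
Qed.

Lemma gr_iso_shift M N n : gr_isomorphic M N ->
  gr_isomorphic (gr_shift M n) (gr_shift N n).
Proof.
move=> [f [g [f0 g0 fK gK]]]; exists f, g.
by split=> // k x xk; [apply: f0|apply: g0].
Qed.

Lemma euler_shift m M n x : euler lam m M x -> euler lam m (gr_shift M n) x.
Proof.
elim: m => [|m IHm] in M x *.
  move=> [P PM ->]; exists (gfp_shift P n); last by rewrite lam_shift.
  exact: gr_iso_shift.
move=> [P [K [y [[i [p [i0 p0 i_inj pS ip]]] Ky xy]]]].
exists (gfp_shift P n), (gr_shift K n), y; split; last by rewrite lam_shift.
  by exists i, p; split=> // k z zk; [apply: i0|apply: p0].
exact: IHm.
Qed.

Lemma chi_shift M n : finitely_generated M -> chi (gr_shift M n) = chi M.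
Proof.
by move=> Mfg; have [m Mm] := chiP Mfg; apply: (@chi_eq m (gr_shift M n) _ Mfg (euler_shift n Mm)).
Qed.

Section Subquotients.
Variable B : grMod A.
Implicit Types S T U V W X Y Z : grSub B.

Definition gs_le S T : Prop := forall x, S x -> T x.
Definition gs_fg S : Prop := finitely_generated (grsub_mod S).
Definition chis S : H := chi (grsub_mod S).

Lemma gs_fg_le S T : gs_le S T -> gs_fg T -> gs_fg S.
Proof.
move=> ST /fg_smod[s [sT sP]]; have [t [ht _ tP]] := homogeneous_span sT.
by apply: (noetherian_span Anoeth ht) => x /ST/sP/tP.
Qed.

Lemma gs_fg_join S T : gs_fg S -> gs_fg T -> gs_fg (gs_join S T).
Proof.
move=> /fg_smod[s [sS sP]] /fg_smod[t [tT tP]]; apply/fg_smod.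
exists (s ++ t); split=> [m|_ [x [y [/sP Sx /tP Ty ->]]]].
  by rewrite mem_cat => /orP[/sS Sm|/tT Tm]; [apply: gs_joinl|apply: gs_joinr].
apply: (smemD (s := lspan_sub (s ++ t))).
  by apply: lspan_trans Sx => u us; apply: lspan_mem; rewrite mem_cat us.
by apply: lspan_trans Ty => u us; apply: lspan_mem; rewrite mem_cat us orbT.
Qed.

(** From the exact sequence of the meet, the direct sum and the join: chi is a *)
(** valuation on the modular lattice of finitely generated graded submodules. *)
Lemma chis_modular S T : gs_fg S -> gs_fg T ->
  chis S +! chis T = chis (gs_meet S T) +! chis (gs_join S T).
Proof.
move=> Sfg Tfg; rewrite -chi_dsum //; apply: chi_ses.
- by apply: gs_fg_le Sfg => x [].
- exact: dsum_fg.
- exact: gs_fg_join.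
pose d : {linear grsub_mod (gs_meet S T) -> dsum B B} :=
  mklin (pair_linear (gs_val (S := gs_meet S T)) (gs_val (S := gs_meet S T))).
pose v : {linear gr_dsum (grsub_mod S) (grsub_mod T) -> dsum B B} :=
  mklin (map_linear (gs_val (S := S)) (gs_val (S := T))).
have v_inj : injective v by move=> [x y] [x' y'] [/gs_val_inj-> /gs_val_inj->].
have [||||i [i0 iE]] := gr_factor_inj (L := gr_dsum B B)
  (M := grsub_mod (gs_meet S T)) (N := gr_dsum (grsub_mod S) (grsub_mod T)) (f := d) (i := v).
- by move=> k x xk.
- by apply: map_degree0; apply: gs_val0.
- exact: v_inj.
- move=> x; have [/gs_val_surj[y yE] /gs_val_surj[z zE]] := gs_valP x.
  by exists (y, z); rewrite /= yE zE.
pose m : {linear gr_dsum (grsub_mod S) (grsub_mod T) -> B} :=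
  mklin (copair_linear (gs_val (S := S)) (\- gs_val (S := T))).
have [||p [p0 pE]] := gs_corestr (M := gr_dsum (grsub_mod S) (grsub_mod T))
  (S := gs_join S T) (f := m).
- apply: copair_degree0; first exact: gs_val0.
  by move=> k x xk; apply/gm_compN/gs_val0.
- move=> [x y]; exists (gs_val x), (- gs_val y).
  by split=> //; [apply: gs_valP|apply/smemN/gs_valP].
exists i, p; split=> //.
- by move=> x y /(congr1 v); rewrite !iE => -[/gs_val_inj].
- move=> z; have [x [y [/gs_val_surj[x' xE] /gs_val_surj[y' yE] zE]]] := gs_valP z.
  exists (x', - y'); apply: (@gs_val_inj _ _ (gs_join S T)).
  by rewrite pE zE /= linearN opprK xE yE.
move=> [x y]; split=> [/(congr1 gs_val)|[z zE]].
  rewrite pE linear0 /= => /eqP; rewrite subr_eq0 => /eqP xy.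
  have : gs_meet S T (gs_val x) by split; [|rewrite xy]; apply: gs_valP.
  by move=> /gs_val_surj[z zE]; exists z; apply: v_inj; rewrite iE /= zE -xy.
apply: (@gs_val_inj _ _ (gs_join S T)); rewrite pE linear0.
by have := iE z; rewrite zE => -[/= -> ->]; rewrite subrr.
Qed.

(** chi (Y / X) = x, without forming a quotient module: Y / X is isomorphic to *)
(** the quotient of V by its intersection with X.                            *)
Definition chi_quo Y X (x : H) : Prop :=
  exists V, [/\ gs_fg V, gs_le V Y, gs_le Y (gs_join V X)
    & x +! chis (gs_meet V X) = chis V].

Lemma chi_quo_ex Y X V : gs_fg V -> gs_le V Y -> gs_le Y (gs_join V X) ->
  exists x, chi_quo Y X x.
Proof.
by move=> Vfg VY YV; exists (ag_sub (chis V) (chis (gs_meet V X))), V; rewrite ag_subK.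
Qed.

Let chis_step U V X : gs_fg U -> gs_le V U -> gs_le U (gs_join V X) ->
  chis V +! chis (gs_meet U X) = chis (gs_meet V X) +! chis U.
Proof.
move=> Ufg VU UV; rewrite chis_modular.
- congr (chis _ +! chis _); apply: grSub_ext => x; split.
  + by move=> [Vx [_ Xx]].
  + by move=> [Vx Xx]; split=> //; split=> //; apply: VU.
  + by move=> [y [z [/VU Uy [Uz _] ->]]]; apply: smemD.
  + move=> Ux; have [y [z [Vy Xz xE]]] := UV x Ux.
    exists y, z; split=> //; split=> //.
    by have -> : z = x - y by [rewrite xE addrC addKr]; apply: smemB => //; apply: VU.
- exact: gs_fg_le Ufg.
- by apply: gs_fg_le Ufg => x [].
Qed.

(** Both the V chosen in [chi_quo] and the given one are compared, by          *)
(** modularity, with their join.                                             *)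
Lemma chi_quo_any Y X V x : chi_quo Y X x -> gs_fg V -> gs_le V Y ->
  gs_le Y (gs_join V X) -> x +! chis (gs_meet V X) = chis V.
Proof.
move=> [V0 [V0fg V0Y YV0 E0]] Vfg VY YV.
have Ufg := gs_fg_join V0fg Vfg.
have UY : gs_le (gs_join V0 V) Y.
  by move=> _ [y [z [/V0Y Yy /VY Yz ->]]]; apply: smemD.
have E1 : chis V0 +! _ = _ :=
  chis_step Ufg (@gs_joinl _ _ _ _) (fun z Uz => YV0 z (UY z Uz)).
have E2 : chis V +! _ = _ :=
  chis_step Ufg (@gs_joinr _ _ _ _) (fun z Uz => YV z (UY z Uz)).
rewrite -E0 (am_addC x) -am_addA in E1; move/ag_addI: E1 => E1.
apply: (@ag_addIr _ (chis (gs_meet (gs_join V0 V) X))).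
by rewrite E2 (am_addC x) -am_addA E1.
Qed.

Lemma chi_quo_uniq Y X x y : chi_quo Y X x -> chi_quo Y X y -> x = y.
Proof.
move=> Yx [V [Vfg VY YV E]].
by apply: (@ag_addIr _ (chis (gs_meet V X))); rewrite E; apply: chi_quo_any Yx _ _ _.
Qed.

Lemma chi_quo_add Z Y X x y : gs_le X Y -> gs_le Y Z ->
  chi_quo Z Y x -> chi_quo Y X y -> chi_quo Z X (x +! y).
Proof.
move=> XY YZ Zx Yy; have [V [Vfg VZ ZV _]] := Zx; have [W [Wfg WY YW _]] := Yy.
have Ufg := gs_fg_join Vfg Wfg; set U := gs_join V W in Ufg.
have UZ : gs_le U Z by move=> _ [a [b [/VZ Za /WY/YZ Zb ->]]]; apply: smemD.
exists U; split=> //.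
  move=> z /ZV[a [b [Va /YW[c [d [Wc Xd ->]]] ->]]].
  by exists (a + c), d; rewrite addrA; split=> //; exists a, c.
have Ex : x +! chis (gs_meet U Y) = chis U.
  apply: (chi_quo_any Zx) => // z /ZV[a [b [Va Yb ->]]].
  by exists a, b; split=> //; apply: gs_joinl.
have Ey : y +! chis (gs_meet (gs_meet U Y) X) = chis (gs_meet U Y).
  apply: (chi_quo_any Yy); first by apply: gs_fg_le Ufg => z [].
    by move=> z [].
  move=> z /YW[c [d [Wc Xd ->]]]; exists c, d; split=> //.
  by split; [apply: gs_joinr|apply: WY].
rewrite -Ex -Ey -am_addA; congr (_ +! (_ +! chis _)); apply: grSub_ext => z.
by split=> [[Uz Xz]|[[Uz _] Xz]] //; split=> //; split=> //; apply: XY.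
Qed.

End Subquotients.

(** * Modules with an automorphism of degree one *)

(** A graded A[t, 1/t]-module, where t has degree one and commutes with A. *)
Record tModule := TModule {
  tm :> grMod A;
  tact : {linear tm -> tm};
  tinv : {linear tm -> tm};
  tactK : cancel tact tinv;
  tinvK : cancel tinv tact;
  tact_deg : forall k x, gm_comp k x -> gm_comp (1 + k) (tact x);
  tinv_deg : forall k x, gm_comp k x -> gm_comp (- 1 + k) (tinv x) }.

Section Lattices.
Variable B : tModule.
Implicit Types R S T V X Y Z : grSub B.
Local Notation t := (@tact B).
Local Notation t' := (@tinv B).

Section Preimage.
Variables (M N : grMod A) (f : {linear M -> N}) (n : int).
Hypothesis f_deg : forall k x, gm_comp k x -> gm_comp (n + k) (f x).
Variable S : grSub N.
Definition pre_sub : submodule M.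
Proof.
exists (fun x => S (f x)) => [|x y Sx Sy|a x Sx].
- by rewrite linear0; apply: smem0.
- by rewrite linearD; apply: smemD.
- by rewrite linearZ_LR; apply: smemZ.
Defined.
Fact pre_hcomp k x : pre_sub x -> pre_sub (hcomp (gm_compP M) k x).
Proof.
move=> /= Sx.
rewrite -(@hcomp_morph _ _ _ _ (gm_compP M) (gm_compP N) f (+%R n)) //.
- exact: gs_hcomp.
- by move=> u v; rewrite linearD.
- exact: addrI.
Qed.
Definition gs_pre : grSub M := GrSub pre_hcomp.
End Preimage.

(** tR, written as the preimage of R under the inverse of t, and t^-1 R. *)
Definition tS S : grSub B := gs_pre (@tinv_deg B) S.
Definition upS S : grSub B := gs_pre (@tact_deg B) S.

Lemma tSE S x : tS S x = S (t' x) :> Prop. Proof. by []. Qed.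
Lemma upSE S x : upS S x = S (t x) :> Prop. Proof. by []. Qed.

Lemma upSK S : tS (upS S) = S.
Proof. by apply: grSub_ext => x; rewrite tSE upSE tinvK. Qed.

Lemma tSK S : upS (tS S) = S.
Proof. by apply: grSub_ext => x; rewrite upSE tSE tactK. Qed.

Lemma tS_iso S : gr_isomorphic (gr_shift (grsub_mod S) (- 1)) (grsub_mod (tS S)).
Proof.
pose f : {linear gr_shift (grsub_mod S) (- 1) -> B} := t \o gs_val (S := S).
have [||g [g0 gE]] := gs_corestr (M := gr_shift (grsub_mod S) (- 1)) (S := tS S) (f := f).
- by move=> k x xk; rewrite -[k](addNKr 1); apply/tact_deg/xk.
- by move=> x; rewrite tSE /= tactK; apply: gs_valP.
apply: (gr_iso_bij g0).
- move=> x y /(congr1 (@gs_val _ _ (tS S))); rewrite !gE => /(can_inj (@tactK B)).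
  exact: gs_val_inj.
- move=> y; have := gs_valP y; rewrite tSE => /gs_val_surj[x xE].
  by exists x; apply: (@gs_val_inj _ _ (tS S)); rewrite gE /= xE tinvK.
Qed.

Lemma tS_fg S : gs_fg S -> gs_fg (tS S).
Proof. by move=> Sfg; apply: fg_iso (tS_iso S) _. Qed.

Lemma chis_tS S : gs_fg S -> chis (tS S) = chis S.
Proof. by move=> Sfg; rewrite /chis -(chi_iso _ (tS_iso S)) // chi_shift. Qed.

Lemma upS_fg S : gs_fg S -> gs_fg (upS S).
Proof.
move=> Sfg; have := tS_iso (upS S); rewrite upSK => /gr_iso_sym I.
exact: (fg_iso I Sfg).
Qed.

Lemma chi_quo_upS Y X x : chi_quo Y X x -> chi_quo (upS Y) (upS X) x.
Proof.
move=> [V [Vfg VY YV E]]; exists (upS V).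
have up U : gs_fg U -> chis (upS U) = chis U.
  by move=> Ufg; rewrite -(chis_tS (upS_fg Ufg)) upSK.
split.
- exact: upS_fg.
- by move=> z; rewrite !upSE; apply: VY.
- move=> z /YV[a [b [Va Xb zE]]]; exists (t' a), (t' b).
  by rewrite !upSE !tinvK -linearD -zE tactK.
- have -> : gs_meet (upS V) (upS X) = upS (gs_meet V X) by apply: grSub_ext.
  by rewrite !up //; apply: gs_fg_le Vfg => z [].
Qed.

(** If B = P[t, 1/t], then R is the Rees module of a filtration of P, and      *)
(** R / tR, which is finitely generated over A, is its associated graded module. *)
Definition lattice R : Prop :=
  gs_le (tS R) R /\ exists V, [/\ gs_fg V, gs_le V R & gs_le R (gs_join V (tS R))].

Lemma lattice_chi R : lattice R -> exists x, chi_quo R (tS R) x.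
Proof. by move=> [_ [V [Vfg VR RV]]]; apply: chi_quo_ex VR RV. Qed.

(** R and R' give the same class if R <= R' <= t^-1 R, since                 *)
(** [R'/tR'] = [R'/R] + [R/tR'] and [R/tR] = [R/tR'] + [tR'/tR], where       *)
(** R'/R and tR'/tR agree up to a shift, which lam ignores.                  *)
Lemma lattice_interlace R R' x : lattice R -> lattice R' ->
  gs_le R R' -> gs_le (tS R') R ->
  chi_quo R (tS R) x -> chi_quo R' (tS R') x.
Proof.
move=> [tR [V [Vfg VR RV]]] [tR' [V' [Vfg' VR' RV']]] RR' tRR' Rx.
have tle S T : gs_le S T -> gs_le (tS S) (tS T).
  by move=> ST z; rewrite !tSE; apply: ST.
have [a Ra] : exists a, chi_quo R' R a.
  apply: chi_quo_ex Vfg' VR' _ => z /RV'[u [v [Vu /tRR' Rv ->]]].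
  by exists u, v.
have [b Rb] : exists b, chi_quo R (tS R') b.
  apply: chi_quo_ex Vfg VR _ => z /RV[u [v [Vu tRv ->]]].
  by exists u, v; split=> //; apply: tle RR' _ _.
have ta : chi_quo (tS R') (tS R) a.
  have [c tc] : exists c, chi_quo (tS R') (tS R) c.
    have [W [Wfg WR' R'W _]] := Ra.
    apply: (@chi_quo_ex _ _ _ (tS W)); [exact: tS_fg|exact: tle|].
    move=> z /R'W[u [v [Wu Rv zE]]]; exists (t u), (t v).
    by rewrite !tSE !tactK -linearD -zE tinvK.
  by have := chi_quo_upS tc; rewrite !tSK => /(chi_quo_uniq Ra)->.
have -> : x = a +! b.
  rewrite am_addC; apply: chi_quo_uniq Rx _.
  by apply: chi_quo_add tRR' Rb ta; apply: tle.
exact: chi_quo_add tRR' RR' Ra Rb.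
Qed.

Definition upn n R := iter n upS R.

Lemma lattice_upS R : lattice R -> lattice (upS R).
Proof.
move=> [tR [V [Vfg VR RV]]]; split.
  by move=> z; rewrite upSK upSE => Rz; apply: tR; rewrite tSE tactK.
exists (upS V); split; first exact: upS_fg.
  by move=> z; rewrite !upSE; apply: VR.
move=> z; rewrite upSE => /RV[u [v [Vu Rv zE]]].
exists (t' u), (t' v); rewrite upSK upSE tinvK -linearD -zE tactK; split=> //.
Qed.

Lemma lattice_join R R' : lattice R -> lattice R' -> lattice (gs_join R R').
Proof.
move=> [tR [V [Vfg VR RV]]] [tR' [V' [Vfg' VR' RV']]]; split.
  move=> z; rewrite tSE => -[u [v [Ru Rv zE]]]; exists (t u), (t v).
  split; [apply: tR|apply: tR'|]; rewrite ?tSE ?tactK //.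
  by rewrite -linearD -zE tinvK.
exists (gs_join V V'); split; first exact: gs_fg_join.
  move=> _ [u [v [/VR Ru /VR' Rv ->]]]; by exists u, v.
move=> _ [u [v [/RV[a [b [Va Rb ->]]] /RV'[c [d [Vc Rd ->]]] ->]]].
exists (a + c), (b + d); rewrite addrACA; split=> //; first by exists a, c.
by rewrite tSE linearD; exists (t' b), (t' d).
Qed.

(** Each R' + t^-i R contains the previous one and is contained in its image  *)
(** under t^-1. The first is R' + R and the n-th one is t^-n R.              *)
Lemma lattice_join_chi R R' n x y : lattice R -> lattice R' ->
  gs_le R' (upn n R) -> chi_quo R (tS R) x ->
  chi_quo (gs_join R' R) (tS (gs_join R' R)) y -> x = y.
Proof.
move=> LR LR' RR' Rx Ry.
have Ln i : lattice (upn i R) by elim: i => //= i; apply: lattice_upS.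
have Rxn i : chi_quo (upn i R) (tS (upn i R)) x.
  by elim: i => //= i /chi_quo_upS; rewrite upSK tSK.
have Ryn i : chi_quo (gs_join R' (upn i R)) (tS (gs_join R' (upn i R))) y.
  elim: i => //= i; apply: lattice_interlace; try exact: lattice_join.
  - exact: lattice_join LR' (lattice_upS (Ln i)).
  - move=> _ [u [v [Ru Rv ->]]]; exists u, v; split=> //.
    by rewrite upSE; apply: (proj1 (Ln i)); rewrite tSE tactK.
  - move=> z [u [v [Ru Rv zE]]]; exists (t u), (t v); split.
    + by apply: (proj1 LR'); rewrite tSE tactK.
    + exact: Rv.
    + by rewrite -linearD -zE tinvK.
apply: chi_quo_uniq (Rxn n) _.
suff <- : gs_join R' (upn n R) = upn n R by apply: Ryn.
apply: grSub_ext => z; split=> [[u [v [/RR' Ru Rv ->]]]|Rz]; first exact: smemD.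
exact: gs_joinr.
Qed.

(** If B = P[t, 1/t], these are the Rees modules of the good filtrations of P: *)
(** finitely generated over A[t], and exhaustive.                            *)
Definition good R : Prop := exists V,
  [/\ gs_fg V, gs_le V R,
      gs_le (tS R) R /\ (forall S, gs_le (tS S) S -> gs_le V S -> gs_le R S)
    & forall x, exists n, upn n R x].

Lemma tS_stable S x : gs_le (tS S) S -> S x -> S (t x).
Proof. by move=> tSS Sx; apply: tSS; rewrite tSE tactK. Qed.

(** V + tR is stable under t and contains V. *)
Lemma good_step R V : gs_le V R -> gs_le (tS R) R ->
    (forall S, gs_le (tS S) S -> gs_le V S -> gs_le R S) ->
  gs_le R (gs_join V (tS R)).
Proof.
move=> VR tR minR; apply: minR; last exact: gs_joinl.
move=> z; rewrite tSE => -[u [v [/VR Ru tRv zE]]]; exists 0, z.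
rewrite add0r tSE; split=> //; first exact: smem0.
by rewrite zE; apply: smemD => //; apply: tR.
Qed.

Lemma good_lattice R : good R -> lattice R.
Proof.
move=> [V [Vfg VR [tR minR] exR]]; split=> //; exists V; split=> //.
exact: good_step.
Qed.

Lemma upn_stable n R : gs_le (tS R) R -> gs_le (tS (upn n R)) (upn n R).
Proof.
move=> tR; elim: n => //= n IHn z; rewrite upSK upSE => Rz.
exact: tS_stable.
Qed.

Lemma upn_mono m n R : (m <= n)%N -> gs_le (tS R) R -> gs_le (upn m R) (upn n R).
Proof.
move=> /subnKC<- tR; elim: (n - m)%N => [|k IHk]; rewrite ?addn0 // addnS => z /IHk.
by move=> Rz; rewrite /upn iterS upSE; apply: tS_stable Rz; apply: upn_stable.
Qed.

(** Any two good filtrations are comparable up to a shift: finitely many       *)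
(** generators of R all lie in some t^-n R'.                                 *)
Lemma good_le R R' : good R -> good R' -> exists n, gs_le R (upn n R').
Proof.
move=> [V [/fg_smod[s [sV sP]] VR [tR minR] exR]] [_ [_ _ [tR' _] exR']].
have [n sn] : exists n, forall m, m \in s -> upn n R' m.
  elim: s {sV sP} => [|m s [n IHs]]; first by exists 0%N.
  have [k mk] := exR' m; exists (maxn k n) => u; rewrite inE => /predU1P[->|us].
    exact: upn_mono (leq_maxl k n) tR' _ mk.
  exact: upn_mono (leq_maxr k n) tR' _ (IHs u us).
exists n; apply: minR; first exact: upn_stable.
by move=> z /sP; apply: lspan_min.
Qed.

(** Both agree with the class given by R + R'. *)
Lemma good_chi_uniq R R' x x' : good R -> good R' ->
  chi_quo R (tS R) x -> chi_quo R' (tS R') x' -> x = x'.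
Proof.
move=> GR GR' Rx Rx'; have [LR LR'] := (good_lattice GR, good_lattice GR').
have [y Ry] := lattice_chi (lattice_join LR' LR).
have [n RR'] := good_le GR' GR; rewrite (lattice_join_chi LR LR' RR' Rx Ry).
have E : gs_join R' R = gs_join R R'.
  by apply: grSub_ext => z; split=> -[u [v [Ru Rv ->]]]; exists v, u; rewrite addrC.
have [m RR''] := good_le GR GR'; rewrite E in Ry.
by rewrite -(lattice_join_chi LR' LR RR'' Rx' Ry).
Qed.

Definition tclass x : Prop := exists R, good R /\ chi_quo R (tS R) x.

Lemma tclass_uniq x y : tclass x -> tclass y -> x = y.
Proof. by move=> [R [GR Rx]] [R' [GR' Ry]]; apply: good_chi_uniq Rx Ry. Qed.

Definition tspan_sub V : submodule B.
Proof.
exists (fun x => forall S, gs_le (tS S) S -> gs_le V S -> S x).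
- by move=> S _ _; apply: smem0.
- by move=> x y Hx Hy S tSS VS; apply: smemD; [apply: Hx|apply: Hy].
- by move=> a x Hx S tSS VS; apply/smemZ/Hx.
Defined.

Fact tspan_hcomp V k x : tspan_sub V x -> tspan_sub V (hcomp (gm_compP B) k x).
Proof. by move=> Hx S tSS VS; apply/gs_hcomp/Hx. Qed.

Definition tspan V : grSub B := GrSub (@tspan_hcomp V).

Lemma tspan_le V : gs_le V (tspan V).
Proof. by move=> x Vx S _ VS; apply: VS. Qed.

Lemma tspan_stable V : gs_le (tS (tspan V)) (tspan V).
Proof. by move=> x Hx S tSS VS; apply: (tSS); apply: (Hx S). Qed.

Lemma tspan_good V : gs_fg V -> (forall x, exists n, upn n (tspan V) x) ->
  good (tspan V).
Proof.
move=> Vfg ex; exists V; split=> //; first exact: tspan_le.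
split; first exact: tspan_stable.
by move=> S tSS VS x Hx; apply: Hx.
Qed.

End Lattices.
End Chi.

Arguments tact {A B} : rename.
Arguments tinv {A B} : rename.

(** * Laurent modules *)

Definition biseq (A : grRing) (P : rmodType A) : Type := int -> P.

Section Biseq.
Variables (A : grRing) (P : rmodType A).
Local Notation biseq := (biseq P).

HB.instance Definition _ := gen_eqMixin biseq.
HB.instance Definition _ := gen_choiceMixin biseq.

Let zero : biseq := fun=> 0.
Let opp (f : biseq) : biseq := fun k => - f k.
Let add (f g : biseq) : biseq := fun k => f k + g k.

Fact biseq_addA : associative add.
Proof. by move=> f g h; apply: funext => k; apply: addrA. Qed.
Fact biseq_addC : commutative add.
Proof. by move=> f g; apply: funext => k; apply: addrC. Qed.
Fact biseq_add0 : left_id zero add.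
Proof. by move=> f; apply: funext => k; apply: add0r. Qed.
Fact biseq_addN : left_inverse zero opp add.
Proof. by move=> f; apply: funext => k; apply: addNr. Qed.

HB.instance Definition _ := GRing.isZmodule.Build biseq
  biseq_addA biseq_addC biseq_add0 biseq_addN.

(** The value at k is the sum of the a_i *: f (k - i) over the components a_i of *)
(** a. The sum is finite for every f; supports are restricted afterwards.    *)
Definition biseq_scale (a : A^c) (f : biseq) : biseq :=
  fun k => glue (gr_compP A) (fun i (b : A) => (b : A^c) *: f (k - i)) a.

Let scaleB (f : biseq) (k i : int) (a b : A) :
  ((a - b : A) : A^c) *: f (k - i) = (a : A^c) *: f (k - i) - (b : A^c) *: f (k - i).
Proof. exact: scalerBl. Qed.

Lemma biseq_scale_hom i (a : A) f k :
  gr_comp i a -> biseq_scale a f k = (a : A^c) *: f (k - i).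
Proof. by move=> ai; rewrite /biseq_scale (glue_hom _ _ ai). Qed.

Lemma biseq_scale0l f : biseq_scale 0 f = zero.
Proof. by apply: funext => k; rewrite /biseq_scale (glue0 _ (scaleB f k)). Qed.

Lemma biseq_scaleDl f a b : biseq_scale (a + b) f = add (biseq_scale a f) (biseq_scale b f).
Proof. by apply: funext => k; rewrite /biseq_scale (glueD _ (scaleB f k)). Qed.

Lemma biseq_scaleDr a : {morph biseq_scale a : f g / add f g}.
Proof.
move=> f g; apply: funext => k; rewrite /add; elim/grA_ind: a => [|i a ai|a b Ha Hb].
- by rewrite !biseq_scale0l /zero addr0.
- by rewrite !(biseq_scale_hom _ _ ai) scalerDr.
- by rewrite !biseq_scaleDl /add Ha Hb addrACA.
Qed.

Fact biseq_scaleA (a b : A^c) f :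
  biseq_scale a (biseq_scale b f) = biseq_scale (a * b) f.
Proof.
apply: funext => k; elim/grA_ind: a => [|i a ai|a c Ha Hc].
- by rewrite mul0r !biseq_scale0l.
- rewrite (biseq_scale_hom _ _ ai); elim/grA_ind: b => [|j b bj|b c Hb Hc].
  + by rewrite mulr0 !biseq_scale0l scaler0.
  + rewrite (biseq_scale_hom _ _ bj) scalerA.
    by rewrite (biseq_scale_hom _ _ (gr_compM bj ai)) opprD addrA addrAC.
  + by rewrite mulrDr !biseq_scaleDl /add scalerDr Hb Hc.
- by rewrite mulrDl !biseq_scaleDl /add Ha Hc.
Qed.

Fact biseq_scale1 : left_id (1 : A^c) biseq_scale.
Proof.
move=> f; apply: funext => k.
by rewrite (biseq_scale_hom _ _ (gr_comp1 A)) subr0 scale1r.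
Qed.

HB.instance Definition _ := GRing.Zmodule_isLmodule.Build A^c biseq
  biseq_scaleA biseq_scale1 biseq_scaleDr biseq_scaleDl.

End Biseq.

Section Laurent.
Variable A : grRing.
Implicit Types P N : rmodType A.

Lemma biseq_addE P (f g : biseq P) k : (f + g) k = f k + g k. Proof. by []. Qed.
Lemma biseq_homE P i (a : A) (f : biseq P) k :
  gr_comp i a -> ((a : A^c) *: f) k = (a : A^c) *: f (k - i).
Proof. exact: biseq_scale_hom. Qed.

Definition fsupp P (f : biseq P) : Prop :=
  exists s : seq int, forall k, k \notin s -> f k = 0.

Fact fsuppD P (x y : biseq P) : fsupp x -> fsupp y -> fsupp (x + y).
Proof.
move=> [s sP] [t tP]; exists (s ++ t) => k; rewrite mem_cat negb_or => /andP[ks kt].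
by rewrite biseq_addE sP // tP // addr0.
Qed.

Fact fsuppZ P (a : A^c) (f : biseq P) : fsupp f -> fsupp (a *: f).
Proof.
move=> [s sP]; elim/grA_ind: a => [|i a ai|a b Ha Hb].
- by exists [::] => k _; rewrite scale0r.
- exists [seq k + i | k <- s] => k nk; rewrite (biseq_homE _ _ ai) sP ?scaler0 //.
  by apply: contraNN nk => ks; apply/mapP; exists (k - i); rewrite ?subrK.
- by rewrite scalerDl; apply: fsuppD.
Qed.

Fact fsupp0 P : fsupp (0 : biseq P). Proof. by exists [::]. Qed.

Definition fsupp_sub P : submodule (biseq P) :=
  Submodule (@fsupp0 P) (@fsuppD P) (@fsuppZ P).

(** P[t, 1/t]: the coefficient of t^k sits in degree k, and a homogeneous      *)
(** scalar of degree i sends p t^k to (p a) t^(k + i).                       *)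
Definition lau_mod P : rmodType A := smod (fsupp_sub P).

Definition lcoef P (k : int) (x : lau_mod P) : P := smod_val x k.

Lemma lcoefP P (x y : lau_mod P) : (forall k, lcoef k x = lcoef k y) -> x = y.
Proof. by move=> E; apply: smod_val_inj; apply: funext => k; apply: E. Qed.

Lemma lau_supp P (x : lau_mod P) :
  exists s : seq int, forall k, k \notin s -> lcoef k x = 0.
Proof. exact: (@smod_valP _ _ (fsupp_sub P) x). Qed.

Lemma lcoef0 P k : lcoef k (0 : lau_mod P) = 0.
Proof. by rewrite /lcoef linear0. Qed.

Lemma lcoefD P k (x y : lau_mod P) : lcoef k (x + y) = lcoef k x + lcoef k y.
Proof. by rewrite /lcoef linearD. Qed.

Lemma lcoefN P k (x : lau_mod P) : lcoef k (- x) = - lcoef k x.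
Proof. by rewrite /lcoef linearN. Qed.

Lemma lcoefB P k (x y : lau_mod P) : lcoef k (x - y) = lcoef k x - lcoef k y.
Proof. by rewrite lcoefD lcoefN. Qed.

Lemma lcoef_sum P k (I : Type) (s : seq I) (f : I -> lau_mod P) :
  lcoef k (\sum_(i <- s) f i) = \sum_(i <- s) lcoef k (f i).
Proof. by apply: (big_morph (lcoef k)) => [x y|]; [apply: lcoefD|apply: lcoef0]. Qed.

Lemma lcoef_hom P k i (a : A) (x : lau_mod P) :
  gr_comp i a -> lcoef k ((a : A^c) *: x) = (a : A^c) *: lcoef (k - i) x.
Proof. by move=> ai; rewrite /lcoef linearZ_LR; apply: biseq_homE. Qed.

Fact mono_fsupp P k (p : P) :
  fsupp_sub P (fun j => if j == k then p else 0).
Proof. by exists [:: k] => j; rewrite inE => /negPf->. Qed.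

Definition mono P k (p : P) : lau_mod P := smod_mk (mono_fsupp k p).

Lemma lcoef_mono P j k (p : P) : lcoef j (mono k p) = if j == k then p else 0.
Proof. by rewrite /lcoef smod_mkK. Qed.

Lemma monoD P k (p q : P) : mono k (p + q) = mono k p + mono k q.
Proof. by apply: lcoefP => j; rewrite lcoefD !lcoef_mono; case: eqP; rewrite ?addr0. Qed.

Lemma mono0 P k : mono k (0 : P) = 0.
Proof. by apply: lcoefP => j; rewrite lcoef0 lcoef_mono; case: eqP. Qed.

Lemma pick_sum P (s : seq int) (f : int -> P) j : uniq s ->
  \sum_(k <- s) (if j == k then f k else 0) = if j \in s then f j else 0.
Proof.
move=> us; case: ifP => js.
  rewrite (big_rem j) //= eqxx big_seq big1 ?addr0 // => k.
  by rewrite mem_rem_uniq // inE eq_sym => /andP[/negPf->].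
rewrite big_seq big1 // => k ks; case: eqP => // jk.
by rewrite jk ks in js.
Qed.

Lemma mono_decomp P (x : lau_mod P) :
  exists2 s : seq int, uniq s & x = \sum_(k <- s) mono k (lcoef k x).
Proof.
have [s sP] := lau_supp x; exists (undup s); first exact: undup_uniq.
apply: lcoefP => j; rewrite lcoef_sum.
under eq_bigr do rewrite lcoef_mono.
rewrite pick_sum ?undup_uniq // mem_undup; case: ifPn => // js.
exact: sP.
Qed.

Definition lau_comp P (k : int) (x : lau_mod P) : Prop :=
  forall j, j != k -> lcoef j x = 0.

Lemma mono_comp P k (p : P) : lau_comp k (mono k p).
Proof. by move=> j /negPf jk; rewrite lcoef_mono jk. Qed.

Fact lau_grading P : direct_grading (@lau_comp P).
Proof.
split=> [k j _|k x y xk yk j jk|x|s f us fG f0 k ks].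
- exact: lcoef0.
- by rewrite lcoefB xk // yk // subr0.
- have [s us xE] := mono_decomp x.
  exists [seq mono k (lcoef k x) | k <- s]; rewrite big_map; split=> //.
  by move=> _ /mapP[k _ ->]; exists k; apply: mono_comp.
- apply: lcoefP => j; rewrite lcoef0; have [->|jk] := eqVneq j k; last exact: fG.
  have := congr1 (lcoef k) f0; rewrite lcoef0 lcoef_sum.
  under eq_bigr => i _.
    have -> : lcoef k (f i) = if k == i then lcoef i (f i) else 0.
      by case: eqVneq => [->//|ki]; apply: fG.
    over.
  by rewrite (@pick_sum P s (fun i => lcoef i (f i))) // ks.
Qed.

Fact lau_scale P i j (x : lau_mod P) (a : A) :
  lau_comp i x -> gr_comp j a -> lau_comp (i + j) ((a : A^c) *: x).
Proof.
move=> xi aj k kij; rewrite (lcoef_hom _ _ aj) xi ?scaler0 //.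
by apply: contraNneq kij => <-; rewrite subrK.
Qed.

Definition lau P : grMod A := GrMod (@lau_grading P) (@lau_scale P).

Lemma lcoef_hcomp P j k (x : lau P) :
  lcoef j (hcomp (gm_compP (lau P)) k x) = if j == k then lcoef j x else 0.
Proof.
case: eqVneq => [->|jk]; last exact: (hcomp_hom (gm_compP (lau P)) k x).
rewrite {2}(hcomp_sum (gm_compP (lau P)) x) lcoef_sum.
have [us _ sP _] := hcompP (gm_compP (lau P)) x.
under eq_bigr => i _.
  have -> : lcoef k (hcomp (gm_compP (lau P)) i x) =
      if k == i then lcoef i (hcomp (gm_compP (lau P)) i x) else 0.
    case: eqVneq => [->//|ki]; exact: (hcomp_hom (gm_compP (lau P)) i x).
  over.
rewrite (pick_sum (fun i => lcoef i (hcomp (gm_compP (lau P)) i x))) //.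
by case: ifPn => // /sP ->; rewrite lcoef0.
Qed.

Section Shift.
Variables (P : rmodType A) (n : int).

(** Multiplication by t^n. *)
Definition bshift (f : biseq P) : biseq P := fun k => f (k - n).

Fact bshift_linear : linear bshift.
Proof.
move=> a f g; apply: funext => k; congr (_ + _).
elim/grA_ind: a => [|i a ai|a b Ha Hb].
- by rewrite /bshift !scale0r.
- by rewrite /bshift !(biseq_homE _ _ ai) addrAC.
- by move: Ha Hb; rewrite /bshift !scalerDl !biseq_addE => -> ->.
Qed.

Fact bshift_fsupp (x : lau_mod P) :
  fsupp_sub P ((mklin bshift_linear \o smod_val (S := fsupp_sub P)) x).
Proof.
have [s sP] := lau_supp x; exists [seq k + n | k <- s] => k nk.
apply: sP; apply: contraNN nk => ks.
by apply/mapP; exists (k - n); rewrite ?subrK.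
Qed.

Definition tpow : {linear lau_mod P -> lau_mod P} := corestr bshift_fsupp.

Lemma lcoef_shift k x : lcoef k (tpow x) = lcoef (k - n) x.
Proof. by rewrite /lcoef corestrE. Qed.

Lemma shift_comp k (x : lau P) : gm_comp k x -> @gm_comp A (lau P) (n + k) (tpow x).
Proof.
move=> xk j jnk; rewrite lcoef_shift xk //.
by apply: contraNneq jnk => <-; rewrite addrC subrK.
Qed.

End Shift.
Arguments tpow {P} n.

Lemma shift_mono P n k (p : P) : tpow n (mono k p) = mono (k + n) p.
Proof. by apply: lcoefP => j; rewrite lcoef_shift !lcoef_mono subr_eq. Qed.

Lemma shift_add P m n (x : lau_mod P) : tpow m (tpow n x) = tpow (m + n) x.
Proof. by apply: lcoefP => k; rewrite !lcoef_shift opprD addrA. Qed.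

Lemma shift0 P (x : lau_mod P) : tpow 0 x = x.
Proof. by apply: lcoefP => k; rewrite lcoef_shift subr0. Qed.

Definition laut P : tModule A.
Proof.
exists (lau P) (tpow 1) (tpow (- 1)).
- by move=> x; apply: (etrans (shift_add (- 1) 1 x)); rewrite addNr shift0.
- by move=> x; apply: (etrans (shift_add 1 (- 1) x)); rewrite addrN shift0.
- by move=> k x; apply: shift_comp.
- by move=> k x; apply: shift_comp.
Defined.

Lemma iter_shift P n (x : laut P) : iter n (@tact A (laut P)) x = tpow n%:Z x.
Proof.
elim: n => [|n IHn]; first by rewrite [RHS]shift0.
by rewrite iterS IHn; apply: shift_add.
Qed.

Section Map.
Variables (P N : rmodType A) (f : {linear P -> N}).

Definition bmap (g : biseq P) : biseq N := fun k => f (g k).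

Fact bmap_linear : linear bmap.
Proof.
move=> a g h; apply: funext => k.
rewrite /bmap !biseq_addE linearD; congr (_ + _).
elim/grA_ind: a => [|i a ai|a b Ha Hb].
- by rewrite !scale0r linear0.
- by rewrite !(biseq_homE _ _ ai) linearZ_LR.
- by rewrite !scalerDl !biseq_addE linearD Ha Hb.
Qed.

Fact bmap_fsupp (x : lau_mod P) :
  fsupp_sub N ((mklin bmap_linear \o smod_val (S := fsupp_sub P)) x).
Proof.
by have [s sP] := lau_supp x; exists s => k /sP xk; rewrite /= /bmap -/(lcoef k x) xk linear0.
Qed.

Definition lmap : {linear lau_mod P -> lau_mod N} := corestr bmap_fsupp.

Lemma lcoef_map k x : lcoef k (lmap x) = f (lcoef k x).
Proof. by rewrite /lcoef corestrE. Qed.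

Lemma map_comp0 : degree0 (M := lau P) (N := lau N) lmap.
Proof. by move=> k x xk j jk; rewrite lcoef_map xk // linear0. Qed.

Lemma map_shift n x : lmap (tpow n x) = tpow n (lmap x).
Proof. by apply: lcoefP => k; rewrite lcoef_map !lcoef_shift lcoef_map. Qed.

Lemma map_mono k p : lmap (mono k p) = mono k (f p).
Proof. by apply: lcoefP => j; rewrite lcoef_map !lcoef_mono; case: eqP; rewrite ?linear0. Qed.

End Map.
Arguments lmap {P N} f.

Section Adjoint.
Variables (F : grMod A) (P : rmodType A) (pi : {linear F -> P}).
Local Notation pr k x := (hcomp (gm_compP F) k x).

(** P |-> P[t, 1/t] is right adjoint to forgetting the grading; [homogenize pi] *)
(** is the map of degree zero from F to P[t, 1/t] adjoint to pi.             *)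
Definition bhom (x : F) : biseq P := fun k => pi (pr k x).

Fact bhom_linear : linear bhom.
Proof.
move=> a x y; apply: funext => k; rewrite /bhom hcompD linearD; congr (_ + _).
elim/grA_ind: a => [|i a ai|a b Ha Hb].
- by rewrite !scale0r hcomp0 linear0.
- rewrite (biseq_homE _ _ ai) -linearZ_LR -(hcompZ ai); congr (pi (pr _ _)).
  by rewrite subrK.
- by rewrite !scalerDl biseq_addE hcompD linearD Ha Hb.
Qed.

Fact bhom_fsupp x : fsupp_sub P (mklin bhom_linear x).
Proof.
have [_ _ sP _] := hcompP (gm_compP F) x.
by exists (hsupp (gm_compP F) x) => k /sP xk; rewrite /= /bhom xk linear0.
Qed.

Definition homogenize : {linear F -> lau_mod P} := corestr bhom_fsupp.

Lemma lcoef_homogenize k x : lcoef k (homogenize x) = pi (pr k x).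
Proof. by rewrite /lcoef corestrE. Qed.

Lemma homogenize_degree0 : degree0 (M := F) (N := lau P) homogenize.
Proof.
move=> k x xk j jk.
by rewrite lcoef_homogenize (hcomp_other _ _ xk) (negPf jk) linear0.
Qed.

Lemma homogenize_hom k x : gm_comp k x -> homogenize x = mono k (pi x).
Proof.
move=> xk; apply: lcoefP => j; rewrite lcoef_homogenize lcoef_mono (hcomp_other _ _ xk).
by case: eqP; rewrite ?linear0.
Qed.

End Adjoint.
Arguments homogenize {F P} pi.
End Laurent.

Arguments tpow {A P} n.
Arguments lmap {A P N} f.
Arguments homogenize {A F P} pi.

(** * The graded class of an ungraded projective module *)

Section Classes.
Variable A : grRing.
Hypotheses (Anoeth : gr_right_noetherian A) (Areg : gr_right_regular A).
Variables (H : abGroup) (lam : grFgProj A -> H).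
Hypothesis lam_iso : forall P Q, gfp_iso P Q -> lam P = lam Q.
Hypothesis lam_dsum : forall P Q, lam (gfp_dsum P Q) = lam P +! lam Q.
Hypothesis lam_shift : forall P n, lam (gfp_shift P n) = lam P.

Lemma gr_img_fg (M N : grMod A) (h : {linear M -> N}) (h0 : degree0 h) (S : grSub M) :
  gs_fg S -> gs_fg (gr_img h0 S).
Proof.
move=> /fg_smod[s [sS sP]]; apply/fg_smod; exists (map h s); split.
  by move=> _ /mapP[m ms ->]; exists m => //; apply: sS.
by move=> _ [x Sx <-]; apply/lspan_map/sP.
Qed.

Section DirectSums.
Variables (B1 B2 B : tModule A) (h1 : {linear B1 -> B}) (h2 : {linear B2 -> B}).
Hypotheses (h10 : degree0 h1) (h20 : degree0 h2).
Hypotheses (h1t : forall x, h1 (tact x) = tact (h1 x))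
           (h2t : forall x, h2 (tact x) = tact (h2 x)).
Hypothesis h_span : forall z, exists x y, z = h1 x + h2 y.
Hypothesis h_free : forall x y, h1 x + h2 y = 0 -> x = 0 /\ y = 0.

Definition dsumS (S1 : grSub B1) (S2 : grSub B2) : grSub B := gs_join (gr_img h10 S1) (gr_img h20 S2).

Lemma dsumSE (S1 : grSub B1) (S2 : grSub B2) x y : dsumS S1 S2 (h1 x + h2 y) <-> S1 x /\ S2 y.
Proof.
split=> [[_ [_ [[x' Sx <-] [y' Sy <-] E]]]|[Sx Sy]].
  have [|xE yE] := @h_free (x - x') (y - y').
    by rewrite !linearB addrACA -opprD E subrr.
  by rewrite -[x](subrK x') -[y](subrK y') xE yE !add0r.
by exists (h1 x), (h2 y); split=> //; [exists x|exists y].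
Qed.

Lemma dsumS_ext (S1 : grSub B1) (S2 : grSub B2) (S : grSub B) :
  (forall x y, S (h1 x + h2 y) <-> S1 x /\ S2 y) -> S = dsumS S1 S2.
Proof.
move=> SE; apply: grSub_ext => z; have [x [y ->]] := h_span z.
by rewrite dsumSE SE.
Qed.

Lemma tinv_dsum x y : tinv (h1 x + h2 y) = h1 (tinv x) + h2 (tinv y).
Proof.
by rewrite linearD -[x in LHS]tinvK -[y in LHS]tinvK h1t h2t !tactK.
Qed.

Lemma tS_dsumS (S1 : grSub B1) (S2 : grSub B2) : tS (dsumS S1 S2) = dsumS (tS S1) (tS S2).
Proof. by apply: dsumS_ext => x y; rewrite tSE tinv_dsum dsumSE. Qed.

Lemma meet_dsumS (S1 T1 : grSub B1) (S2 T2 : grSub B2) :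
  gs_meet (dsumS S1 S2) (dsumS T1 T2) = dsumS (gs_meet S1 T1) (gs_meet S2 T2).
Proof.
apply: dsumS_ext => x y; split=> [[/dsumSE[? ?] /dsumSE[? ?]]|[[? ?] [? ?]]] //.
by split; apply/dsumSE.
Qed.

Lemma dsumS_fg (S1 : grSub B1) (S2 : grSub B2) : gs_fg S1 -> gs_fg S2 -> gs_fg (dsumS S1 S2).
Proof. by move=> fg1 fg2; apply: gs_fg_join; apply: gr_img_fg. Qed.

Lemma chis_dsumS (S1 : grSub B1) (S2 : grSub B2) : gs_fg S1 -> gs_fg S2 ->
  chis lam (dsumS S1 S2) = chis lam S1 +! chis lam S2.
Proof.
move=> fg1 fg2.
rewrite /chis -(chi_dsum Anoeth Areg lam_iso lam_dsum fg1 fg2); apply/esym.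
apply: (chi_iso Anoeth Areg lam_iso lam_dsum); first exact: dsum_fg.
pose f : {linear gr_dsum (grsub_mod S1) (grsub_mod S2) -> B} :=
  mklin (copair_linear (h1 \o gs_val (S := S1)) (h2 \o gs_val (S := S2))).
have fE x : f x = h1 (gs_val x.1) + h2 (gs_val x.2) by [].
have [||g [g0 gE]] := gs_corestr (S := dsumS S1 S2)
  (M := gr_dsum (grsub_mod S1) (grsub_mod S2)) (f := f).
- by apply: copair_degree0 => k x xk; [apply: h10|apply: h20].
- by move=> x; rewrite fE; apply/dsumSE; split; apply: gs_valP.
apply: (gr_iso_bij g0).
  move=> x y; move/(congr1 (@gs_val _ _ (dsumS S1 S2))); rewrite !gE => E.
  have : f (x - y) = 0 by rewrite linearB E subrr.
  rewrite fE => /h_free[]; rewrite !linearB => /eqP E1 /eqP E2.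
  move: E1 E2; rewrite !subr_eq0 => /eqP/gs_val_inj E1 /eqP/gs_val_inj E2.
  by rewrite [x]surjective_pairing E1 E2 -surjective_pairing.
move=> z; have := gs_valP z; have [x [y zE]] := h_span (gs_val z).
rewrite zE => /dsumSE[/gs_val_surj[x' xE] /gs_val_surj[y' yE]].
exists (x', y'); apply: (@gs_val_inj _ _ (dsumS S1 S2)).
by rewrite gE fE xE yE.
Qed.

Lemma upnE (C : tModule A) n (R : grSub C) x : upn n R x = R (iter n (@tact A C) x) :> Prop.
Proof. by elim: n x => // n IHn x; rewrite iterSr -IHn. Qed.

Lemma iter_dsum n x y : iter n (@tact A B) (h1 x + h2 y) =
  h1 (iter n (@tact A B1) x) + h2 (iter n (@tact A B2) y).
Proof. by elim: n => //= n ->; rewrite linearD h1t h2t. Qed.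

Lemma good_dsumS (R1 : grSub B1) (R2 : grSub B2) : good R1 -> good R2 -> good (dsumS R1 R2).
Proof.
move=> [V1 [fg1 VR1 [tR1 min1] ex1]] [V2 [fg2 VR2 [tR2 min2] ex2]].
exists (dsumS V1 V2); split.
- exact: dsumS_fg.
- move=> z; have [x [y ->]] := h_span z.
  by move=> /dsumSE[/VR1 Rx /VR2 Ry]; apply/dsumSE.
- split; first move=> z.
    rewrite tS_dsumS; have [x [y ->]] := h_span z.
    by move=> /dsumSE[/tR1 Rx /tR2 Ry]; apply/dsumSE.
  move=> S tSS VS z; have [x [y ->]] := h_span z => /dsumSE[Rx Ry].
  have d1 k u : gm_comp k u -> gm_comp (0 + k) (h1 u) by rewrite add0r => /h10.
  have d2 k u : gm_comp k u -> gm_comp (0 + k) (h2 u) by rewrite add0r => /h20.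
  apply: smemD.
    suff: gs_pre d1 S x by [].
    apply: (min1) Rx => u /=.
      move=> Su; rewrite -[u]tinvK h1t; exact: tS_stable.
    move=> Vu; apply: VS; rewrite -[h1 u]addr0 -(linear0 h2); apply/dsumSE.
    by split=> //; apply: smem0.
  suff: gs_pre d2 S y by [].
  apply: (min2) Ry => u /=.
    move=> Su; rewrite -[u]tinvK h2t; exact: tS_stable.
  move=> Vu; apply: VS; rewrite -[h2 u]add0r -(linear0 h1); apply/dsumSE.
  by split=> //; apply: smem0.
- move=> z; have [x [y ->]] := h_span z; have [m xm] := ex1 x; have [n yn] := ex2 y.
  exists (maxn m n); rewrite upnE iter_dsum; apply/dsumSE.
  split; rewrite -upnE; [apply: upn_mono xm => //|apply: upn_mono yn => //].
    exact: leq_maxl.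
  exact: leq_maxr.
Qed.

(** The sum of good filtrations of two summands is a good filtration. *)
Lemma tclass_dsum x1 x2 : tclass lam B1 x1 -> tclass lam B2 x2 ->
  tclass lam B (x1 +! x2).
Proof.
move=> [R1 [G1 [V1 [fg1 VR1 RV1 E1]]]] [R2 [G2 [V2 [fg2 VR2 RV2 E2]]]].
exists (dsumS R1 R2); split; first exact: good_dsumS.
exists (dsumS V1 V2); split.
- exact: dsumS_fg.
- move=> z; have [x [y ->]] := h_span z.
  by move=> /dsumSE[/VR1 Rx /VR2 Ry]; apply/dsumSE.
- move=> z; have [x [y ->]] := h_span z.
  move=> /dsumSE[/RV1[a [b [Va Rb ->]]] /RV2[c [d [Vc Rd ->]]]].
  exists (h1 a + h2 c), (h1 b + h2 d); rewrite tS_dsumS.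
  by split; [apply/dsumSE|apply/dsumSE|rewrite !linearD addrACA].
- have fgm (C : grMod A) (S T : grSub C) : gs_fg S -> gs_fg (gs_meet S T).
    by move=> Sfg; apply: (gs_fg_le Anoeth _ Sfg) => z [].
  rewrite tS_dsumS meet_dsumS !chis_dsumS //; try exact: fgm.
  by rewrite ag_addACA E1 E2.
Qed.

End DirectSums.

(** x is the Euler characteristic of the graded module associated with the good *)
(** filtrations of P.                                                        *)
Definition pclass (P : rmodType A) x : Prop := tclass lam (laut P) x.

Lemma pclass_uniq P x y : pclass P x -> pclass P y -> x = y.
Proof. exact: tclass_uniq. Qed.

Lemma lau_ind (P : rmodType A) (Q : lau_mod P -> Prop) : Q 0 ->
  (forall k p, Q (mono k p)) -> (forall x y, Q x -> Q y -> Q (x + y)) ->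
  forall x, Q x.
Proof.
move=> Q0 Qm QD x; have [s _ ->] := mono_decomp x.
by elim/big_ind: _ => //.
Qed.

Lemma pclass_dsum (P1 P2 P : rmodType A) (f1 : {linear P1 -> P}) (f2 : {linear P2 -> P})
    x1 x2 :
  (forall p, exists p1 p2, p = f1 p1 + f2 p2) ->
  (forall p1 p2, f1 p1 + f2 p2 = 0 -> p1 = 0 /\ p2 = 0) ->
  pclass P1 x1 -> pclass P2 x2 -> pclass P (x1 +! x2).
Proof.
move=> f_span f_free; apply: (@tclass_dsum (laut P1) (laut P2) (laut P) (lmap f1) (lmap f2)).
- exact: map_comp0.
- exact: map_comp0.
- by move=> x; apply: map_shift.
- by move=> x; apply: map_shift.
- move=> z; elim/lau_ind: z => [|k p|x y [x1' [x2' ->]] [y1 [y2 ->]]].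
  + by exists 0, 0; rewrite !linear0 addr0.
  + have [p1 [p2 ->]] := f_span p; exists (mono k p1), (mono k p2).
    by rewrite monoD !map_mono.
  + by exists (x1' + y1), (x2' + y2); rewrite !linearD addrACA.
- move=> x y E.
  have F k : lcoef k x = 0 /\ lcoef k y = 0.
    by apply: f_free; rewrite -!lcoef_map -lcoefD E lcoef0.
  by split; apply: lcoefP => k; rewrite lcoef0; have [] := F k.
Qed.

Section Homogenization.
Variables (F : grMod A) (P : rmodType A) (pi : {linear F -> P}).
Hypothesis pi_surj : forall p, exists x, pi x = p.
Local Notation pr k x := (hcomp (gm_compP F) k x).

(** The coefficient of t^k runs over the image under pi of the component of   *)
(** degree k; it generates the image under pi of the degree filtration of F. *)
Definition hlattice : grSub (laut P) :=
  gr_img (@homogenize_degree0 A F P pi : degree0 (N := laut P) _) (gs_top F).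

(** For y of degree j, the element pi y t^k is t^(k - j) times the             *)
(** homogenization of y.                                                     *)
Lemma hlattice_exhausts x : exists n, upn n (tspan hlattice) x.
Proof.
have st := @tspan_stable _ _ hlattice.
elim/lau_ind: x => [|k p|x y [m xm] [n yn]].
- by exists 0%N; apply: smem0.
- have [x <-] := pi_surj p; elim/(grading_ind (gm_compP F)): x => [|j x xj|x y [m xm] [n yn]].
  + by exists 0%N; rewrite linear0 mono0; apply: smem0.
  + exists `|k - j|%N; rewrite upnE iter_shift shift_mono.
    have [n nE] : exists n : nat, k + `|k - j|%N = j + n%:Z.
      have : 0 <= `|k - j|%N%:Z + (k - j).
        by rewrite abszE -[X in _ + X]opprK subr_ge0 -normrN ler_norm.
      move=> /gez0_abs E; exists `|(`|k - j|%N%:Z + (k - j))%R|%N.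
      by rewrite E [in RHS](addrC _ (k - j)) addrA [j + _]addrC subrK.
    rewrite nE -shift_mono -(homogenize_hom pi xj) -iter_shift -upnE.
    by apply: (upn_mono (leq0n n)) => //; apply: tspan_le; exists x.
  + exists (maxn m n); rewrite linearD monoD; apply: smemD.
      by apply: (upn_mono (leq_maxl m n)) xm.
    by apply: (upn_mono (leq_maxr m n)) yn.
- exists (maxn m n); apply: smemD.
    by apply: (upn_mono (leq_maxl m n)) xm.
  by apply: (upn_mono (leq_maxr m n)) yn.
Qed.

Hypothesis Ffg : finitely_generated F.

Lemma hlattice_fg : gs_fg hlattice.
Proof.
apply: gr_img_fg; have /fgP[s sP] := Ffg.
by apply/fg_smod; exists s; split=> // x _; apply: sP.
Qed.

Lemma hlattice_good : good (tspan hlattice).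
Proof. exact: tspan_good hlattice_fg hlattice_exhausts. Qed.

End Homogenization.

Lemma ungraded_cover (P : rmodType A) : finitely_generated P ->
  exists (F : grFgProj A) (pi : {linear F -> P}), forall p, exists x, pi x = p.
Proof.
move=> /fgP[s sP]; suff [F [pi piP]] : exists (F : grFgProj A) (pi : {linear F -> P}),
    forall p, lspan s p -> exists x, pi x = p.
  by exists F, pi => p; apply: piP.
elim: s {sP} => [|m s [F [pi piP]]].
  by exists (gfp_zero A), (\0 : {linear zero_mod A -> P}) => p ->; exists 0.
exists (gfp_dsum (gfp_reg A) F), (mklin (copair_linear (orbit_map m) pi)).
by move=> p [a [y [/piP[x <-] ->]]]; exists (a, x).
Qed.

Lemma pclass_ex (P : rmodType A) : finitely_generated P -> exists x, pclass P x.
Proof.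
move=> /ungraded_cover[F [pi piS]].
have G := hlattice_good piS (gfp_fg F).
have [x Rx] := lattice_chi lam (good_lattice G).
by exists x, (tspan (hlattice pi)).
Qed.

Section Graded.
Variable P : grFgProj A.
Local Notation pr k x := (hcomp (gm_compP P) k x).

(** The coefficient of t^k lies in the sum of the components of degree at most *)
(** k.                                                                       *)
Definition lower_sub : submodule (laut P).
Proof.
exists (fun x : lau_mod P => forall k j, (k < j)%R -> pr j (lcoef k x) = 0).
- by move=> k j _; rewrite lcoef0 hcomp0.
- by move=> x y Hx Hy k j kj; rewrite lcoefD hcompD Hx // Hy // addr0.
- move=> a x Hx k j kj; elim/grA_ind: a => [|i a ai|a b Ha Hb].
  + by rewrite scale0r lcoef0 hcomp0.
  + rewrite (lcoef_hom _ _ ai) -[j](subrK i) hcompZ // Hx ?scaler0 //.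
    by rewrite ltrD2r.
  + by rewrite scalerDl lcoefD hcompD Ha Hb addr0.
Defined.

Fact lower_hcomp k x : lower_sub x -> lower_sub (hcomp (gm_compP (laut P)) k x).
Proof.
move=> Hx i j ij; rewrite [lcoef _ _]lcoef_hcomp; case: eqP => _; last exact: hcomp0.
exact: Hx.
Qed.

Definition lower : grSub (laut P) := GrSub lower_hcomp.

(** The filtration of P by degree is good, and its associated graded module is *)
(** P: here V is isomorphic to P and meets tR trivially, as the coefficients *)
(** of t^k in tR have degrees below k.                                       *)
Lemma pclass_graded : pclass P (lam P).
Proof.
pose h : {linear P -> laut P} := homogenize (idfun : {linear P -> P}).
have h0 : degree0 h := @homogenize_degree0 A P P idfun.
have hE k x : lcoef k (h x) = pr k x by apply: lcoef_homogenize.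
have G : good (tspan (hlattice (idfun : {linear P -> P}))).
  by apply: hlattice_good (gfp_fg P) => p; exists p.
set V := hlattice _ in G; exists (tspan V); split=> //; exists V.
have Vfg : gs_fg V by apply: hlattice_fg; apply: gfp_fg.
have h_inj : injective h.
  move=> x y hxy; apply/eqP; rewrite -subr_eq0; apply/eqP.
  apply: (@hcomp_eq0 _ _ (gm_compP P)) => k.
  by rewrite -hE linearB hxy subrr lcoef0.
have E0 : chis lam (gs_meet V (tS (tspan V))) = am_zero H.
  rewrite -(lam0 lam_iso lam_dsum) /chis; apply: (@chi_eq _ Anoeth Areg _ _ lam_iso lam_dsum 0).
    by apply: (gs_fg_le Anoeth _ Vfg) => x [].
  exists (gfp_zero A) => //.
  apply: (@gr_iso_bij _ (gr_zero A) _ (\0 : {linear zero_mod A -> _})).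
  - by move=> k x _; apply: gm_comp0.
  - by move=> x y _; rewrite (zero_modE x) (zero_modE y).
  move=> y; exists 0; apply: (@gs_val_inj _ _ (gs_meet V (tS (tspan V)))).
  rewrite linear0; have [[q _ <-] tV] := gs_valP y.
  have lq : lower (tinv (h q)).
    apply: tV => [x|_ [x _ <-] k j kj] /=.
      move=> Hx k j kj; have := Hx (k - 1) j; rewrite lcoef_shift opprK subrK; apply.
      by apply: lt_trans kj; rewrite ltrBlDr ltrDl.
    rewrite -/h hE (hcomp_other _ _ (hcomp_hom _ k x)).
    by case: eqP kj => // ->; rewrite ltxx.
  suff -> : q = 0 by rewrite !linear0.
  apply: (@hcomp_eq0 _ _ (gm_compP P)) => k.
  have := lq (k - 1) k; rewrite [lcoef _ _]lcoef_shift opprK subrK -/h hE.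
  rewrite (hcomp_id _ (hcomp_hom _ _ _)); apply.
  by rewrite ltrBlDr ltrDl.
have E1 : chis lam V = lam P.
  rewrite /chis; apply: (@chi_eq _ Anoeth Areg _ _ lam_iso lam_dsum 0) => //.
  exists P => //.
  have [|g [g0 gE]] := gs_corestr (S := V) h0; first by move=> x; exists x.
  apply: (gr_iso_bij g0) => [x y|y].
    by move=> /(congr1 (@gs_val _ _ V)); rewrite !gE => /h_inj.
  have [x _ xE] := gs_valP y; exists x.
  by apply: (@gs_val_inj _ _ V); rewrite gE.
split=> //; first exact: tspan_le.
  apply: good_step; [exact: tspan_le|exact: tspan_stable|].
  by move=> S tSS VS x Hx; apply: Hx.
by rewrite E0 E1 ag_addr0.
Qed.

End Graded.
End Classes.

(** * Ungraded modules as modules concentrated in degree zero *)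

Definition in_degree0 (V : zmodType) (k : int) (x : V) : Prop := k != 0 -> x = 0.

Fact in_degree0_grading (V : zmodType) : direct_grading (@in_degree0 V).
Proof.
split=> [k _|k x y xk yk k0|x|s f us fG f0 k ks] //.
- by rewrite xk // yk // subr0.
- exists [:: x]; rewrite big_seq1; split=> // y; rewrite inE => /eqP->.
  by exists 0; rewrite /in_degree0 eqxx.
- have [k0|] := eqVneq k 0; last exact: fG.
  rewrite -f0 (big_rem k) //= big_seq big1 ?addr0 // => i.
  rewrite mem_rem_uniq // inE k0 => /andP[i0 _]; exact: fG.
Qed.

Section Ungraded.
Variable A : grRing.

Fact triv_comp1 : in_degree0 0 (1 : A). Proof. by rewrite /in_degree0 eqxx. Qed.

Fact triv_compM i j (a b : A) :
  in_degree0 i a -> in_degree0 j b -> in_degree0 (i + j) (a * b).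
Proof.
move=> ai bj ij; have [i0|/ai->] := eqVneq i 0; last by rewrite mul0r.
by rewrite (bj _) ?mulr0 //; apply: contraNneq ij => ->; rewrite i0.
Qed.

(** A with all its elements in degree zero. Over it, the Euler characteristics *)
(** of graded modules specialize to those of ungraded A-modules.             *)
Definition triv_ring : grRing :=
  @GrRing (gr_ring A) _ (in_degree0_grading A) triv_comp1 triv_compM.

Fact conc_scale (M : rmodType A) i j (m : M) (a : A) :
  in_degree0 i m -> in_degree0 j a -> in_degree0 (i + j) ((a : A^c) *: m).
Proof.
move=> mi aj ij; have [i0|/mi->] := eqVneq i 0; last by rewrite scaler0.
by rewrite (aj _) ?scale0r //; apply: contraNneq ij => ->; rewrite i0.
Qed.

Definition conc (M : rmodType A) : grMod triv_ring :=
  @GrMod triv_ring M _ (in_degree0_grading M) (@conc_scale M).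

Lemma conc_degree0 (M N : rmodType A) (f : {linear M -> N}) :
  degree0 (M := conc M) (N := conc N) f.
Proof. by move=> k x xk k0; rewrite xk // linear0. Qed.

(** A lift of an ungraded map becomes homogeneous after projection to the     *)
(** component of degree zero, which is linear over the trivially graded ring. *)
Lemma conc_projective (P : rmodType A) : projective P -> gr_projective (conc P).
Proof.
move=> PP N L p f p0 f0 pS; have [g gE] := PP N L p f pS.
pose pr := hcomp (gm_compP N).
have prL : linear (fun x : N => pr 0 x).
  move=> a x y; rewrite /pr hcompD; congr (_ + _).
  have a0 : @gr_comp triv_ring 0 a by rewrite /= /in_degree0 eqxx.
  by rewrite -[X in hcomp _ X](addr0 0) (hcompZ a0).
exists (mklin prL \o g); split=> [k x xk|x] /=.
  have [->|/xk->] := eqVneq k 0; first exact: hcomp_hom.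
  by rewrite linear0 /pr hcomp0; apply: gm_comp0.
rewrite /pr -(degree0_hcomp p0) gE hcomp_id //; apply: f0.
by rewrite /= /in_degree0 eqxx.
Qed.

Definition conc_proj (P : fgProj A) : grFgProj triv_ring :=
  @GrFgProj triv_ring (conc P) (fgp_fg P) (conc_projective (@fgp_proj _ P)).

Definition forget (B : grRing) (P : grFgProj B) : fgProj B :=
  FgProj (gfp_fg P) (@gfp_projective B P).

Definition K0_class (P : fgProj A) : K0 A := @gc_class (K0_monoid A) (cls (@fgp_iso A) P).

Lemma gc_classD (M : abMonoid) (a b : M) :
  gc_class (am_add a b) = gc_class a +! gc_class b.
Proof.
rewrite /gc_class [RHS](quot_addE (@gc_equiv M) (@gc_addR M)) /gc_add /=.
by rewrite am_add0.
Qed.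

Lemma K0_class_iso P Q : fgp_iso P Q -> K0_class P = K0_class Q.
Proof. by move=> PQ; congr gc_class; apply/(clsP (@fgp_iso_equiv A)). Qed.

Lemma K0_class_dsum P Q : K0_class (fgp_dsum P Q) = K0_class P +! K0_class Q.
Proof.
rewrite /K0_class -gc_classD; congr gc_class.
by rewrite [RHS](quot_addE (@fgp_iso_equiv A) (@fgp_dsum_iso A)).
Qed.

Definition triv_class (P : grFgProj triv_ring) : K0 A := K0_class (forget P).

Lemma triv_class_iso P Q : gfp_iso P Q -> triv_class P = triv_class Q.
Proof. by move=> [f [g [_ _ fK gK]]]; apply: K0_class_iso; exists f, g. Qed.

Lemma triv_class_dsum P Q :
  triv_class (gfp_dsum P Q) = triv_class P +! triv_class Q.
Proof.
by rewrite -K0_class_dsum; apply: K0_class_iso; exists idfun, idfun.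
Qed.

Section Transport.
Variables (H : abGroup) (lam : grFgProj A -> H) (phi : H -> K0 A).
Hypothesis phiD : forall x y, phi (x +! y) = phi x +! phi y.
Hypothesis phi_lam : forall P, phi (lam P) = K0_class (forget P).

Lemma euler_conc n (M : grMod A) x :
  euler lam n M x -> euler triv_class n (conc M) (phi x).
Proof.
have E (P : grFgProj A) : phi (lam P) = triv_class (conc_proj (forget P)).
  by rewrite phi_lam; apply: K0_class_iso; exists idfun, idfun.
elim: n => [|n IHn] in M x *.
  move=> [P [f [g [_ _ fK gK]]] ->]; exists (conc_proj (forget P)) => //.
  by exists f, g; split=> //; apply: conc_degree0.
move=> [P [K [y [[i [p [_ _ i_inj pS ip]]] Ky xy]]]].
exists (conc_proj (forget P)), (conc K), (phi y); split; last by rewrite -phiD xy.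
  by exists i, p; split=> //; apply: conc_degree0.
exact: IHn.
Qed.

End Transport.

(** * The Rees sequence of an ungraded projective module *)

(** The value at t = 1. *)
Definition dehom (P : rmodType A) (x : lau_mod P) : P :=
  glue (gm_compP (lau P)) (@lcoef A P) x.

Section Dehomogenization.
Variable P : rmodType A.

Lemma dehomD (x y : lau_mod P) : dehom (x + y) = dehom x + dehom y.
Proof. exact: (glueD _ (@lcoefB A P)). Qed.

Lemma dehom0 : dehom (0 : lau_mod P) = 0.
Proof. exact: (glue0 _ (@lcoefB A P)). Qed.

Lemma dehom_mono k (p : P) : dehom (mono k p) = p.
Proof.
apply: (etrans (glue_hom (gm_compP (lau P)) (@lcoefB A P) (@mono_comp A P k p))).
by rewrite lcoef_mono eqxx.
Qed.

Lemma scale_mono i (a : A) k (p : P) :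
  gr_comp i a -> (a : A^c) *: mono k p = mono (k + i) ((a : A^c) *: p).
Proof.
move=> ai; apply: lcoefP => j; rewrite (lcoef_hom _ _ ai) !lcoef_mono subr_eq.
by case: eqP; rewrite ?scaler0.
Qed.

Fact dehom_linear : linear (@dehom P).
Proof.
move=> a x y; rewrite dehomD; congr (_ + _).
elim/grA_ind: a => [|i a ai|a b Ha Hb].
- by rewrite !scale0r dehom0.
- elim/lau_ind: x => [|k p|u v Hu Hv]; first by rewrite scaler0 dehom0 scaler0.
    by rewrite (scale_mono _ _ ai) !dehom_mono.
  by rewrite scalerDr !dehomD scalerDr Hu Hv.
- by rewrite !scalerDl dehomD Ha Hb.
Qed.

Definition dehom_map : {linear lau_mod P -> P} := mklin dehom_linear.

Lemma dehom_shift n x : dehom_map (tpow n x) = dehom_map x.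
Proof.
elim/lau_ind: x => [|k p|x y Hx Hy]; first by rewrite !linear0.
  by rewrite shift_mono /= !dehom_mono.
by rewrite !linearD Hx Hy.
Qed.

(** Multiplication by 1 - t. *)
Definition bdiff : {linear lau_mod P -> lau_mod P} :=
  idfun \- tpow 1.

Lemma bdiffE x : bdiff x = x - tpow 1 x. Proof. by []. Qed.

Lemma int_lbound (s : seq int) : exists m : int, forall k, k \in s -> m <= k.
Proof.
elim: s => [|k s [m ms]]; first by exists 0.
exists (Num.min k m) => j; rewrite inE => /predU1P[->|/ms mj].
  by rewrite ge_min lexx.
by rewrite ge_min mj orbT.
Qed.

(** The coefficients of a kernel element are all equal, and almost all vanish. *)
Lemma bdiff_inj : injective bdiff.
Proof.
suff bdiff0 x : bdiff x = 0 -> x = 0.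
  move=> x y xy; apply/eqP; rewrite -subr_eq0; apply/eqP/bdiff0.
  by rewrite linearB xy subrr.
rewrite bdiffE => /eqP; rewrite subr_eq0 => /eqP xt.
apply: lcoefP => k; rewrite lcoef0.
have xn (n : nat) : lcoef k x = lcoef (k - n%:Z) x.
  elim: n => [|n IHn]; first by rewrite subr0.
  by rewrite IHn [in LHS]xt lcoef_shift intS [1 + _]addrC opprD addrA.
have [s sP] := lau_supp x; have [m ms] := int_lbound s.
rewrite (xn (`|k - m|.+1)%N) sP //; apply/negP => /ms.
lia.
Qed.

End Dehomogenization.

Section Rees.
Variables (F : grMod A) (P : rmodType A) (pi : {linear F -> P}).
Hypothesis Ffg : finitely_generated F.
Hypothesis pi_surj : forall p, exists x, pi x = p.
Local Notation V := (hlattice pi).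
Local Notation h := (homogenize pi).
Local Notation pr k x := (hcomp (gm_compP F) k x).

(** V + tV + ... + t^n V *)
Fixpoint rees n : grSub (laut P) :=
  if n is m.+1 then gs_join V (tS (rees m)) else V.

Lemma rees_t n x : rees n x -> rees n.+1 (tpow 1 x).
Proof.
move=> nx; exists 0, (tpow 1 x); split; rewrite ?add0r //; first exact: smem0.
by rewrite tSE (tactK (x : laut P)).
Qed.

Lemma rees0 n : gs_le V (rees n).
Proof. by case: n => // n; apply: gs_joinl. Qed.

Lemma rees_succ n : gs_le (rees n) (rees n.+1).
Proof.
elim: n => [|n IHn]; first exact: rees0.
by move=> _ [x [y [Vx ny ->]]]; exists x, y; split=> //; rewrite tSE; apply: IHn.
Qed.

Lemma rees_le m n : (m <= n)%N -> gs_le (rees m) (rees n).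
Proof.
move=> /subnKC<-; elim: (n - m)%N => [|k IHk] x; rewrite ?addn0 // addnS.
by move=> /IHk/rees_succ.
Qed.

Lemma rees_fg n : gs_fg (rees n).
Proof.
elim: n => [|n IHn]; first exact: hlattice_fg.
by apply: gs_fg_join; [apply: hlattice_fg|apply: tS_fg].
Qed.

Lemma hV x : V (h x). Proof. by exists x. Qed.

Lemma dehom_h x : dehom_map P (h x) = pi x.
Proof.
elim/(grading_ind (gm_compP F)): x => [|k x xk|x y Hx Hy]; first by rewrite !linear0.
  by rewrite (homogenize_hom pi xk) /= dehom_mono.
by rewrite !linearD Hx Hy.
Qed.

(** t^i v and v differ by a multiple of 1 - t, so modulo (1 - t) (rees n) only *)
(** elements of V remain.                                                    *)
Lemma rees_decomp n z : rees n.+1 z ->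
  exists x y, rees n y /\ z = bdiff P y + h x.
Proof.
have step m w x0 x1 y : rees m y -> rees m w -> w = bdiff P y + h x1 ->
    exists x y', rees m y' /\ h x0 + tpow 1 w = bdiff P y' + h x.
  move=> my mw wE; exists (x0 + x1), (y - w); split; first exact: smemB.
  have yE : bdiff P y = w - h x1 by rewrite wE addrK.
  rewrite linearB linearD yE bdiffE opprB [w - _ + _]addrC [_ - w + _]addrA subrK.
  by rewrite addrCA subrK.
elim: n z => [|n IHn] _ [_ [w [[x0 _ <-] nw ->]]]; rewrite tSE in nw.
  have -> : w = tpow 1 (tinv (w : laut P)) by rewrite (tinvK (w : laut P)).
  have [x1 _ wE] := nw; apply: (step 0%N _ _ x1 0) => //; first exact: smem0.
  by rewrite linear0 add0r wE.
have -> : w = tpow 1 (tinv (w : laut P)) by rewrite (tinvK (w : laut P)).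
have [x1 [y [ny wE]]] := IHn _ nw.
by apply: (step n.+1 _ _ x1 y) => //; apply: rees_succ.
Qed.

Lemma bdiff_geometric n m k : rees 0 m -> (n <= k)%N ->
  exists2 y, rees k y & m - tpow n%:Z m = bdiff P y.
Proof.
move=> Vm; elim: n k => [|n IHn] k.
  by exists 0; [apply: smem0|rewrite shift0 subrr linear0].
case: k => // k /IHn[y ky yE]; exists (m + tpow 1 y).
  by apply: smemD; [apply: rees0|apply: rees_t].
have tyE : tpow 1 y - tpow 1 (tpow 1 y) = tpow 1 m - tpow 1 (tpow n%:Z m).
  by rewrite -!linearB yE bdiffE.
by rewrite linearD !bdiffE tyE shift_add -intS addrA subrK.
Qed.

(** Let -m bound the degrees of x. Each homogenized component h x_k agrees, up *)
(** to a multiple of 1 - t, with t^(-m - k) (h x_k) = (pi x_k) t^-m, and these *)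
(** add up to (pi x) t^-m = 0.                                               *)
Lemma rees_relation x : pi x = 0 -> exists n y, rees n y /\ h x = bdiff P y.
Proof.
move=> px; set s := hsupp (gm_compP F) x.
have [m ms] := int_lbound [seq - k | k <- s].
have step (u : seq int) : (forall k, k \in u -> m <= - k) ->
    exists n y, rees n y /\
      h (\sum_(k <- u) pr k x) = bdiff P y + mono (- m) (pi (\sum_(k <- u) pr k x)).
  elim: u => [_|k u IHu um].
    exists 0%N, 0; rewrite !big_nil !linear0 mono0 addr0; split=> //.
    exact: (@smem0 _ _ V).
  have [|n [y [ny yE]]] := IHu; first by move=> j ju; apply: um; rewrite inE ju orbT.
  have mk := um k (mem_head _ _); set i := `|- k - m|%N.
  have Vk : rees 0 (h (pr k x)) by apply: hV.
  have [z nz zE] := bdiff_geometric Vk (leqnn i).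
  exists (maxn i n), (z + y); split.
    by apply: smemD; [apply: rees_le nz; apply: leq_maxl|apply: rees_le ny; apply: leq_maxr].
  rewrite !big_cons !linearD yE monoD addrACA -zE; congr (_ + _).
  rewrite (homogenize_hom pi (hcomp_hom _ k x)) shift_mono.
  have -> : k + i%:Z = - m by rewrite /i; lia.
  by rewrite subrK.
have [|n [y [ny]]] := step s; first by move=> k ks; apply/ms/map_f.
rewrite -(hcomp_sum (gm_compP F) x) px mono0 addr0 => E.
by exists n, y.
Qed.

(** The maps are multiplication by 1 - t and evaluation at t = 1. As P is       *)
(** projective, the kernel of pi is finitely generated, so one n serves all its *)
(** elements in [rees_relation].                                             *)
Lemma rees_ses : projective P -> exists n,
  ses (conc (grsub_mod (rees n))) (conc (grsub_mod (rees n.+1))) (conc P).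
Proof.
move=> PP; have [s sE] := PP F P pi (idfun : {linear P -> P}) pi_surj.
have [e eP] := proj1 (fgP F) Ffg.
pose r : {linear F -> F} := idfun \- (s \o pi).
have pir x : pi (r x) = 0 by rewrite /= linearB sE subrr.
have [n nP] : exists n, forall m, m \in map r e -> exists2 y, rees n y & bdiff P y = h m.
  elim: e {eP} => [|x e [n IHe]]; first by exists 0%N.
  have [k [y [ky yE]]] := rees_relation (pir x).
  exists (maxn k n) => m; rewrite inE => /predU1P[->|/IHe[z nz zE]].
    by exists y => //; apply: rees_le ky; apply: leq_maxl.
  by exists z => //; apply: rees_le nz; apply: leq_maxr.
have kerP x : pi x = 0 -> exists2 y, rees n y & bdiff P y = h x.
  move=> px; have xr : lspan (map r e) x.
    have -> : x = r x by rewrite /= px linear0 subr0.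
    exact: lspan_map.
  have /(lspan_map h) := xr.
  pose I : submodule (laut P) := @img_sub A (laut P) (laut P) (bdiff P) (rees n).
  by apply: (@lspan_min _ _ _ I) => _ /mapP[m /nP[y ny yE] ->]; exists y.
have d_rees x : rees n x -> rees n.+1 (bdiff P x).
  by move=> nx; rewrite bdiffE; apply: smemB; [apply: rees_succ|apply: rees_t].
have [||i iE] := factor_inj (i := gs_val (S := rees n.+1))
  (f := bdiff P \o gs_val (S := rees n)).
- exact: gs_val_inj.
- by move=> x; apply/gs_val_surj/d_rees/gs_valP.
exists n, i, (dehom_map P \o gs_val (S := rees n.+1)); split.
- exact: conc_degree0.
- exact: conc_degree0.
- move=> x y /(congr1 (@gs_val _ _ (rees n.+1))); rewrite !iE => /bdiff_inj.
  by move=> /(@gs_val_inj _ _ (rees n)).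
- move=> p; have [x <-] := pi_surj p.
  have /gs_val_surj[y yE] : rees n.+1 (h x) by apply/rees0/hV.
  by exists y; rewrite /= yE -dehom_h.
move=> x; split=> [x1|[y <-]]; last first.
  by rewrite [LHS](congr1 (dehom_map P) (iE y)) linearB dehom_shift subrr.
have [z [y [ny xE]]] := rees_decomp (gs_valP x).
have /kerP[w nw wE] : pi z = 0.
  rewrite -dehom_h -x1 [RHS](congr1 (dehom_map P) xE) linearD bdiffE linearB.
  by rewrite dehom_shift subrr add0r.
have /gs_val_surj[v vE] := smemD ny nw.
exists v; apply: (@gs_val_inj _ _ (rees n.+1)).
by rewrite iE /= vE [RHS]xE -wE -linearD.
Qed.

End Rees.
End Ungraded.

(** * Universal properties of the Grothendieck groups *)

Definition additive_map (M N : abMonoid) (f : M -> N) : Prop :=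
  forall x y, f (x +! y) = f x +! f y.

Lemma additive_map0 (M : abMonoid) (G : abGroup) (f : M -> G) :
  additive_map f -> f (am_zero M) = am_zero G.
Proof.
move=> fD; apply: (@ag_addI _ (f (am_zero M))).
by rewrite -fD am_add0 ag_addr0.
Qed.

Section GroupCompletionLift.
Variables (M : abMonoid) (G : abGroup) (h : M -> G).
Hypothesis hD : additive_map h.

Definition gc_lift (x : group_completion M) : G := ag_sub (h (rep x).1) (h (rep x).2).

Lemma gc_lift_cls p : gc_lift (cls (@gc_eq M) p) +! h p.2 = h p.1.
Proof.
have [k] := rep_cls (@gc_equiv M) p; rewrite /gc_lift.
move: (rep _) => r /(congr1 h); rewrite !hD => /ag_addIr E.
apply: (@ag_addIr _ (h r.2)).
by rewrite -E -am_addA (am_addC (h p.2)) am_addA ag_subK.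
Qed.

Lemma gc_liftD : additive_map gc_lift.
Proof.
move=> x y; rewrite -(repK x) -(repK y); move: (rep x) (rep y) => p q.
rewrite [_ +! _](quot_addE (@gc_equiv M) (@gc_addR M)).
apply: (@ag_addIr _ (h (gc_add p q).2)); rewrite gc_lift_cls /= !hD.
by rewrite ag_addACA !gc_lift_cls.
Qed.

Lemma gc_lift_class a : gc_lift (gc_class a) = h a.
Proof. by have := gc_lift_cls (a, am_zero M); rewrite /= (additive_map0 hD) ag_addr0. Qed.

End GroupCompletionLift.

Lemma gc_difference (M : abMonoid) (x : group_completion M) :
  exists a b, x +! gc_class b = gc_class a.
Proof.
rewrite -(repK x); case: (rep x) => a b; exists a, b.
rewrite [LHS](quot_addE (@gc_equiv M) (@gc_addR M)); apply/(clsP (@gc_equiv M)).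
by exists (am_zero M); rewrite /= !am_addA.
Qed.

Section QuotientLift.
Variables (G G' : abGroup) (S : G -> Prop) (Ss : is_subgroup S).

Definition quotg_cls (x : G) : quotient_group Ss := cls (cong S) x.

Lemma quotg_clsD : additive_map quotg_cls.
Proof. by move=> x y; rewrite [RHS](quot_addE (cong_equiv Ss) (cong_addR Ss)). Qed.

Lemma quotg_clsP x y : S (ag_sub x y) -> quotg_cls x = quotg_cls y.
Proof. by move=> Sxy; apply/(clsP (cong_equiv Ss)). Qed.

Lemma quotg_surj (q : quotient_group Ss) : exists x, quotg_cls x = q.
Proof. by exists (rep q); apply: repK. Qed.

Variable f : G -> G'.
Hypotheses (fD : additive_map f) (fS : forall x, S x -> f x = am_zero G').

Definition quotg_lift (q : quotient_group Ss) : G' := f (rep q).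

Lemma quotg_liftE x : quotg_lift (quotg_cls x) = f x.
Proof.
have /fS := rep_cls (cong_equiv Ss) x => E.
by rewrite /quotg_lift -[LHS](congr1 f (ag_subK _ x)) fD E am_add0.
Qed.

Lemma quotg_liftD : additive_map quotg_lift.
Proof.
move=> p q; have [x <-] := quotg_surj p; have [y <-] := quotg_surj q.
by rewrite -quotg_clsD !quotg_liftE fD.
Qed.

End QuotientLift.

Lemma additive_map_ker (G G' : abGroup) (f : G -> G') (S : G -> Prop) :
  additive_map f -> (forall x, S x -> f x = am_zero G') ->
  forall x, subgroup_gen S x -> f x = am_zero G'.
Proof.
move=> fD fS x Sx; apply: (Sx (fun y => f y = am_zero G')) => //; split=> [|y z fy fz]; first exact: additive_map0.
by apply: (@ag_addIr _ (f z)); rewrite -fD ag_subK fy fz am_add0.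
Qed.

(** Additive maps are determined by their values on the classes g P, k P, since *)
(** every element is a difference of two of them.                            *)
Lemma additive_isomorphic (G K : abGroup) (T U : Type) (g : T -> G) (k : U -> K)
    (phi : G -> K) (psi : K -> G) :
    additive_map phi -> additive_map psi ->
    (forall q, exists P Q, q +! g Q = g P) -> (forall y, exists P Q, y +! k Q = k P) ->
    (forall P, psi (phi (g P)) = g P) -> (forall P, exists q, phi q = k P) ->
  ag_isomorphic G K.
Proof.
move=> phiD psiD gE kE phiK phiS; have {}phiK : cancel phi psi.
  move=> q; have [P [Q E]] := gE q.
  by apply: (@ag_addIr _ (g Q)); rewrite E -[g Q]phiK -psiD -phiD E phiK.
exists phi; split=> //; exists psi => // y.
have [P [Q E]] := kE y; have [p pE] := phiS P; have [q qE] := phiS Q.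
have <- : phi (ag_sub p q) = y; last by rewrite phiK.
by apply: (@ag_addIr _ (phi q)); rewrite -phiD ag_subK pE qE E.
Qed.

(** * The isomorphism *)

Section Main.
Variable A : grRing.

Definition shift_quotient : abGroup := quotient_group (subgroup_genP (@shift_diff A)).

Definition gr_class (P : grFgProj A) : shift_quotient :=
  quotg_cls (subgroup_genP (@shift_diff A)) (K0gr_class P).

Lemma gr_class_iso P Q : gfp_iso P Q -> gr_class P = gr_class Q.
Proof.
by move=> PQ; congr (quotg_cls _ (gc_class _)); apply/(clsP (@gfp_iso_equiv A)).
Qed.

Lemma gr_class_dsum P Q : gr_class (gfp_dsum P Q) = gr_class P +! gr_class Q.
Proof.
rewrite /gr_class -quotg_clsD; congr (quotg_cls _ _).
rewrite /K0gr_class -gc_classD; congr gc_class.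
by rewrite [RHS](quot_addE (@gfp_iso_equiv A) (@gfp_dsum_iso A)).
Qed.

Lemma gr_class_shift1 P : gr_class (gfp_shift P 1) = gr_class P.
Proof. by apply: quotg_clsP => S _ HS; apply: HS; exists P. Qed.

Lemma gfp_shift_add (P : grFgProj A) m n :
  gfp_iso (gfp_shift (gfp_shift P m) n) (gfp_shift P (m + n)).
Proof. by exists idfun, idfun; split=> // k x /=; rewrite addrA. Qed.

Lemma gr_class_shift P n : gr_class (gfp_shift P n) = gr_class P.
Proof.
have shiftS Q m : gr_class (gfp_shift Q (m + 1)) = gr_class (gfp_shift Q m).
  by rewrite -[RHS]gr_class_shift1; apply/esym/gr_class_iso/gfp_shift_add.
have shift0 Q : gr_class (gfp_shift Q 0) = gr_class Q.
  by apply: gr_class_iso; exists idfun, idfun; split=> // k x /=; rewrite add0r.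
elim/int_rec: n => [|n IHn|n IHn]; first exact: shift0.
  by rewrite intS addrC shiftS.
by rewrite -shiftS -IHn; congr (gr_class (gfp_shift _ _)); lia.
Qed.

Lemma forget_map : exists phi : shift_quotient -> K0 A,
  additive_map phi /\ forall P, phi (gr_class P) = K0_class (forget P).
Proof.
pose f (C : K0gr_monoid A) : K0 A := K0_class (forget (rep C)).
have fE P : f (cls (@gfp_iso A) P) = K0_class (forget P).
  have [g [g' [_ _ gK gK']]] := rep_cls (@gfp_iso_equiv A) P.
  by apply: K0_class_iso; exists g, g'.
have fD : additive_map f.
  move=> C D; rewrite -(repK C) -(repK D) [_ +! _](quot_addE (@gfp_iso_equiv A) (@gfp_dsum_iso A)).
  by rewrite !fE -K0_class_dsum; apply: K0_class_iso; exists idfun, idfun.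
have hD := gc_liftD fD.
have hE P : gc_lift f (K0gr_class P) = K0_class (forget P).
  by rewrite (gc_lift_class fD).
have hS x : subgroup_gen (@shift_diff A) x -> gc_lift f x = am_zero (K0 A).
  apply: (additive_map_ker hD) => _ [P ->].
  apply: (@ag_addIr _ (gc_lift f (K0gr_class P))).
  rewrite -hD ag_subK am_add0 !hE.
  by apply: K0_class_iso; exists idfun, idfun.
exists (quotg_lift (gc_lift f)); split; first exact: quotg_liftD.
by move=> P; rewrite quotg_liftE.
Qed.

Lemma gr_class_difference (q : shift_quotient) :
  exists P Q, q +! gr_class Q = gr_class P.
Proof.
have [x <-] := quotg_surj q; have [a [b E]] := gc_difference x.
exists (rep a), (rep b); rewrite -quotg_clsD /gr_class; congr (quotg_cls _ _).
by rewrite /K0gr_class !repK.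
Qed.

Lemma K0_difference (y : K0 A) : exists P Q, y +! K0_class Q = K0_class P.
Proof.
have [a [b E]] := gc_difference y; exists (rep a), (rep b).
by rewrite /K0_class !repK.
Qed.

Hypotheses (Anoeth : gr_right_noetherian A) (Areg : gr_right_regular A).

Local Notation pc := (pclass gr_class).
Let pc_uniq := pclass_uniq Anoeth Areg gr_class_iso gr_class_dsum gr_class_shift.
Let pc_dsum := pclass_dsum Anoeth Areg gr_class_iso gr_class_dsum.

(** [P] goes to the class of gr P for any good filtration of P. *)
Lemma associated_graded_map : exists psi : K0 A -> shift_quotient,
  additive_map psi /\ forall P : grFgProj A, psi (K0_class (forget P)) = gr_class P.
Proof.
have ex (P : fgProj A) : exists x, pc P x by apply: pclass_ex (fgp_fg P).
pose c P := projT1 (cid (ex P)).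
have cP (P : fgProj A) : pc P (c P) := projT2 (cid (ex P)).
have pc0 : pc (zero_mod A) (am_zero shift_quotient).
  have z := cP (fgp_zero A).
  suff : c (fgp_zero A) = am_zero _ by move=> <-.
  apply: (@ag_addI _ (c (fgp_zero A))); rewrite ag_addr0; apply: esym; apply: (pc_uniq z).
  apply: (@pc_dsum _ _ (zero_mod A) idfun idfun) (z) (z).
    by move=> p; exists p, 0; rewrite addr0.
  by move=> p q _; rewrite (zero_modE p) (zero_modE q).
have c_iso (P Q : fgProj A) : fgp_iso P Q -> c P = c Q.
  move=> [f [g [fK gK]]]; apply/esym; apply: pc_uniq (cP Q) _.
  rewrite -[c P]ag_addr0.
  apply: (@pc_dsum _ _ Q f (\0 : {linear zero_mod A -> Q})) (cP P) pc0.
    by move=> q; exists (g q), 0; rewrite /= gK addr0.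
  move=> p z /=; rewrite addr0 => fp; rewrite (zero_modE z); split=> //.
  by apply: (can_inj fK); rewrite fp linear0.
have c_dsum (P Q : fgProj A) : c (fgp_dsum P Q) = c P +! c Q.
  apply: pc_uniq (cP _) _.
  apply: (@pc_dsum _ _ _ (mklin (@inl_linear A P Q)) (mklin (@inr_linear A P Q))) (cP P) (cP Q).
    by move=> [p q]; exists p, q; congr (_, _); rewrite /= ?addr0 ?add0r.
  by move=> p q [/=]; rewrite addr0 add0r.
pose h (C : K0_monoid A) := c (rep C).
have hE P : h (cls (@fgp_iso A) P) = c P by apply/c_iso/(rep_cls (@fgp_iso_equiv A)).
have hD : additive_map h.
  move=> C D; rewrite -(repK C) -(repK D) [_ +! _](quot_addE (@fgp_iso_equiv A) (@fgp_dsum_iso A)).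
  by rewrite !hE.
exists (gc_lift h); split; first exact: gc_liftD.
move=> P; rewrite (gc_lift_class hD) hE; apply: pc_uniq (cP _) _.
exact: (pclass_graded Anoeth Areg gr_class_iso gr_class_dsum).
Qed.

(** The sequence of [rees_ses] expresses [P] as the difference of the Euler     *)
(** characteristics of two modules that come from graded ones.               *)
Lemma forget_surj (phi : shift_quotient -> K0 A) : additive_map phi ->
    (forall P, phi (gr_class P) = K0_class (forget P)) ->
  forall P, exists q, phi q = K0_class P.
Proof.
move=> phiD phiE P; have [F [pi piS]] := ungraded_cover (fgp_fg P).
have [n S] := rees_ses (gfp_fg F) piS (@fgp_proj _ P).
have fg m : gs_fg (rees pi m) by apply: rees_fg; apply: gfp_fg.
have E m : exists l, euler (@triv_class A) l (conc (grsub_mod (rees pi m)))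
    (phi (chis gr_class (rees pi m))).
  by have [l /(euler_conc phiD phiE)] := chiP Anoeth Areg gr_class (fg m); exists l.
have [l El] := E n; have [l' El'] := E n.+1.
have EP : euler (@triv_class A) 0 (conc P) (K0_class P).
  exists (conc_proj P); first exact: gr_iso_refl.
  by apply: K0_class_iso; exists idfun, idfun.
have := euler_ses (@triv_class_iso A) (@triv_class_dsum A) S El EP El'.
move=> EE; exists (ag_sub (chis gr_class (rees pi n.+1)) (chis gr_class (rees pi n))).
apply: (@ag_addIr _ (phi (chis gr_class (rees pi n)))).
rewrite -phiD ag_subK EE; exact: am_addC.
Qed.

Lemma forget_bijective : ag_isomorphic shift_quotient (K0 A).
Proof.
have [phi [phiD phiE]] := forget_map.
have [psi [psiD psiE]] := associated_graded_map.
apply: (additive_isomorphic phiD psiD gr_class_difference K0_difference).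
  by move=> P; rewrite phiE psiE.
exact: forget_surj.
Qed.

End Main.

Theorem corollary6p4p2 (A : grRing)
    (Anoeth : gr_right_noetherian A) (Areg : gr_right_regular A) :
  ag_isomorphic
    (quotient_group (subgroup_genP (@shift_diff A)))
    (K0 A).
Proof. exact: forget_bijective. Qed.
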